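(* Let $\mathcal E$, $\lambda$, $\varepsilon$, $\theta$, $n$, $f$ (depending on $\delta$, on an arbitrary $r\in\mathbb{N}$, and on suitable fixed absolute constants) be as described in the context. There are absolute constants $c_0,c_1,c_2>0$ such that the following holds. Let $0<\delta\leq c_0$ and let $A:\mathbb{R}^n\to\mathbb{R}^m$ be the standard gaussian matrix. If $$m\leq c_1\sqrt{\log(e/\delta)}\,\frac{\ell_*^2(\mathcal E)}{\delta^3},$$ then with probability at least $0.9$ there are $x,y\in\mathcal E$ such that $$\left|\sqrt{2\pi}\,\frac{\lambda}{m}\,d_H(f(x),f(y))-\|x-y\|_2\right|\geq2\delta.$$ Moreover, if $$m\geq c_2\sqrt{\log(e/\delta)}\,\frac{\ell_*^2(\mathcal E)}{\delta^3},$$ then with probability at least $0.9$ $$\sup_{x,y\in\mathcal E}\left|\sqrt{2\pi}\,\frac{\lambda}{m}\,d_H(f(x),f(y))-\|x-y\|_2\right|\leq\delta.$$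
   Context: Setting. Let $\eta>0$ be a suitable, sufficiently small absolute constant. The shift parameter $\lambda$ satisfies $\lambda\geq C\sqrt{\log(e/\delta)}$ for a suitable absolute constant $C$ and $\lambda\sim\sqrt{\log(e/\delta)}$. The parameter $\theta$ satisfies $\theta\sim\delta/\log(e\lambda/\delta)$, equivalently $\theta\sim\delta/\log(e/\delta)$, and $\varepsilon=\theta/2$, with $0<\varepsilon<\delta/2$. Here $a\sim b$ means that $c\,b\leq a\leq c'\,b$ for suitable fixed absolute constants $c,c'>0$. Let $r\in\mathbb{N}$, $I=\{1,\dots,r\}$, $J=\{r+1,\dots,\eta r/\varepsilon^2\}$ (the upper endpoint being understood as an integer), and $n=|I|+|J|$. Let $B_2^I$ and $B_2^J$ be the Euclidean unit balls supported on $\mathrm{span}(e_i:i\in I)$ and $\mathrm{span}(e_j:j\in J)$, and set $$\mathcal E=\{(x,y):x\in B_2^I,\ y\in\varepsilon B_2^J\}\subset\mathbb{R}^n.$$ The random map is $f:\mathbb{R}^n\to\{-1,1\}^m$, $f(t)=\operatorname{sign}(At+\tau)$, where $A$ has independent $N(0,1)$ entries and $\tau$ is uniformly distributed in $[-\lambda,\lambda]^m$ and independent of $A$; $\operatorname{sign}$ is applied coordinatewise with $\operatorname{sign}(a)=1$ if $a\geq0$ and $-1$ if $a<0$. $d_H$ is the Hamming distance on $\{-1,1\}^m$ (number of differing coordinates). $\ell_*(S)=\mathbb{E}\sup_{t\in S}|\langle G,t\rangle|$ with $G$ the standard gaussian vector in $\mathbb{R}^n$, and $\ell_*^2(S)=(\ell_*(S))^2$.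 ''Absolute constant'' means a positive number independent of all other parameters. *)

(* Defs.v *)
From HB Require Import structures.
From mathcomp Require Import all_boot all_order all_algebra.
From mathcomp Require Import all_classical all_reals all_analysis.
Set Implicit Arguments.
Unset Strict Implicit.
Unset Printing Implicit Defensive.
Import Order.TTheory GRing.Theory Num.Theory.
Import numFieldNormedType.Exports.
Local Open Scope classical_set_scope.
Local Open Scope ring_scope.

(* The library norm `|x| on matrices is the maximum norm, hence this one. *)
Definition l2norm (R : realType) (n : nat) (x : 'cV[R]_n) : R :=
  Num.sqrt (\sum_i x i 0 ^+ 2).

Section standard_gaussian.
Variable R : realType.

Let RR := measurableTypeR R.

Definition tuple_cons (n : nat) (p : RR * n.-tuple RR) : n.+1.-tuple RR :=
  [the n.+1.-tuple RR of p.1 :: p.2].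

Lemma measurable_tuple_cons (n : nat) :
  measurable_fun [set: RR * n.-tuple RR] (@tuple_cons n).
Proof. exact: measurable_cons. Qed.

HB.instance Definition _ (n : nat) :=
  isMeasurableFun.Build _ _ _ _ (@tuple_cons n) (@measurable_tuple_cons n).

(* The law of a standard Gaussian vector in R^n: the n-fold product of
   N(0, 1). *)
Fixpoint std_gaussian (n : nat) : probability (n.-tuple RR) R :=
  match n with
  | 0 => \d_([tuple] : 0.-tuple RR)
  | n'.+1 =>
    distribution (normal_prob (0 : R) 1 \x std_gaussian n')%E
      (@tuple_cons n' : {mfun _ >-> _})
  end.

End standard_gaussian.

(* ell_* (S) = E sup_(t in S) |<G, t>|, with G standard Gaussian in R^n. *)
Definition ell_star (R : realType) (n : nat) (S : set 'cV[R]_n) : \bar R :=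
  (\int[std_gaussian R n]_g
     ereal_sup [set (`|\sum_i tnth g i * t i 0|%R)%:E | t in S])%E.

(* The cardinality of J = {r+1, ..., N}, where N is the integer part of
   eta r / eps^2. *)
Definition cardJ (R : realType) (eta eps : R) (r : nat) : nat :=
  (Num.truncn (eta * r%:R / eps ^+ 2) - r)%N.

(* The first r coordinates are those of I, the last k those of J. *)
Definition ellipsoid (R : realType) (r k : nat) (eps : R) :
    set 'cV[R]_(r + k) :=
  [set t | l2norm (usubmx t) <= 1 /\ l2norm (dsubmx t) <= eps].

Definition sign1 (R : realType) (a : R) : R := if 0 <= a then 1 else -1.

Definition sign_map (R : realType) (m n : nat) (A : 'M[R]_(m, n))
    (tau : 'cV[R]_m) (t : 'cV[R]_n) : 'cV[R]_m :=
  map_mx (@sign1 R) (A *m t + tau).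

Definition hamming (R : realType) (m : nat) (u v : 'cV[R]_m) : nat :=
  #|[set i : 'I_m | u i 0 != v i 0]%SET|.

Definition distortion (R : realType) (m n : nat) (lambda : R)
    (f : 'cV[R]_n -> 'cV[R]_m) (x y : 'cV[R]_n) : R :=
  `|Num.sqrt (2 * pi) * (lambda / m%:R) * (hamming (f x) (f y))%:R
    - l2norm (x - y)|.

Section probability_notions.
Context (d : measure_display) (T : measurableType d) (R : realType).
Variable P : probability T R.

(* The product rule for subfamilies is the case B i = setT for the other i. *)
Definition mutually_independent (I : finType) (X : I -> {RV P >-> R}) : Prop :=
  forall B : I -> set R, (forall i, measurable (B i)) ->
    P (\bigcap_(i in [set: I]) (X i @^-1` B i)) =
    (\prod_(i : I) P (X i @^-1` B i))%E.

Definition has_std_normal_law (X : {RV P >-> R}) : Prop :=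
  forall B, measurable B -> distribution P X B = normal_prob 0 1 B.

Definition has_uniform_law (a b : R) (X : {RV P >-> R}) : Prop :=
  exists ab : a < b,
    forall B, measurable B -> distribution P X B = uniform_prob ab B.

(* The entries of A are independent N(0, 1), tau is uniform on
   [-lambda, lambda]^m, i.e. has independent uniform coordinates, and tau is
   independent of A: all these variables form one independent family. *)
Definition gaussian_dither (m n : nat) (lambda : R)
    (A : 'I_m -> 'I_n -> {RV P >-> R}) (tau : 'I_m -> {RV P >-> R}) : Prop :=
  [/\ forall i j, has_std_normal_law (A i j),
      forall i, has_uniform_law (- lambda) lambda (tau i) &
      mutually_independent
        (fun k : 'I_m * 'I_n + 'I_m =>
           match k with inl ij => A ij.1 ij.2 | inr i => tau i end)].

Definition random_map (m n : nat) (A : 'I_m -> 'I_n -> {RV P >-> R})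
    (tau : 'I_m -> {RV P >-> R}) (w : T) : 'cV[R]_n -> 'cV[R]_m :=
  sign_map (\matrix_(i, j) A i j w) (\col_i tau i w).

(* Q need not be measurable: it is required to contain a measurable event of
   probability at least p. *)
Definition with_prob_at_least (p : R) (Q : set T) : Prop :=
  exists E, [/\ measurable E, E `<=` Q & (p%:E <= P E)%E].

End probability_notions.

(* Main.v *)
(* Put L = log (e / delta); the Gaussian width of the ellipsoid is of order sqrt r,
   so the critical sample size is m ~ sqrt L r / delta^3 ~ lambda r / delta^3.

   Upper bound. For fixed x, y the bit i flips with probability
   |x - y| / (sqrt (2 pi) lambda) up to a Gaussian tail term, and Chernoff's bound
   gives the estimate simultaneously on an eps-net of B_2^I, of cardinality at most
   exp (r (1 + log (4 / eps))). A point t of the ellipsoid lies within sqrt 2 eps of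
   a net point z, and f(t), f(z) differ in bit i only if <A_i, z> + tau_i is at most
   q = delta / 200 in absolute value, which happens for few i by Chernoff's bound, or
   if |<A_i, t - z>| > q. If this last event occurred for s ~ delta m / lambda indices,
   then some sign vector u supported on s coordinates would have
   |A^T u| >= s q / (sqrt 2 eps); a union bound over all u excludes this, because
   eps ~ delta / log (e lambda / delta) makes the exponent beat s log (m / s).

   Lower bound. If m <= lambda / (4 delta), a single flip already changes the scaled
   Hamming distance by more than 8 delta, and 4 delta e_1 and 0 are badly
   represented. Otherwise take x = 0 and kappa = 4000 delta. About m kappa / lambda
   of the tau_i lie in [-kappa, kappa]; let v_i be their signs, w = A^T v restricted
   to J, and y = - eps w / |w|. Conditionally on tau, v_i <A_i, w> is at least of
   order |J| with high probability, so <A_i, y> overturns the sign of most of these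
   tau_i, although |y| <= eps. *)
Require Import Defs.
From HB Require Import structures.
From mathcomp Require Import all_boot all_order all_algebra.
From mathcomp Require Import all_classical all_reals all_analysis.
From mathcomp Require Import measurable_realfun ring lra.
Set Implicit Arguments.
Unset Strict Implicit.
Unset Printing Implicit Defensive.
Import Order.TTheory GRing.Theory Num.Theory.
Import numFieldNormedType.Exports.
Local Open Scope classical_set_scope.
Local Open Scope ring_scope.


(** * Gaussian integrals *)

(** Why [lambda * r / delta ^+ 3] is critical in both directions: a vector of norm [eps] supported
    on J can move about [delta * m / lambda] of the values <A_i, x> + tau_i, each by about [delta],
    or cannot, according to whether [m * delta ^+ 3 / lambda] is small or large against
    [eps ^+ 2 * |J|], which is of order r. So [eps] cancels from the threshold, and its logarithm
    only serves the union bound over sign vectors. The net of B_2^I is cheap by comparison: the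
    exponent [m * delta ^+ 2 / lambda] is at least of order [r / delta], which pays even for the
    crude bound [ln (4 / eps) <= H / delta]. The entries and the dither live on an arbitrary
    probability space, not on a product. Conditioning is therefore done by giving T two
    sigma-algebras generated by disjoint subfamilies: by independence the map w |-> (w, w) sends P
    to a product measure, and Tonelli's theorem applies. Only nonnegative functions are integrated
    this way. Tails come from exponential moments, except for one first-moment bound where the rows
    are dependent. *)

Section ge0_integral.
Local Open Scope ereal_scope.
Context d (T : measurableType d) (R : realType).
Variable mu : {measure set T -> \bar R}.

(* Contrary to [ge0_le_integral], no measurability is assumed. *)
Lemma le_ge0_integral (f g : T -> \bar R) :
  (forall x, 0 <= f x) -> (forall x, f x <= g x) ->
  \int[mu]_x f x <= \int[mu]_x g x.
Proof.
move=> f0 fg; rewrite !ge0_integralTE//; last first.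
  by move=> x; exact: le_trans (fg x).
apply: le_ereal_sup => _ [h hf <-]; exists h => // x.
exact: le_trans (fg x).
Qed.

End ge0_integral.

Section gaussian_1D.
Context {R : realType}.
Local Notation mu := (@lebesgue_measure R).
Local Notation gamma := (normal_prob (0 : R) 1).

(** The Radon-Nikodym derivative and [normal_pdf] have the same integral over every measurable set,
    hence agree almost everywhere. *)
Lemma ge0_integral_normal_prob (f : measurableTypeR R -> \bar R) :
  measurable_fun setT f -> (forall x, 0 <= f x)%E ->
  (\int[gamma]_x f x = \int[mu]_x (f x * (normal_pdf 0 1 x)%:E))%E.
Proof.
move=> mf f0.
have dom := normal_prob_dominates (0 : R) 1.
rewrite -(Radon_Nikodym_SigmaFinite.change_of_variables dom)//.
apply: ge0_ae_eq_integral => //.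
- apply: emeasurable_funM => //.
  exact: measurable_int (Radon_Nikodym_SigmaFinite.f_integrable dom).
- apply: emeasurable_funM => //; apply/measurable_EFinP.
  exact: measurable_normal_pdf.
- by move=> x _; rewrite mule_ge0// Radon_Nikodym_SigmaFinite.f_ge0.
- by move=> x _; rewrite mule_ge0// lee_fin normal_pdf_ge0.
- apply: ae_eqe_mul2l; apply: integral_ae_eq => //.
  + exact: Radon_Nikodym_SigmaFinite.f_integrable.
  + by apply/measurable_EFinP; exact: measurable_normal_pdf.
  + by move=> E _ mE; rewrite -Radon_Nikodym_SigmaFinite.f_integral.
Qed.

Lemma normal_pdf01E (x : R) :
  normal_pdf 0 1 x = (Num.sqrt (2 * pi))^-1 * expR (- (x ^+ 2 / 2)).
Proof.
rewrite normal_pdfE ?oner_neq0// /normal_peak /normal_fun expr1n mul1r subr0.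
by rewrite -mulr_natl mulNr.
Qed.

Lemma sqrt2pi_gt0 : 0 < Num.sqrt (2 * pi) :> R.
Proof. by rewrite sqrtr_gt0 mulr_gt0// pi_gt0. Qed.

Lemma integral_affine (c b : R) (G : R -> R) : 0 < b -> continuous G ->
  (forall x, 0 <= G x) ->
  (\int[mu]_x (G x)%:E = \int[mu]_x (G (c + b * x) * b)%:E)%E.
Proof.
move=> b0 cG G0; pose F (x : R^o) : R^o := c + b * x.
have dF (x : R^o) : is_derive x 1 F b.
  have := is_deriveD (is_derive_cst c x 1) (is_deriveZ b (is_derive_id x (1 : R^o))).
  by rewrite add0r scaler1.
have F'E : F^`()%classic = cst b.
  by apply/funext => x; rewrite derive1E derive_val.
rewrite (increasing_ge0_integration_by_substitutionT (F := F))//.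
- by rewrite F'E.
- by move=> x y xy; rewrite /F ltrD2l ltr_pM2l.
- by rewrite F'E => ?; exact: cvg_cst.
- by rewrite F'E; exact: is_cvg_cst.
- by rewrite F'E; exact: is_cvg_cst.
- have bNy : b * x @[x --> -oo] --> -oo.
    by under eq_fun do rewrite mulrC; apply/gt0_cvgMlNy => //; exact: cvg_id.
  have -> : F = (fun y => y + c) \o ( *%R b) by apply/funext => x; rewrite /F /= addrC.
    exact: (cvg_comp _ _ bNy (cvg_addrr_Ny _)).
- have by_ : b * x @[x --> +oo] --> +oo.
    by under eq_fun do rewrite mulrC; apply/gt0_cvgMly => //; exact: cvg_id.
  have -> : F = (fun y => y + c) \o ( *%R b) by apply/funext => x; rewrite /F /= addrC.
  exact: (cvg_comp _ _ by_ (cvg_addrr _)).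
Qed.

(** Completing the square turns [expR (s * x)] times the N(0, 1) density into [expR (s ^+ 2 / 2)]
    times the N(s, 1) density. *)
Lemma normal_expR (s : R) :
  (\int[gamma]_x (expR (s * x))%:E = (expR (s ^+ 2 / 2))%:E)%E.
Proof.
have mf : measurable_fun setT (fun x : measurableTypeR R => (expR (s * x))%:E).
  by apply/measurable_EFinP; apply: measurableT_comp => //; exact: measurable_funM.
rewrite ge0_integral_normal_prob//.
transitivity (\int[mu]_x ((expR (s ^+ 2 / 2))%:E * (normal_pdf s 1 x)%:E))%E.
  apply: eq_integral => x _; rewrite -!EFinM; congr EFin.
  rewrite !normal_pdfE ?oner_neq0// /normal_fun mulrCA [RHS]mulrCA.
  by congr (_ * _); rewrite -!expRD; congr expR; field.
rewrite ge0_integralZl//=.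
- by rewrite integral_normal_pdf mule1.
- by apply/measurable_EFinP; exact: measurable_normal_pdf.
- by move=> x _; rewrite lee_fin normal_pdf_ge0.
Qed.

(** The integrand times the N(0, 1) density is a multiple of the N(0, 1 / (1 + t)) density. Negative
    [t] give the exponential moments of a squared Gaussian. *)
Lemma normal_expR_sqr (t : R) : -1 < t ->
  (\int[gamma]_x (expR (- (t * x ^+ 2 / 2)))%:E = ((Num.sqrt (1 + t))^-1)%:E)%E.
Proof.
move=> t1.
have t0 : 0 < 1 + t by lra.
pose s := (Num.sqrt (1 + t))^-1.
have s0 : 0 < s by rewrite invr_gt0 sqrtr_gt0.
have ss : s ^+ 2 = (1 + t)^-1 by rewrite exprVn sqr_sqrtr// ltW.
have mf : measurable_fun setT (fun x : measurableTypeR R => (expR (- (t * x ^+ 2 / 2)))%:E).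
  apply/measurable_EFinP; apply: measurableT_comp => //.
  apply: measurableT_comp => //; apply: measurable_funM => //.
  by apply: measurable_funM => //; exact: measurable_funX.
rewrite ge0_integral_normal_prob//.
transitivity (\int[mu]_x (s%:E * (normal_pdf 0 s x)%:E))%E.
  apply: eq_integral => x _; rewrite -!EFinM; congr EFin.
  rewrite normal_pdf01E normal_pdfE ?gt_eqF// /normal_peak /normal_fun subr0.
  have -> : s ^+ 2 * pi *+ 2 = s ^+ 2 * (2 * pi) by ring.
  rewrite (sqrtrM _ (sqr_ge0 _)) sqrtr_sqr gtr0_norm//.
  rewrite invfM mulrCA -[in RHS]mulrA mulVKf ?gt_eqF//; congr (_ * _).
  rewrite -expRD; congr expR; rewrite -[_ *+ 2]mulr_natr ss.
  by field; rewrite gt_eqF.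
rewrite ge0_integralZl//=.
- by rewrite integral_normal_pdf mule1.
- by apply/measurable_EFinP; exact: measurable_normal_pdf.
- by move=> x _; rewrite lee_fin normal_pdf_ge0.
- by rewrite lee_fin ltW.
Qed.

(** By symmetry it suffices to integrate over the half-line, where minus the density is an
    antiderivative. This constant is the source of the factor [Num.sqrt (2 * pi)] in
    [distortion]. *)
Lemma normal_abs : (\int[gamma]_x `|x|%:E = (2 / Num.sqrt (2 * pi))%:E)%E.
Proof.
rewrite ge0_integral_normal_prob//; last first.
  by apply/measurable_EFinP; exact: normr_measurable.
pose f (x : R) := `|x| * normal_pdf 0 1 x.
have cf : continuous f.
  move=> x; apply: cvgM; first exact: norm_continuous.
  by apply: continuous_normal_pdf; rewrite oner_neq0.
rewrite (@ge0_symfun_integralT _ f)//; first last.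
- by move=> x; rewrite /f /= normrN !normal_pdf01E sqrrN.
- by move=> x; rewrite mulr_ge0// normal_pdf_ge0.
pose F (x : R^o) : R^o := - ((Num.sqrt (2 * pi))^-1 * expR (- (x ^+ 2 / 2))).
have dF (x : R^o) : is_derive x 1 F ((Num.sqrt (2 * pi))^-1 * (x * expR (- (x ^+ 2 / 2)))).
  have dG : is_derive x 1 (fun x : R^o => - (x ^+ 2 / 2) : R^o) (- x).
    apply: is_derive_eq.
    by rewrite !scaler0 add0r !scaler1 -[_ *: _]/(_ * _); lra.
  have := @is_derive1_comp _ (@expR R : R^o -> R^o) (fun x : R^o => - (x ^+ 2 / 2)) x _ _ _ dG => /(_ _ (is_derive_expR _)) dE.
  have -> : F = - ((Num.sqrt (2 * pi))^-1 *: (expR \o (fun x : R^o => - (x ^+ 2 / 2)))) by apply/funext.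
  apply: is_derive_eq.
  rewrite -[_ *: _]/(_ * _).
  by ring.
have itv : [set x : R | (0 <= x)%R] = `[0, +oo[%classic.
  by apply/seteqP; split => x /=; rewrite in_itv/= andbT.
rewrite itv (@ge0_continuous_FTC2y _ f F 0 0)//.
- by rewrite sub0e -EFinN opprK expr0n /= mul0r oppr0 expR0 mulr1 -EFinM.
- by move=> x _; rewrite mulr_ge0// normal_pdf_ge0.
- exact: continuous_subspaceT.
- rewrite /F -oppr0; apply: (@cvgN _ R^o).
  rewrite -[X in _ --> X](mulr0 (Num.sqrt (2 * pi))^-1); apply: cvgM; first exact: cvg_cst.
  apply: (@cvg_comp _ _ _ (fun x : R => x ^+ 2 / 2) (fun y => expR (- y)) _ (+oo)%R).
    apply/gt0_cvgMly; first by rewrite invr_gt0.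
    rewrite /=; apply: (@ger_cvgy _ _ _ _ (fun x : R => x)); last exact: cvg_id.
    near=> x; rewrite expr2 ler_peMl//; near: x; exact: nbhs_pinfty_ge.
  exact: cvgr_expR.
- have : {for 0, continuous F} by apply: differentiable_continuous; apply/derivable1_diffP; have [] := dF 0.
  by move/cvg_at_right_filter.
- move=> x; rewrite in_itv/= andbT => x0; rewrite derive1E derive_val /f normal_pdf01E gtr0_norm//.
  by ring.
Unshelve. all: by end_near. Qed.

Lemma normal_integralN (f : measurableTypeR R -> \bar R) :
  measurable_fun setT f -> (forall x, 0 <= f x)%E ->
  (\int[gamma]_x f (- x)%R = \int[gamma]_x f x)%E.
Proof.
move=> mf f0.
have mN : measurable_fun setT (-%R : measurableTypeR R -> measurableTypeR R) by [].
rewrite !ge0_integral_normal_prob//; last exact: (measurableT_comp mf mN).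
pose g (x : measurableTypeR R) := (f x * (normal_pdf 0 1 x)%:E)%E.
have -> : (fun x => f (- x)%R * (normal_pdf 0 1 x)%:E)%E =
    g \o (-%R : measurableTypeR R -> measurableTypeR R).
  by apply/funext => x /=; rewrite /g !normal_pdf01E sqrrN.
have := @ge0_integral_pushforward _ _ _ _ _ _ mN mu setT g.
rewrite preimage_setT => <- //.
- by apply: eq_measure_integral => A mA _; exact: lebesgue_measureN.
- by apply: emeasurable_funM => //; apply/measurable_EFinP; exact: measurable_normal_pdf.
- by move=> x _; rewrite mule_ge0// lee_fin normal_pdf_ge0.
Qed.

(** For u = a x + b y both sides are the joint density of (x, u). The right side is the N(0, s^2)
    density of u times the conditional density of x given u, which is normal with mean a u / s^2 and
    deviation b / s. *)
Lemma normal_convolution_pdf (a b x u : R) : 0 < b ->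
  let s := Num.sqrt (a ^+ 2 + b ^+ 2) in
  normal_pdf 0 1 x * (normal_pdf 0 1 ((u - a * x) / b) / b) =
  normal_pdf 0 1 (u / s) / s * normal_pdf (a * u / s ^+ 2) (b / s) x.
Proof.
move=> b0 s.
have ab : 0 < a ^+ 2 + b ^+ 2 by rewrite ltr_wpDl ?sqr_ge0// exprn_gt0.
have s0 : 0 < s by rewrite sqrtr_gt0.
have ss : s ^+ 2 = a ^+ 2 + b ^+ 2 by rewrite sqr_sqrtr// ltW.
have bs0 : 0 < b / s by rewrite divr_gt0.
have cs0 := sqrt2pi_gt0.
rewrite !normal_pdf01E normal_pdfE ?gt_eqF// /normal_peak /normal_fun.
have -> : (b / s) ^+ 2 * pi *+ 2 = (b / s) ^+ 2 * (2 * pi) by ring.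
rewrite (sqrtrM _ (sqr_ge0 _)) sqrtr_sqr gtr0_norm//.
set K := Num.sqrt (2 * pi) in cs0 *.
transitivity ((K^-1 * K^-1 * b^-1) * expR (- (x ^+ 2 / 2) - ((u - a * x) / b) ^+ 2 / 2)).
  by rewrite expRD; ring.
transitivity ((K^-1 * K^-1 * b^-1) * expR (- ((u / s) ^+ 2 / 2) +
    - (x - a * u / s ^+ 2) ^+ 2 / ((b / s) ^+ 2 *+ 2))); last first.
  by rewrite expRD; field; rewrite !gt_eqF.
congr (_ * expR _).
have -> : (u / s) ^+ 2 = u ^+ 2 / (a ^+ 2 + b ^+ 2) by rewrite expr_div_n ss.
have -> : (b / s) ^+ 2 = b ^+ 2 / (a ^+ 2 + b ^+ 2) by rewrite expr_div_n ss.
by rewrite ss; field; rewrite !gt_eqF.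
Qed.

(** The inner integral is rewritten in the variable u = a x + b y, which uses b > 0; Tonelli's
    theorem and the factorisation above then integrate x out, and u is rescaled by s. *)
Lemma normal_convolution_pos (a b : R) (F : R -> R) :
  0 < b -> continuous F -> (forall x, 0 <= F x) ->
  (\int[gamma]_x \int[gamma]_y (F (a * x + b * y))%:E =
   \int[gamma]_x (F (Num.sqrt (a ^+ 2 + b ^+ 2) * x))%:E)%E.
Proof.
move=> b0 cF F0; set s := Num.sqrt _.
have s0 : 0 < s.
  by rewrite sqrtr_gt0 ltr_wpDl ?sqr_ge0// exprn_gt0.
pose phi := normal_pdf (0 : R) 1.
have mF : measurable_fun [set: measurableTypeR R] F by exact: continuous_measurable_fun.
have mphi : measurable_fun [set: measurableTypeR R] phi by exact: measurable_normal_pdf.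
have phi0 (x : R) : 0 <= phi x by exact: normal_pdf_ge0.
have cphi : continuous phi by apply: continuous_normal_pdf; rewrite oner_neq0.
have mlin (p q : R) : measurable_fun [set: measurableTypeR R] (fun y : R => p + q * y).
  by apply: measurable_funD => //; exact: measurable_funM.
have inner (x : R) : (\int[gamma]_y (F (a * x + b * y))%:E =
    \int[mu]_u (F u * (phi ((u - a * x) / b) / b))%:E)%E.
  have mFx : measurable_fun setT (fun y : measurableTypeR R => (F (a * x + b * y))%:E).
    by apply/measurable_EFinP; apply: measurableT_comp.
  rewrite ge0_integral_normal_prob//; last by move=> ?; rewrite lee_fin.
  rewrite (@integral_affine (a * x) b (fun u => F u * (phi ((u - a * x) / b) / b)))//.
  - apply: eq_integral => y _; rewrite -EFinM; congr EFin.
    rewrite -/(phi y) -[in RHS]mulrA divfK ?gt_eqF//.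
    by congr (_ * phi _); field; rewrite gt_eqF.
  - move=> u; apply: cvgM; first exact: cF.
    apply: cvgM; last exact: cvg_cst.
    apply: (@cvg_comp _ _ _ (fun u => (u - a * x) / b) phi); last exact: cphi.
    apply: cvgM; last exact: cvg_cst.
    by apply: (@cvgB _ R^o); [exact: cvg_id|exact: cvg_cst].
  - by move=> u; rewrite mulr_ge0// divr_ge0// ltW.
under eq_integral do rewrite inner.
pose H (z : measurableTypeR R * measurableTypeR R) : \bar R :=
  (F z.2 * (phi z.1 * (phi ((z.2 - a * z.1) / b) / b)))%:E.
have mH : measurable_fun setT H.
  apply/measurable_EFinP; apply: measurable_funM; first exact: measurableT_comp.
  apply: measurable_funM; first exact: measurableT_comp.
  apply: measurable_funM => //; apply: measurableT_comp => //.
  apply: measurable_funM => //; apply: measurable_funB => //.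
  exact: measurable_funM.
have H0 z : (0 <= H z)%E by rewrite lee_fin !mulr_ge0// invr_ge0 ltW.
transitivity (\int[mu]_x \int[mu]_u H (x, u))%E.
  rewrite ge0_integral_normal_prob//; first last.
  - by move=> x; apply: integral_ge0 => u _; rewrite lee_fin mulr_ge0// divr_ge0// ltW.
  - have := @measurable_fun_fubini_tonelli_F _ _ _ _ _ mu (fun z : measurableTypeR R * measurableTypeR R => (F z.2 * (phi ((z.2 - a * z.1) / b) / b))%:E).
    rewrite /fubini_F /=; apply; last by move=> z; rewrite lee_fin !mulr_ge0// invr_ge0 ltW.
    apply/measurable_EFinP; apply: measurable_funM; first exact: measurableT_comp.
    apply: measurable_funM => //; apply: measurableT_comp => //.
    apply: measurable_funM => //; apply: measurable_funB => //.
    exact: measurable_funM.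
  apply: eq_integral => x _; rewrite -ge0_integralZr//.
  + by apply: eq_integral => u _; rewrite /H -EFinM /=; congr EFin; rewrite -/(phi x); ring.
  + apply/measurable_EFinP; apply: measurable_funM => //.
    apply: measurable_funM => //; apply: measurableT_comp => //.
    by apply: measurable_funM => //; apply: measurable_funB.
  + by move=> u _; rewrite lee_fin mulr_ge0// divr_ge0// ltW.
  + by rewrite lee_fin normal_pdf_ge0.
have := @fubini_tonelli2 _ _ _ _ _ mu mu H mH H0.
rewrite (@fubini_tonelli1 _ _ _ _ _ mu mu H mH H0) /fubini_F /fubini_G => ->.
transitivity (\int[mu]_u (F u * (phi (u / s) / s))%:E)%E.
  apply: eq_integral => u _.
  transitivity (\int[mu]_x ((F u * (phi (u / s) / s))%:E * (normal_pdf (a * u / s ^+ 2) (b / s) x)%:E))%E.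
    apply: eq_integral => x _; rewrite /H /= -EFinM; congr EFin.
    by rewrite normal_convolution_pdf// mulrA.
  rewrite ge0_integralZl//.
  - by rewrite integral_normal_pdf mule1.
  - by apply/measurable_EFinP; exact: measurable_normal_pdf.
  - by move=> x _; rewrite lee_fin normal_pdf_ge0.
  - by rewrite lee_fin mulr_ge0// divr_ge0// ltW.
rewrite (@integral_affine 0 s (fun u => F u * (phi (u / s) / s)))//.
- have mFs : measurable_fun setT (fun y : measurableTypeR R => (F (s * y))%:E).
    by apply/measurable_EFinP; apply: measurableT_comp => //; exact: measurable_funM.
  rewrite ge0_integral_normal_prob//; last by move=> ?; rewrite lee_fin.
  apply: eq_integral => x _; rewrite add0r -EFinM; congr EFin.
  by rewrite -[in LHS]mulrA divfK ?gt_eqF// mulrAC mulfV ?mul1r ?gt_eqF.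
- move=> u; apply: cvgM; first exact: cF.
  apply: cvgM; last exact: cvg_cst.
  apply: (@cvg_comp _ _ _ (fun u => u / s) phi); last exact: cphi.
  by apply: cvgM; [exact: cvg_id|exact: cvg_cst].
- by move=> u; rewrite mulr_ge0// divr_ge0// ltW.
Qed.

(** The case b = 0, reached in [gaussian_comb] when the remaining coefficients vanish, follows from
    the symmetry of [gamma], because [Num.sqrt (a ^+ 2)] is the absolute value of a. *)
Lemma normal_convolution (a b : R) (F : R -> R) :
  0 <= b -> continuous F -> (forall x, 0 <= F x) ->
  (\int[gamma]_x \int[gamma]_y (F (a * x + b * y))%:E =
   \int[gamma]_x (F (Num.sqrt (a ^+ 2 + b ^+ 2) * x))%:E)%E.
Proof.
move=> + cF F0; rewrite le_eqVlt => /predU1P[<-|]; last first.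
  by move=> b0; exact: normal_convolution_pos.
rewrite expr0n /= addr0 sqrtr_sqr.
under eq_integral => x _.
  under eq_integral => y _ do rewrite mul0r addr0.
  rewrite integral_cst//= (@probability_setT _ _ _ gamma) mule1.
  over.
have mF (c : R) : measurable_fun [set: measurableTypeR R] (fun x => (F (c * x))%:E).
  apply/measurable_EFinP; apply: (measurableT_comp (continuous_measurable_fun cF)).
  exact: measurable_funM.
have [a0|a0] := leP 0 a; first by rewrite ger0_norm.
rewrite ltr0_norm// -(@normal_integralN (fun x => (F (- a * x))%:E))//; last by move=> x; rewrite lee_fin.
by under [in RHS]eq_integral => x _ do rewrite mulrNN.
Qed.

End gaussian_1D.

(** * Independence and Chernoff bounds *)

Lemma measurable_bool_set d (T : measurableType d) (b : T -> bool) :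
  measurable_fun setT b -> measurable [set w | b w].
Proof.
move=> mb; rewrite (_ : [set w | b w] = setT `&` b @^-1` [set true]); first exact: mb.
by apply/seteqP; split => w /=; [move=> ->|case].
Qed.

Lemma ge0_integral_std_normal d (T : measurableType d) (R : realType)
    (P : probability T R) (Y : {RV P >-> R}) (h : measurableTypeR R -> \bar R) :
  has_std_normal_law Y -> measurable_fun setT h -> (forall x, 0 <= h x)%E ->
  (\int[P]_w h (Y w) = \int[normal_prob 0 1]_x h x)%E.
Proof.
move=> nY mh h0.
(* [measurableTypeR R] and [R] carry the same sigma-algebra under different displays. *)
have mY : measurable_fun setT (Y : T -> measurableTypeR R).
  by move=> _ A mA; have := @measurable_funPT _ _ _ _ Y measurableT A mA.
have := @ge0_integral_pushforward _ _ _ _ _ _ mY P setT h measurableT mh (fun z _ => h0 z).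
rewrite preimage_setT => <-.
by apply: eq_measure_integral => A mA _; apply: nY.
Qed.

Section independence.
Context d (T : measurableType d) (R : realType) (P : probability T R).
Context (K : finType) (X : K -> {RV P >-> R}).
Implicit Types D : {set K}.

Definition box D (B : K -> set R) : set T :=
  [set w | forall k, k \in D -> B k (X k w)].

(** The cylinder events of the subfamily indexed by [D]. They form a pi-system, so independence need
    only be checked on them. *)
Definition boxes D : set (set T) :=
  [set A | exists2 B, (forall k, measurable (B k)) & A = box D B].

(* T with the sigma-algebra generated by the X k, k in D. *)
Definition sigT D := g_sigma_algebraType (boxes D).

Lemma measurable_box D B : (forall k, measurable (B k)) -> measurable (box D B).
Proof.
move=> mB; rewrite (_ : box D B = \bigcap_(k in [set k | k \in D]) (X k @^-1` B k)); last first.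
  by apply/seteqP; split => w /= h k; exact: h.
apply: fin_bigcap_measurable => // k _.
by rewrite -[X in measurable X]setTI; apply: measurable_funPT.
Qed.

Lemma boxes_measurable D : boxes D `<=` measurable.
Proof. by move=> _ [B mB ->]; exact: measurable_box. Qed.

Lemma sigT_measurable D (A : set T) : <<s boxes D >> A -> measurable A.
Proof. by apply: smallest_sub; [exact: sigma_algebra_measurable|exact: boxes_measurable]. Qed.

Lemma boxes_setI D : setI_closed (boxes D).
Proof.
move=> _ _ [B mB ->] [C mC ->]; exists (fun k => B k `&` C k).
  by move=> k; exact: measurableI.
apply/seteqP; split => [w [hB hC] k kD|w h]; first by split; [exact: hB|exact: hC].
by split => k kD; have [] := h k kD.
Qed.

Lemma boxes_setT D : boxes D setT.
Proof. by exists (fun=> setT) => //; apply/seteqP; split. Qed.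

Lemma measurable_sigT_id D : measurable_fun setT (idfun : T -> sigT D).
Proof. by move=> _ A mA; rewrite setTI; exact: sigT_measurable mA. Qed.

Lemma sigT_measurable_fun D d' (U : measurableType d') (f : T -> U) :
  measurable_fun setT (f : sigT D -> U) -> measurable_fun setT f.
Proof. by move=> mf; apply: (measurableT_comp mf (@measurable_sigT_id D)). Qed.

Lemma boxes_sub D D' : D \subset D' -> boxes D `<=` boxes D'.
Proof.
move=> DD' _ [B mB ->]; exists (fun k => if k \in D then B k else setT).
  by move=> k; case: ifP.
apply/seteqP; split => w h k kD; first by case: ifP => // /h.
by have := h k (fintype.subsetP DD' _ kD); rewrite kD.
Qed.

Lemma sigT_sub D D' d' (U : measurableType d') (f : T -> U) : D \subset D' ->
  measurable_fun setT (f : sigT D -> U) -> measurable_fun setT (f : sigT D' -> U).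
Proof.
move=> DD' mf _ A mA; have := mf measurableT A mA.
by apply: sub_sigma_algebra2; exact: boxes_sub.
Qed.

Lemma measurable_sigT D k : k \in D -> measurable_fun setT (X k : sigT D -> R).
Proof.
move=> kD _ A mA; apply: sub_sigma_algebra.
exists (fun j => if j == k then A else setT).
  by move=> j; case: ifP.
apply/seteqP; split => w /=.
  by move=> [_ Aw] j jD; case: eqP => // ->.
by move=> /(_ k kD); rewrite eqxx.
Qed.

Hypothesis indepX : mutually_independent X.

Lemma box_prob D B : (forall k, measurable (B k)) ->
  P (box D B) = (\prod_(k in D) P (X k @^-1` B k))%E.
Proof.
move=> mB; pose B' k := if k \in D then B k else setT.
have mB' k : measurable (B' k) by rewrite /B'; case: ifP.
have -> : box D B = \bigcap_(k in [set: K]) (X k @^-1` B' k).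
  apply/seteqP; split => w h k /=; first by rewrite /B' => _; case: ifP => // /h.
  by move=> kD; have := h k I; rewrite /B' /= kD.
rewrite indepX// [RHS]big_mkcond; apply: eq_bigr => k _.
by rewrite /B'; case: ifP => // _; rewrite preimage_setT probability_setT.
Qed.

Lemma indep_boxes D1 D2 A1 A2 : [disjoint D1 & D2]%B -> boxes D1 A1 -> boxes D2 A2 ->
  P (A1 `&` A2) = (P A1 * P A2)%E.
Proof.
move=> dD [B1 mB1 ->] [B2 mB2 ->].
pose B k := if k \in D1 then B1 k else B2 k.
have mB k : measurable (B k) by rewrite /B; case: ifP.
have D21 k : k \in D2 -> (k \in D1) = false.
  by move=> k2; apply/negbTE/negP => k1; move/pred0P: dD => /(_ k)/=; rewrite k1 k2.
have -> : box D1 B1 `&` box D2 B2 = box (D1 :|: D2)%SET B.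
  apply/seteqP; split => w.
    move=> [h1 h2] k; rewrite inE /B; case: ifP => [k1 _|k1 /= k2]; first exact: h1.
    exact: h2.
  move=> h; split => k kD.
    by have := h k; rewrite inE kD /B kD; exact.
  by have := h k; rewrite inE kD orbT /B D21//; exact.
rewrite !box_prob// (eq_bigl (fun k => (k \in D1) || (k \in D2))); last by move=> k; rewrite inE.
rewrite bigU//=; congr (_ * _)%E; apply: eq_bigr => k kD; rewrite /B.
  by rewrite kD.
by rewrite D21.
Qed.

(** Both sides are finite measures in A, the restriction of P to A2 and a multiple of P. They agree
    on the pi-system [G], which contains the whole space, hence on the sigma-algebra it
    generates. *)
Lemma indep_extend (G : set (set T)) (A2 : set T) : G `<=` measurable ->
  setI_closed G -> G setT -> measurable A2 ->
  (forall A, G A -> P (A `&` A2) = (P A * P A2)%E) ->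
  forall A, <<s G >> A -> P (A `&` A2) = (P A * P A2)%E.
Proof.
move=> mG GI GT mA2 h A sA.
have PA2 : P A2 \is a fin_num by exact: fin_num_measure.
pose r := NngNum (fine_ge0 (measure_ge0 P A2)).
have e B : mscale r P B = (P B * P A2)%E.
  by rewrite /mscale /= fineK// muleC.
rewrite -e; have := @g_sigma_algebra_measure_unique _ R T G mG (fun=> setT) (fun=> GT) _ (mrestr P mA2) (mscale r P) GI.
apply => //.
- by rewrite bigcup_const//; exists 0%N.
- by move=> B GB; exact: (etrans (h B GB) (esym (e B))).
- by move=> _; apply: le_lt_trans (ltry 1); apply: probability_le1; exact: measurableI.
Qed.

Lemma indep_sigT D1 D2 A1 A2 : [disjoint D1 & D2]%B ->
  <<s boxes D1 >> A1 -> <<s boxes D2 >> A2 -> P (A1 `&` A2) = (P A1 * P A2)%E.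
Proof.
move=> dD s1 s2.
have h B1 : boxes D1 B1 -> P (B1 `&` A2) = (P B1 * P A2)%E.
  move=> b1; rewrite setIC muleC; apply: (@indep_extend (boxes D2)) => //.
  - exact: boxes_measurable.
  - exact: boxes_setI.
  - exact: boxes_setT.
  - exact: boxes_measurable b1.
  - by move=> B2 b2; rewrite setIC muleC; exact: indep_boxes dD b1 b2.
apply: (@indep_extend (boxes D1)) => //.
- exact: boxes_measurable.
- exact: boxes_setI.
- exact: boxes_setT.
- exact: sigT_measurable s2.
Qed.

(** Independence identifies the image of P under w |-> (w, w) with a product measure, first on
    rectangles and then everywhere by uniqueness. This is the substitute for conditional
    expectation: w1 is frozen, w2 is averaged. *)
Lemma indep_fubini D1 D2 (H : T -> T -> \bar R) : [disjoint D1 & D2]%B ->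
  measurable_fun setT (fun z : sigT D1 * sigT D2 => H z.1 z.2) ->
  (forall w1 w2, 0 <= H w1 w2)%E ->
  measurable_fun setT (fun w1 : sigT D1 => \int[P]_w2 H w1 w2)%E /\
  (\int[P]_w H w w = \int[P]_w1 \int[P]_w2 H w1 w2)%E.
Proof.
move=> dD mH H0.
pose G (z : sigT D1 * sigT D2) := H z.1 z.2.
have m1 := @measurable_sigT_id D1; have m2 := @measurable_sigT_id D2.
pose f1 : {mfun T >-> sigT D1} := HB.pack (idfun : T -> sigT D1) (isMeasurableFun.Build _ _ _ _ _ m1).
pose f2 : {mfun T >-> sigT D2} := HB.pack (idfun : T -> sigT D2) (isMeasurableFun.Build _ _ _ _ _ m2).
pose P1 := distribution P f1; pose P2 := distribution P f2.
pose dd (w : T) : sigT D1 * sigT D2 := (w, w).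
have mdd : measurable_fun setT dd by exact: measurable_fun_pair.
have mHx w1 : measurable_fun setT (fun w2 : sigT D2 => H w1 w2).
  pose p (w2 : sigT D2) : sigT D1 * sigT D2 := (w1, w2).
  have mp : measurable_fun setT p by exact: measurable_fun_pair.
  exact: (measurableT_comp mH mp).
have inner w1 : (\int[P]_w2 H w1 w2 = \int[P2]_w2 H w1 w2)%E.
  by rewrite (ge0_integral_distribution f2).
have mF : measurable_fun setT (fun w1 : sigT D1 => \int[P]_w2 H w1 w2)%E.
  have := @measurable_fun_fubini_tonelli_F _ _ _ _ _ P2 G mH.
  rewrite /fubini_F => /(_ (fun z => H0 _ _)).
  by under eq_fun do rewrite -inner.
split => //.
have <- : (\int[pushforward P dd]_z G z = \int[P]_w H w w)%E.
  have := @ge0_integral_pushforward _ _ _ _ _ dd mdd P setT G measurableT mH (fun z _ => H0 _ _).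
  by rewrite preimage_setT => ->.
have -> : (\int[pushforward P dd]_z G z = \int[P1 \x P2]_z G z)%E.
  apply: eq_measure_integral => A mA _; apply/esym.
  apply: (@product_measure_unique _ _ _ _ _ P1 P2 (pushforward P dd)) => // B C mB mC.
  exact: (@indep_sigT D1 D2).
rewrite fubini_tonelli1//; last by move=> z; exact: H0.
rewrite /fubini_F; under eq_integral do rewrite -inner.
rewrite (ge0_integral_distribution f1)// => w1.
exact: integral_ge0.
Qed.

Lemma indep_event D1 D2 (b : T -> T -> bool) : [disjoint D1 & D2]%B ->
  measurable_fun setT (fun z : sigT D1 * sigT D2 => b z.1 z.2) ->
  [/\ forall w1, measurable [set w | b w1 w],
      measurable_fun setT (fun w1 => P [set w | b w1 w]) &
      (P [set w | b w w] = \int[P]_w1 P [set w | b w1 w])%E].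
Proof.
move=> dD mb.
have mbw w1 : measurable_fun setT (b w1 : sigT D2 -> bool).
  pose p (w2 : sigT D2) : sigT D1 * sigT D2 := (w1, w2).
  have mp : measurable_fun setT p by exact: measurable_fun_pair.
  exact: (measurableT_comp mb mp).
have mB w1 : measurable [set w | b w1 w].
  exact: measurable_bool_set (sigT_measurable_fun (mbw w1)).
have mdd : measurable_fun setT (fun w : T => (w, w) : sigT D1 * sigT D2).
  by apply: measurable_fun_pair; exact: measurable_sigT_id.
have mD : measurable [set w : T | b w w] by exact: measurable_bool_set (measurableT_comp mb mdd).
have [||mH fub] := @indep_fubini D1 D2 (fun w1 w2 => (\1_[set w | b w1 w] w2)%:E) dD.
- apply/measurable_EFinP.
  rewrite (_ : (fun z => _) = (fun x => if b x.1 x.2 then 1 else 0)); last first.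
    by apply/funext => x; rewrite indicE; case bx : (b x.1 x.2); [rewrite mem_set|rewrite memNset//= bx].
  exact: measurable_fun_ifT.
- by move=> w1 w2; rewrite lee_fin.
have inner w1 : (\int[P]_w2 (\1_[set w | b w1 w] w2)%:E)%E = P [set w | b w1 w].
  by rewrite integral_indic// setIT.
split => //.
  by under eq_fun do rewrite -inner; exact: (sigT_measurable_fun mH).
under [RHS]eq_integral do rewrite -inner.
have <- : (\int[P]_w (\1_[set w | b w w] w)%:E)%E = P [set w | b w w].
  by rewrite integral_indic// setIT.
by rewrite -fub; apply: eq_integral => w _; rewrite !indicE.
Qed.

Lemma indep_integralM D1 D2 (f g : T -> R) : [disjoint D1 & D2]%B ->
  measurable_fun setT (f : sigT D1 -> R) -> measurable_fun setT (g : sigT D2 -> R) ->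
  (forall w, 0 <= f w) -> (forall w, 0 <= g w) ->
  (\int[P]_w (f w * g w)%:E = \int[P]_w (f w)%:E * \int[P]_w (g w)%:E)%E.
Proof.
move=> dD mf mg f0 g0.
have [||_ ->] := @indep_fubini D1 D2 (fun w1 w2 => (f w1 * g w2)%:E) dD.
- apply/measurable_EFinP; apply: measurable_funM.
    exact: (measurableT_comp mf).
  exact: (measurableT_comp mg).
- by move=> w1 w2; rewrite lee_fin mulr_ge0.
have mf' := sigT_measurable_fun mf; have mg' := sigT_measurable_fun mg.
rewrite -ge0_integralZr//.
- apply: eq_integral => w _; under eq_integral do rewrite EFinM.
  rewrite ge0_integralZl//.
  + exact/measurable_EFinP.
  + by move=> ? _; rewrite lee_fin.
  + by rewrite lee_fin.
- exact/measurable_EFinP.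
- by move=> ? _; rewrite lee_fin.
- by apply: integral_ge0 => ? _; rewrite lee_fin.
Qed.

Lemma indep_integral_prod (I : eqType) (s : seq I) (D : I -> {set K}) (f : I -> T -> R) :
  uniq s -> {in s &, forall i j, i != j -> [disjoint D i & D j]%B} ->
  {in s, forall i, measurable_fun setT (f i : sigT (D i) -> R)} ->
  (forall i w, 0 <= f i w) ->
  (\int[P]_w (\prod_(i <- s) f i w)%:E = \prod_(i <- s) \int[P]_w (f i w)%:E)%E.
Proof.
move=> + + + f0; elim: s => [_ _ _|a s ih /= /andP[ans us] ds ms].
  by under eq_integral do rewrite big_nil; rewrite big_nil integral_cst//= probability_setT mule1.
under eq_integral do rewrite big_cons.
rewrite big_cons -ih//; last 2 first.
- by move=> i j si sj; apply: ds; rewrite inE ?si ?sj orbT.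
- by move=> i si; apply: ms; rewrite inE si orbT.
(* The product over the tail depends only on the variables indexed by this union, which is disjoint
   from [D a]. *)
pose D2 := (\bigcup_(i <- s) D i)%SET.
apply: (@indep_integralM (D a) D2) => //.
- rewrite disjoint_sym; apply/pred0P => k /=; apply/negbTE/negP => /andP[+ ka].
  rewrite /D2; elim: s {ih ms D2} ans us ds => [|b s ih]; first by rewrite big_nil inE.
  rewrite inE negb_or => /andP[ab as_] /= /andP[_ us] ds; rewrite big_cons inE => /orP[kb|].
    have sb : b \in [:: a, b & s] by rewrite !inE eqxx orbT.
    by rewrite (fintype.disjointFr (ds a b (mem_head _ _) sb ab) ka) in kb.
  apply: ih => // i j si sj; apply: ds.
    by move: si; rewrite !inE => /orP[->//|->]; rewrite !orbT.
  by move: sj; rewrite !inE => /orP[->//|->]; rewrite !orbT.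
- by apply: ms; rewrite inE eqxx.
- apply: (@measurable_prod _ (sigT D2)) => i si.
  apply: (@sigT_sub (D i)); last by apply: ms; rewrite inE si orbT.
  by rewrite /D2 (big_rem i si) /=; exact: finset.subsetUl.
- by move=> w; apply: prodr_ge0.
Qed.

Lemma measurable_comb (J : eqType) (s : seq J) (e : J -> K) (z : J -> R) D :
  {in s, forall j, e j \in D} ->
  measurable_fun setT ((fun w => \sum_(j <- s) z j * X (e j) w) : sigT D -> R).
Proof.
elim: s => [_|a s ih sD].
  rewrite (_ : (fun w => _) = cst 0)//.
  by apply/funext => w; rewrite big_nil.
rewrite (_ : (fun w => _) = (fun w => z a * X (e a) w + \sum_(j <- s) z j * X (e j) w)); last first.
  by apply/funext => w; rewrite big_cons.
apply: measurable_funD.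
  by apply: measurable_funM => //; apply: measurable_sigT; apply: sD; exact: mem_head.
by apply: ih => j sj; apply: sD; rewrite inE sj orbT.
Qed.

(** Induction on [s] with [F] varying: the head variable is frozen and the induction hypothesis is
    applied to a translate of [F]; then the head is averaged and the two Gaussians are merged by
    [normal_convolution]. *)
Lemma gaussian_comb (J : finType) (s : seq J) (e : J -> K) (z : J -> R) (F : R -> R) :
  uniq s -> {in s &, injective e} ->
  {in s, forall j, has_std_normal_law (X (e j))} ->
  continuous F -> (forall x, 0 <= F x) ->
  (\int[P]_w (F (\sum_(j <- s) z j * X (e j) w))%:E =
   \int[normal_prob 0 1]_x (F (Num.sqrt (\sum_(j <- s) z j ^+ 2) * x))%:E)%E.
Proof.
move=> + + + cF F0; elim: s F cF F0 => [|a s ih] F cF F0.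
  move=> _ _ _; under eq_integral do rewrite big_nil.
  under [RHS]eq_integral do rewrite big_nil sqrtr0 mul0r.
  by rewrite !integral_cst//= !probability_setT.
move=> /= /andP[ans us] ei ne.
pose Y w := \sum_(j <- s) z j * X (e j) w.
pose sg := Num.sqrt (\sum_(j <- s) z j ^+ 2).
pose D2 := [set e j | j in s]%SET.
have D12 : [disjoint [set e a]%SET & D2]%B.
  rewrite finset.disjoints1; apply/imsetP => -[j sj eaj]; move/negP: ans; apply.
  by rewrite (ei a j) ?inE ?eqxx ?sj ?orbT.
have mY : measurable_fun setT (Y : sigT D2 -> R).
  by apply: measurable_comb => j sj; exact: imset_f.
have mXa : measurable_fun setT (X (e a) : sigT [set e a]%SET -> R).
  by apply: measurable_sigT; exact: finset.set11.
have cFc (c : R) : continuous (fun x => F (c + x)).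
  move=> x; apply: (@cvg_comp _ _ _ (fun x => c + x) F); last exact: cF.
  by apply: (@cvgD _ R^o); [exact: cvg_cst|exact: cvg_id].
have mF : measurable_fun [set: measurableTypeR R] F by exact: continuous_measurable_fun.
have [||_] := @indep_fubini [set e a]%SET D2 (fun w1 w2 => (F (z a * X (e a) w1 + Y w2))%:E) D12.
- apply/measurable_EFinP; apply: measurableT_comp => //.
  apply: measurable_funD.
    apply: measurable_funM => //.
    exact: (measurableT_comp mXa).
  exact: (measurableT_comp mY).
- by move=> w1 w2; rewrite lee_fin.
move=> fub.
transitivity (\int[P]_w (F (z a * X (e a) w + Y w))%:E)%E.
  by apply: eq_integral => w _; rewrite big_cons.
rewrite fub.
pose h (x : measurableTypeR R) := (\int[normal_prob 0 1]_y (F (z a * x + sg * y))%:E)%E.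
transitivity (\int[P]_w (h (X (e a) w)))%E.
  apply: eq_integral => w _; rewrite /h.
  apply: (ih (fun y => F (z a * X (e a) w + y))) => //.
  - by move=> i j si sj; apply: ei; rewrite inE ?si ?sj orbT.
  - by move=> j sj; apply: ne; rewrite inE sj orbT.
have mh : measurable_fun setT h.
  have := @measurable_fun_fubini_tonelli_F _ _ _ _ _ (normal_prob (0 : R) 1)
    (fun z0 : measurableTypeR R * measurableTypeR R => (F (z a * z0.1 + sg * z0.2))%:E).
  apply; last by move=> ?; rewrite lee_fin.
  apply/measurable_EFinP; apply: measurableT_comp => //.
  by apply: measurable_funD; apply: measurable_funM.
have h0 x : (0 <= h x)%E by apply: integral_ge0 => y _; rewrite lee_fin.
rewrite (ge0_integral_std_normal (ne a (mem_head _ _)) mh h0).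
rewrite /h normal_convolution ?sqrtr_ge0//.
rewrite sqr_sqrtr; last by apply: sumr_ge0 => j _; exact: sqr_ge0.
by under [RHS]eq_integral do rewrite big_cons.
Qed.

End independence.

(** [expR u] is at most 1 / (1 - u), and (1 - u)(1 + u + 2 u^2) = 1 + u^2 (1 - 2 u) >= 1. All
    negative u are covered, which lets one inequality serve both Chernoff tails. *)
Lemma expR_le_quad (R : realType) (u : R) : u <= 1 / 2 -> expR u <= 1 + u + 2 * u ^+ 2.
Proof.
move=> u12; have h := expR_ge1Dx (- u).
have u1 : 0 < 1 - u by lra.
have -> : expR u = (expR (- u))^-1 by rewrite expRN invrK.
apply: (@le_trans _ _ (1 - u)^-1).
  by rewrite lef_pV2// posrE ?expR_gt0.
rewrite -(ler_pM2r u1) mulVf ?gt_eqF//.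
have : 0 <= u ^+ 2 * (1 - 2 * u) by rewrite mulr_ge0 ?sqr_ge0//; lra.
nra.
Qed.

Section chernoff.
Context d (T : measurableType d) (R : realType) (P : probability T R).

Lemma exp_markov (A : set T) (g : T -> R) (a : R) :
  measurable A -> measurable_fun setT g -> (forall w, A w -> a <= g w) ->
  (P A <= (expR (- a))%:E * \int[P]_w (expR (g w))%:E)%E.
Proof.
move=> mA mg Ag.
have -> : P A = (\int[P]_w (\1_A w)%:E)%E by rewrite integral_indic// setIT.
rewrite -ge0_integralZl//.
- apply: le_ge0_integral => w; first by rewrite lee_fin.
  rewrite -EFinM lee_fin indicE -expRD; case: (boolP (w \in A)) => [/set_mem/Ag|_].
    by move=> ag; rewrite -expR0 ler_expR; lra.
  exact: expR_ge0.
- by apply/measurable_EFinP; exact: measurableT_comp.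
Qed.

Context (K : finType) (X : K -> {RV P >-> R}).
Hypothesis indepX : mutually_independent X.

Lemma integral_expR_bool (b : T -> bool) (u : R) : measurable_fun setT b ->
  (\int[P]_w (expR (u * (b w)%:R))%:E = 1 + (expR u - 1)%:E * P [set w | b w])%E.
Proof.
move=> mb; have mB : measurable [set w | b w].
  exact: measurable_bool_set.
have PB : P [set w | b w] \is a fin_num by exact: fin_num_measure.
have PC : (P (~` [set w | b w]) = 1 - P [set w | b w])%E by exact: probability_setC.
transitivity (\int[P]_w ((expR u * \1_[set w | b w] w)%:E + (\1_(~` [set w | b w]) w)%:E))%E.
  apply: eq_integral => w _; rewrite -EFinD; congr EFin; rewrite !indicE in_setC.
  case bw : (b w).
    by rewrite mem_set//= mulr1 mulr1 addr0.
  by rewrite memNset /= ?bw// !mulr0 expR0 add0r.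
have mI (B : set T) : measurable B -> measurable_fun setT (fun w => (\1_B w : R)%:E).
  by move=> mB'; apply/measurable_EFinP; exact: measurable_indic.
have mC : measurable (~` [set w | b w]) by exact: measurableC.
rewrite ge0_integralD//; first last.
- exact: mI.
- by under eq_fun do rewrite EFinM; apply: emeasurable_funM => //; exact: mI.
under eq_integral do rewrite EFinM.
rewrite ge0_integralZl//; last exact: mI.
rewrite !integral_indic//.
rewrite !setIT.
transitivity ((expR u)%:E * P [set w | b w] + (1 - P [set w | b w]))%E.
  by congr (_ + _)%E; exact: PC.
rewrite -(fineK PB) -!EFinM -!EFinD; congr EFin; ring.
Qed.

Lemma bernoulli_mgf (m : nat) (D : 'I_m -> {set K}) (b : 'I_m -> T -> bool) (u : R) :
  (forall i j, i != j -> [disjoint D i & D j]%B) ->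
  (forall i, measurable_fun setT (b i : sigT X (D i) -> bool)) ->
  (\int[P]_w (expR (u * \sum_i (b i w)%:R))%:E =
   \prod_i (1 + (expR u - 1)%:E * P [set w | b i w]))%E.
Proof.
move=> dD mb.
under eq_integral do rewrite mulr_sumr expR_sum.
rewrite (indep_integral_prod indepX (D := D) (f := fun i w => expR (u * (b i w)%:R)))//.
- by apply: eq_bigr => i _; apply: integral_expR_bool; exact: sigT_measurable_fun (mb i).
- exact: index_enum_uniq.
- by move=> i j _ _; exact: dD.
- move=> i _; apply: measurableT_comp => //; apply: measurable_funM => //.
  rewrite (_ : (fun w => _) = (fun w => if b i w then 1 else 0)); last first.
    by apply/funext => w; case: (b i w).
  exact: measurable_fun_ifT.
Qed.

(** Each factor is at most [expR q] by 1 + x <= exp x. Bounding the product [(expR u - 1) * P] as a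
    whole treats u >= 0 with upper bounds and u <= 0 with lower bounds on the probabilities. *)
Lemma bernoulli_mgf_le (m : nat) (D : 'I_m -> {set K}) (b : 'I_m -> T -> bool) (u q : R) :
  (forall i j, i != j -> [disjoint D i & D j]%B) ->
  (forall i, measurable_fun setT (b i : sigT X (D i) -> bool)) ->
  (forall i, (expR u - 1)%:E * P [set w | b i w] <= q%:E)%E ->
  (\int[P]_w (expR (u * \sum_i (b i w)%:R))%:E <= (expR (m%:R * q))%:E)%E.
Proof.
move=> dD mb hq; rewrite (bernoulli_mgf _ dD mb).
have h i : exists2 r : R, ((expR u - 1)%:E * P [set w | b i w] = r%:E)%E & 0 <= 1 + r <= expR q.
  have mB : measurable [set w | b i w].
    exact: measurable_bool_set (sigT_measurable_fun (mb i)).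
  have PB : P [set w | b i w] \is a fin_num by exact: fin_num_measure.
  have P1 : fine (P [set w | b i w]) <= 1 by rewrite -lee_fin fineK// probability_le1.
  have P0 : 0 <= fine (P [set w | b i w]) by rewrite fine_ge0.
  have := hq i; rewrite -(fineK PB) -EFinM lee_fin => le.
  exists ((expR u - 1) * fine (P [set w | b i w])) => //.
  have u0 := expR_gt0 u; apply/andP; split; first by nra.
  by apply: (le_trans _ (expR_ge1Dx q)); rewrite lerD2l.
have : forall s : seq 'I_m, (\prod_(i <- s) (1 + (expR u - 1)%:E * P [set w | b i w]) <= (expR ((size s)%:R * q))%:E)%E.
  elim => [|i s ih]; first by rewrite big_nil mul0r expR0.
  rewrite big_cons /= -natr1 mulrDl mul1r [_%:R * q + q]addrC expRD EFinM.
  have [r -> /andP[r0 r1]] := h i.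
  rewrite (_ : (1 + r%:E = (1 + r)%:E)%E)//.
  apply: lee_pmul => //.
  apply: (big_ind (fun x => 0 <= x)%E) => //; first by move=> x y x0 y0; rewrite mule_ge0.
  by move=> j _; have [r' -> /andP[r0' _]] := h j; rewrite lee_fin.
by move=> /(_ (enum 'I_m)); rewrite size_enum_ord big_enum.
Qed.

Lemma measurable_count (m : nat) (D : 'I_m -> {set K}) (b : 'I_m -> T -> bool) :
  (forall i, measurable_fun setT (b i : sigT X (D i) -> bool)) ->
  measurable_fun setT (fun w => \sum_i (b i w)%:R : R).
Proof.
move=> mb; apply: measurable_sum => i.
rewrite (_ : (fun w => _) = (fun w => if b i w then 1 else 0)); last first.
  by apply/funext => w; case: (b i w).
by apply: measurable_fun_ifT => //; exact: sigT_measurable_fun (mb i).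
Qed.

(** The exponent comes from [expR u - 1 <= u + 2 * u ^+ 2]. The parameter u is left to the caller:
    of order [delta] for small relative deviations, an absolute constant for deviations of the order
    of the mean. *)
Lemma chernoff_upper (m : nat) (D : 'I_m -> {set K}) (b : 'I_m -> T -> bool) (u p a : R) :
  (forall i j, i != j -> [disjoint D i & D j]%B) ->
  (forall i, measurable_fun setT (b i : sigT X (D i) -> bool)) ->
  (forall i, P [set w | b i w] <= p%:E)%E -> 0 <= u <= 1 / 2 -> 0 <= p ->
  (P [set w | m%:R * p + a <= \sum_i (b i w)%:R]%R <=
   (expR (2 * u ^+ 2 * m%:R * p - u * a))%:E)%E.
Proof.
move=> dD mb Pp /andP[u0 u1] p0; have mc := measurable_count mb.
pose g w := u * \sum_i (b i w)%:R : R.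
have mg : measurable_fun setT g by exact: measurable_funM.
apply: (@le_trans _ _ ((expR (- (u * (m%:R * p + a))))%:E * (expR (m%:R * ((u + 2 * u ^+ 2) * p)))%:E)%E).
  apply: (le_trans (@exp_markov _ g (u * (m%:R * p + a)) _ mg _)).
  - have := measurable_fun_le measurableT (measurable_cst (m%:R * p + a)) mc.
    by rewrite setTI.
  - by move=> w /=; rewrite /g; exact: ler_wpM2l.
  - rewrite lee_pmul2l//; last by rewrite lte_fin expR_gt0.
    apply: (bernoulli_mgf_le dD mb) => i.
    have e1 : 0 <= expR u - 1 by rewrite subr_ge0 -expR0 ler_expR.
    apply: (@le_trans _ _ ((expR u - 1)%:E * p%:E)%E); first exact: lee_wpmul2l.
    rewrite -EFinM lee_fin; apply: ler_wpM2r => //.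
    by have := expR_le_quad u1; lra.
rewrite -EFinM lee_fin -expRD ler_expR; lra.
Qed.

Lemma chernoff_lower (m : nat) (D : 'I_m -> {set K}) (b : 'I_m -> T -> bool) (u p a : R) :
  (forall i j, i != j -> [disjoint D i & D j]%B) ->
  (forall i, measurable_fun setT (b i : sigT X (D i) -> bool)) ->
  (forall i, p%:E <= P [set w | b i w])%E -> 0 <= u <= 1 / 2 -> 0 <= p ->
  (P [set w | \sum_i (b i w)%:R <= m%:R * p - a]%R <=
   (expR (2 * u ^+ 2 * m%:R * p - u * a))%:E)%E.
Proof.
move=> dD mb Pp /andP[u0 u1] p0; have mc := measurable_count mb.
pose g w := - u * \sum_i (b i w)%:R : R.
have mg : measurable_fun setT g by exact: measurable_funM.
apply: (@le_trans _ _ ((expR (- (- u * (m%:R * p - a))))%:E * (expR (m%:R * ((- u + 2 * u ^+ 2) * p)))%:E)%E).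
  apply: (le_trans (@exp_markov _ g (- u * (m%:R * p - a)) _ mg _)).
  - have := measurable_fun_le measurableT mc (measurable_cst (m%:R * p - a)).
    by rewrite setTI.
  - by move=> w /=; rewrite /g => h; rewrite !mulNr lerN2; exact: ler_wpM2l.
  - rewrite lee_pmul2l//; last by rewrite lte_fin expR_gt0.
    apply: (bernoulli_mgf_le dD mb) => i.
    have u12 : - u <= 1 / 2 by lra.
    have e1 : expR (- u) - 1 <= 0 by rewrite subr_le0 -[leRHS]expR0 ler_expR oppr_le0.
    apply: (@le_trans _ _ ((expR (- u) - 1)%:E * p%:E)%E).
      have PB : P [set w | b i w] \is a fin_num.
        by apply: fin_num_measure; exact: measurable_bool_set (sigT_measurable_fun (mb i)).
      have := Pp i; rewrite -(fineK PB) -!EFinM !lee_fin => ?.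
      exact: ler_wnM2l.
    rewrite -EFinM lee_fin; apply: ler_wpM2r => //.
    by have := expR_le_quad u12; rewrite sqrrN; lra.
rewrite -EFinM lee_fin -expRD ler_expR; lra.
Qed.

End chernoff.

(** * Sign flips of the dithered map *)

Section uniform_law.
Context d (T : measurableType d) (R : realType) (P : probability T R).
Variables (lambda : R) (Y : {RV P >-> R}).
Hypothesis uY : has_uniform_law (- lambda) lambda Y.

Lemma uniform_lambda_gt0 : 0 < lambda.
Proof. by case: uY => ab _; lra. Qed.

(** The density never exceeds 1 / (2 lambda), so the interval may leave the support; the reverse
    inequality below requires it to stay inside. *)
Lemma uniform_itv_le (b1 b2 : bool) (x y : R) : x <= y ->
  (P [set w | Y w \in Interval (BSide b1 x) (BSide b2 y)] <= ((y - x) / (2 * lambda))%:E)%E.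
Proof.
move=> xy; case: uY => ab h.
have l0 := uniform_lambda_gt0.
pose B : set (measurableTypeR R) := [set` Interval (BSide b1 x) (BSide b2 y)].
have mB : measurable B by exact: measurable_itv.
have muB := lebesgue_measure_itv (Interval (BSide b1 x) (BSide b2 y)); rewrite -/B /= in muB.
have := h B mB; rewrite /distribution /pushforward /= => ->.
apply: (@le_trans _ _ (\int[lebesgue_measure]_(x in B) ((2 * lambda)^-1)%:E)%E).
  apply: ge0_le_integral => //.
  - by move=> z _; rewrite lee_fin uniform_pdf_ge0.
  - by apply/measurable_EFinP; apply: measurable_funTS; exact: measurable_uniform_pdf.
  - move=> z _; rewrite lee_fin /uniform_pdf; case: ifP => _.
      by rewrite opprK -mulr2n mulr_natl.
    by rewrite invr_ge0 mulr_ge0// ltW.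
have -> : (\int[lebesgue_measure]_(x in B) ((2 * lambda)^-1)%:E =
    ((2 * lambda)^-1)%:E * lebesgue_measure B)%E by rewrite integral_cst.
rewrite muB.
case: ifP => _; last by rewrite mule0 lee_fin divr_ge0// ?subr_ge0// mulr_ge0// ltW.
by rewrite -EFinB -EFinM lee_fin mulrC.
Qed.

Lemma uniform_itv_ge (b1 b2 : bool) (x y : R) : - lambda <= x -> x <= y -> y <= lambda ->
  (((y - x) / (2 * lambda))%:E <= P [set w | Y w \in Interval (BSide b1 x) (BSide b2 y)])%E.
Proof.
move=> lx xy yl; case: uY => ab h.
have l0 := uniform_lambda_gt0.
pose B : set (measurableTypeR R) := [set` Interval (BSide b1 x) (BSide b2 y)].
have mB : measurable B by exact: measurable_itv.
have muB := lebesgue_measure_itv (Interval (BSide b1 x) (BSide b2 y)); rewrite -/B /= in muB.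
have := h B mB; rewrite /distribution /pushforward /= => ->.
apply: (@le_trans _ _ (\int[lebesgue_measure]_(x in B) ((2 * lambda)^-1)%:E)%E); last first.
  apply: ge0_le_integral => //.
  - by move=> z _; rewrite lee_fin invr_ge0 mulr_ge0// ltW.
  - by apply/measurable_EFinP; apply: measurable_funTS; exact: measurable_uniform_pdf.
  - move=> z Bz; have /andP[xz zy] : x <= z <= y.
      by move: Bz; rewrite /B /= in_itv; case: (b1); case: (b2) => /andP[/= ? ?]; apply/andP; split => //; exact: ltW.
    rewrite lee_fin /uniform_pdf ifT ?opprK -?mulr2n ?mulr_natl//.
    by rewrite (le_trans lx xz) (le_trans zy yl).
have -> : (\int[lebesgue_measure]_(x in B) ((2 * lambda)^-1)%:E =
    ((2 * lambda)^-1)%:E * lebesgue_measure B)%E by rewrite integral_cst.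
rewrite muB.
case: ifPn => [_|]; first by rewrite -EFinB -EFinM lee_fin mulrC.
rewrite lte_fin -leNgt => yx; rewrite mule0 lee_fin.
by rewrite (le_anti (introT andP (conj xy yx))) subrr mul0r.
Qed.

End uniform_law.

Section clip.
Context {R : realType}.
Implicit Types lambda u v t : R.

(* A uniform dither on [-lambda, lambda] separates the signs of u and v with
   probability |clip u - clip v| / (2 lambda). *)
Definition clip lambda u : R := Num.max (- lambda) (Num.min u lambda).

(** The distance from u to [-lambda, lambda], that is, the error made by [clip]. *)
Definition excess lambda u : R := Num.max 0 (`|u| - lambda).

Lemma clipP lambda u : 0 < lambda ->
  [\/ u <= - lambda /\ clip lambda u = - lambda,
      - lambda <= u <= lambda /\ clip lambda u = u |
      lambda <= u /\ clip lambda u = lambda].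
Proof.
move=> l0; rewrite /clip.
have [ul|lu] := leP u lambda.
  have [lu|ul'] := leP (- lambda) u.
    by constructor 2.
  by constructor 1; rewrite (ltW ul').
by constructor 3; rewrite (ltW lu) max_r//; lra.
Qed.

Lemma excessP lambda u :
  [/\ 0 <= excess lambda u, u - lambda <= excess lambda u & - u - lambda <= excess lambda u].
Proof.
rewrite /excess; split; rewrite ?le_max ?lexx//.
  by rewrite lerD2r ler_norm orbT.
by rewrite lerD2r -normrN ler_norm orbT.
Qed.

Lemma clip_diff lambda u v : 0 < lambda -> u <= v ->
  [/\ - lambda <= clip lambda u, clip lambda u <= clip lambda v,
      clip lambda v <= lambda &
      v - u - excess lambda u - excess lambda v <= clip lambda v - clip lambda u].
Proof.
move=> l0 uv; have [u1 u2 u3] := excessP lambda u; have [v1 v2 v3] := excessP lambda v.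
by case: (clipP u l0) => -[hu ->]; case: (clipP v l0) => -[hv ->]; split; lra.
Qed.

Lemma clip_itv lambda u v t : 0 < lambda -> u <= v ->
  - clip lambda v <= t < - clip lambda u -> - v <= t < - u.
Proof.
by move=> l0 uv; case: (clipP u l0) => -[hu ->]; case: (clipP v l0) => -[hv ->]; lra.
Qed.

(** From y <= exp y with y = (lambda / 2)(|u| - lambda), the absolute value being absorbed in a sum
    over both signs. For a Gaussian u of variance at most 2, the rate lambda / 2 costs
    [lambda ^+ 2 / 4] of the gain [lambda ^+ 2 / 2]. *)
Lemma excess_le_exp lambda u : 0 < lambda ->
  excess lambda u <= (2 / lambda) * expR (- (lambda ^+ 2 / 2)) *
     (expR (lambda / 2 * u) + expR (- (lambda / 2) * u)).
Proof.
move=> l0.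
have h : excess lambda u <= (2 / lambda) * expR (lambda / 2 * (`|u| - lambda)).
  have l2 : 0 < 2 / lambda by rewrite divr_gt0.
  rewrite /excess ge_max; apply/andP; split; first by rewrite mulr_ge0 ?expR_ge0// ltW.
  have := expR_ge1Dx (lambda / 2 * (`|u| - lambda)) => e.
  rewrite -(ler_pM2l (x := lambda / 2)) ?divr_gt0//.
  rewrite mulrA (_ : lambda / 2 * (2 / lambda) = 1) ?mul1r; last by field; rewrite gt_eqF.
  lra.
apply: (le_trans h).
rewrite -[leRHS]mulrA ler_pM2l ?divr_gt0//.
rewrite mulrBr expRD mulrC (_ : lambda / 2 * lambda = lambda ^+ 2 / 2); last by field.
rewrite ler_pM2l ?expR_gt0//.
by case: (ger0P u) => _; rewrite ?mulrN ?mulNr ?lerDl ?lerDr expR_ge0.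
Qed.

End clip.

Lemma disjoint_fibers (K : finType) (L : eqType) (f : K -> L) (a b : L) : a != b ->
  [disjoint [set k | f k == a]%SET & [set k | f k == b]%SET]%B.
Proof.
move=> ab; rewrite -setI_eq0; apply/eqP/setP => k; rewrite !finset.inE.
by apply/negbTE/negP => /andP[/eqP e1 /eqP e2]; rewrite -e1 e2 eqxx in ab.
Qed.

Section model.
Context d (T : measurableType d) (R : realType) (P : probability T R).
Context (m n : nat) (lambda : R).
Context (A : 'I_m -> 'I_n -> {RV P >-> R}) (tau : 'I_m -> {RV P >-> R}).
Hypothesis dither : gaussian_dither lambda A tau.

Notation K := ('I_m * 'I_n + 'I_m)%type.

Definition fam (k : K) : {RV P >-> R} :=
  match k with inl ij => A ij.1 ij.2 | inr i => tau i end.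

(** The fibres of these three maps are the disjoint index sets behind every use of independence:
    rows together with their dither for Chernoff bounds, rows without it for averaging over the
    dither alone, columns for products over coordinates. *)
Definition row_of (k : K) : 'I_m := match k with inl ij => ij.1 | inr i => i end.

Definition entry_row (k : K) : option 'I_m :=
  match k with inl ij => Some ij.1 | inr _ => None end.

Definition entry_col (k : K) : option 'I_n :=
  match k with inl ij => Some ij.2 | inr _ => None end.

Lemma indep_fam : mutually_independent fam.
Proof. by case: dither. Qed.

Lemma entry_normal i j : has_std_normal_law (A i j).
Proof. by case: dither. Qed.

Lemma tau_uniform i : has_uniform_law (- lambda) lambda (tau i).
Proof. by case: dither. Qed.

Lemma dither_gt0 (i : 'I_m) : 0 < lambda.
Proof. exact: uniform_lambda_gt0 (tau_uniform i). Qed.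

Definition dot (z : 'I_n -> R) (i : 'I_m) (w : T) : R := \sum_j z j * A i j w.

Lemma measurable_dot z i (D : {set K}) : (forall j, inl (i, j) \in D) ->
  measurable_fun setT (dot z i : sigT fam D -> R).
Proof.
by move=> hD; apply: (@measurable_comb _ _ _ _ _ fam _ _ (fun j => inl (i, j))) => j _.
Qed.

Lemma measurable_dotT z i : measurable_fun setT (dot z i).
Proof. by apply: (@sigT_measurable_fun _ _ _ _ _ fam [set: K]%SET); apply: measurable_dot => j; rewrite finset.inE. Qed.

Lemma gaussian_dot z i (F : R -> R) : continuous F -> (forall x, 0 <= F x) ->
  (\int[P]_w (F (dot z i w))%:E =
   \int[normal_prob 0 1]_x (F (Num.sqrt (\sum_j z j ^+ 2) * x))%:E)%E.
Proof.
move=> cF F0.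
apply: (@gaussian_comb _ _ _ _ _ fam indep_fam _ _ (fun j => inl (i, j))) => //.
- exact: index_enum_uniq.
- by move=> j j' _ _ [].
- by move=> j _; exact: entry_normal.
Qed.

Lemma dotB z z' i w : dot z i w - dot z' i w = dot (fun j => z j - z' j) i w.
Proof. by rewrite -sumrB; apply: eq_bigr => j _; rewrite mulrBl. Qed.

Lemma integral_abs_dot z i :
  (\int[P]_w (`|dot z i w|)%:E =
   (Num.sqrt (\sum_j z j ^+ 2) * (2 / Num.sqrt (2 * pi)))%:E)%E.
Proof.
rewrite (gaussian_dot z i (F := fun x => `|x|))//; last exact: norm_continuous.
under eq_integral do rewrite normrM ger0_norm ?sqrtr_ge0// EFinM.
rewrite ge0_integralZl//; last by apply/measurable_EFinP; exact: normr_measurable.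
by rewrite normal_abs -EFinM.
Qed.

Lemma integral_expR_dot z i (t : R) :
  (\int[P]_w (expR (t * dot z i w))%:E =
   (expR (t ^+ 2 * (\sum_j z j ^+ 2) / 2))%:E)%E.
Proof.
have z0 : 0 <= \sum_j z j ^+ 2 by apply: sumr_ge0 => j _; exact: sqr_ge0.
rewrite (gaussian_dot z i (F := fun x => expR (t * x))).
- under eq_integral do rewrite mulrA.
  by rewrite normal_expR exprMn sqr_sqrtr.
- move=> x; apply: (@cvg_comp _ _ _ (fun x => t * x) (@expR R)); last exact: continuous_expR.
  by apply: cvgM; [exact: cvg_cst|exact: cvg_id].
- by move=> x; exact: expR_ge0.
Qed.

Lemma measurable_excess z i : measurable_fun setT (fun w => excess lambda (dot z i w)).
Proof.
apply: measurable_maxr => //; apply: measurable_funB => //.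
by apply: measurableT_comp => //; exact: measurable_dotT.
Qed.

Lemma integral_excess_dot (z : 'I_n -> R) i : \sum_j z j ^+ 2 <= 2 ->
  (\int[P]_w (excess lambda (dot z i w))%:E <=
   ((4 / lambda) * expR (- (lambda ^+ 2 / 4)))%:E)%E.
Proof.
move=> z2; have l0 := dither_gt0 i.
pose c := (2 / lambda) * expR (- (lambda ^+ 2 / 2)).
have c0 : 0 <= c by rewrite mulr_ge0 ?expR_ge0// divr_ge0// ltW.
have mE t : measurable_fun setT (fun w => (expR (t * dot z i w))%:E).
  apply/measurable_EFinP; apply: measurableT_comp => //.
  by apply: measurable_funM => //; exact: measurable_dotT.
apply: (@le_trans _ _ (\int[P]_w (c%:E * ((expR (lambda / 2 * dot z i w))%:E + (expR (- (lambda / 2) * dot z i w))%:E)))%E).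
  apply: le_ge0_integral => w; first by rewrite lee_fin; case: (excessP lambda (dot z i w)).
  by rewrite -EFinD -EFinM lee_fin; exact: excess_le_exp.
rewrite ge0_integralZl//; last 2 first.
- exact: emeasurable_funD.
- by move=> w _; rewrite -EFinD lee_fin addr_ge0 ?expR_ge0.
rewrite ge0_integralD//.
rewrite !integral_expR_dot -EFinD -EFinM lee_fin sqrrN.
set q := (\sum_j z j ^+ 2) in z2 *.
apply: (@le_trans _ _ (c * (expR (lambda ^+ 2 / 4) + expR (lambda ^+ 2 / 4)))).
  have h : (lambda / 2) ^+ 2 * q / 2 <= lambda ^+ 2 / 4.
    have : 0 <= lambda ^+ 2 * (2 - q) by rewrite mulr_ge0 ?sqr_ge0// subr_ge0.
    by rewrite !expr2; lra.
  by rewrite ler_wpM2l// lerD// ler_expR.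
rewrite /c.
have -> : expR (- (lambda ^+ 2 / 2)) = expR (- (lambda ^+ 2 / 4)) * expR (- (lambda ^+ 2 / 4)).
  by rewrite -expRD; congr expR; lra.
have e : expR (- (lambda ^+ 2 / 4)) * expR (lambda ^+ 2 / 4) = 1 by rewrite -expRD addNr expR0.
rewrite (_ : _ * (_ + _) = 4 / lambda * expR (- (lambda ^+ 2 / 4)) * (expR (- (lambda ^+ 2 / 4)) * expR (lambda ^+ 2 / 4))); last by field; rewrite gt_eqF.
by rewrite e mulr1.
Qed.

(** The flip once the two Gaussian values are frozen at u and v, so that only the dither is
    random. *)
Definition tau_flip (u v : R) (i : 'I_m) (w : T) : bool :=
  (0 <= u + tau i w) != (0 <= v + tau i w).

Definition flip (z z' : 'I_n -> R) (i : 'I_m) (w : T) : bool :=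
  tau_flip (dot z i w) (dot z' i w) i w.

Definition in_band (z : 'I_n -> R) (r : R) (i : 'I_m) (w : T) : bool :=
  `|dot z i w + tau i w| <= r.

Notation row_set i := [set k : K | row_of k == i]%SET.
Notation arow_set i := [set k : K | entry_row k == Some i]%SET.

Lemma measurable_neqb d' (U : measurableType d') (f g : U -> bool) :
  measurable_fun setT f -> measurable_fun setT g ->
  measurable_fun setT (fun x => f x != g x).
Proof.
move=> mf mg; rewrite (_ : (fun x => _) = (fun x => (f x && ~~ g x) || (~~ f x && g x))); last first.
  by apply/funext => x; case: (f x); case: (g x).
by apply: measurable_or; apply: measurable_and => //; exact: measurable_neg.
Qed.

Lemma measurable_tau i (D : {set K}) : inr i \in D ->
  measurable_fun setT (tau i : sigT fam D -> R).
Proof. exact: (@measurable_sigT _ _ _ _ _ fam). Qed.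

Lemma measurable_flip z z' i : measurable_fun setT (flip z z' i : sigT fam (row_set i) -> bool).
Proof.
have mt : measurable_fun setT (tau i : sigT fam (row_set i) -> R).
  by apply: measurable_tau; rewrite finset.inE.
have md x : measurable_fun setT (dot x i : sigT fam (row_set i) -> R).
  by apply: measurable_dot => j; rewrite finset.inE.
by apply: measurable_neqb; apply: measurable_fun_ler => //; apply: measurable_funD.
Qed.

Lemma measurable_flip_set z z' i : measurable [set w | flip z z' i w].
Proof.
apply: measurable_bool_set.
exact: sigT_measurable_fun (@measurable_flip z z' i).
Qed.

Lemma measurable_in_band z r i :
  measurable_fun setT (in_band z r i : sigT fam (row_set i) -> bool).
Proof.
have mt : measurable_fun setT (tau i : sigT fam (row_set i) -> R).
  by apply: measurable_tau; rewrite finset.inE.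
have md x : measurable_fun setT (dot x i : sigT fam (row_set i) -> R).
  by apply: measurable_dot => j; rewrite finset.inE.
by apply: measurable_fun_ler => //; apply: measurableT_comp => //; apply: measurable_funD.
Qed.

Lemma flip_setE (u v t : R) : u <= v ->
  ((0 <= u + t) != (0 <= v + t)) = (- v <= t < - u).
Proof.
move=> uv; rewrite -lerBlDl sub0r -[0 <= v + t]lerBlDl sub0r ltNge.
have [h1|h1] := leP (- u) t; have [h2|h2] := leP (- v) t => //.
by exfalso; lra.
Qed.

Lemma flip_tau_le i (u v : R) :
  (P [set w | tau_flip u v i w] <= (`|u - v| / (2 * lambda))%:E)%E.
Proof.
wlog uv : u v / u <= v.
  move=> h; have [uv|/ltW vu] := leP u v; first exact: h.
  rewrite distrC; under eq_set do rewrite /tau_flip eq_sym; exact: h.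
under eq_set do rewrite /tau_flip flip_setE//.
rewrite distrC ger0_norm ?subr_ge0// (_ : v - u = - u - - v); last by lra.
have := @uniform_itv_le _ _ _ _ _ _ (tau_uniform i) true true (- v) (- u).
by rewrite lerN2 => /(_ uv); under eq_set do rewrite in_itv.
Qed.

(** The flip event contains the event that the dither falls between the negated clipped values, an
    interval inside the support; clipping shortens it by at most the two excesses. *)
Lemma flip_tau_ge i (u v : R) :
  ((`|u - v| / (2 * lambda))%:E <=
   P [set w | tau_flip u v i w] +
   ((excess lambda u + excess lambda v) / (2 * lambda))%:E)%E.
Proof.
wlog uv : u v / u <= v.
  move=> h; have [uv|/ltW vu] := leP u v; first exact: h.
  by rewrite distrC [excess lambda u + _]addrC; under eq_set do rewrite /tau_flip eq_sym; exact: h.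
have l0 := dither_gt0 i.
have [c1 c2 c3 c4] := clip_diff l0 uv.
have := @uniform_itv_ge _ _ _ _ _ _ (tau_uniform i) true true (- clip lambda v) (- clip lambda u).
rewrite !lerN2 => /(_ c3 c2); rewrite lerNl => /(_ c1) h.
apply: (@le_trans _ _ (((- clip lambda u - - clip lambda v) / (2 * lambda))%:E + ((excess lambda u + excess lambda v) / (2 * lambda))%:E)%E).
  rewrite -EFinD lee_fin -mulrDl ler_pM2r ?invr_gt0 ?mulr_gt0//.
  rewrite distrC ger0_norm ?subr_ge0//; lra.
apply: leeD => //; apply: (le_trans h).
apply: le_measure; rewrite ?inE.
- have -> : [set w | tau i w \in `[- clip lambda v, - clip lambda u[] = setT `&` tau i @^-1` `[- clip lambda v, - clip lambda u[.
    by rewrite setTI.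
  exact: measurable_funPT.
- apply: measurable_bool_set; apply: measurable_neqb; apply: measurable_fun_ler => //; exact: measurable_funD.
- by move=> w /=; rewrite in_itv /= /tau_flip flip_setE//; exact: clip_itv.
Qed.

Lemma flip_fubini z z' i :
  measurable_fun setT (fun w1 : T => P [set w | tau_flip (dot z i w1) (dot z' i w1) i w]) /\
  (P [set w | flip z z' i w] =
  \int[P]_w1 P [set w | tau_flip (dot z i w1) (dot z' i w1) i w])%E.
Proof.
pose b (w1 w2 : T) := tau_flip (dot z i w1) (dot z' i w1) i w2.
have D12 : [disjoint arow_set i & [set inr i]%SET]%B.
  by rewrite disjoint_sym finset.disjoints1 finset.inE.
have md x : measurable_fun setT (dot x i : sigT fam (arow_set i) -> R).
  by apply: measurable_dot => j; rewrite finset.inE.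
have mt : measurable_fun setT (tau i : sigT fam [set inr i]%SET -> R).
  by apply: measurable_tau; rewrite finset.inE.
have mb : measurable_fun setT (fun x : sigT fam (arow_set i) * sigT fam [set inr i]%SET => b x.1 x.2).
  have mdx x : measurable_fun setT (fun y : sigT fam (arow_set i) * sigT fam [set inr i]%SET => dot x i y.1 + tau i y.2).
    apply: measurable_funD; first exact: (measurableT_comp (md x)).
    exact: (measurableT_comp mt).
  by apply: measurable_neqb; apply: measurable_fun_ler.
by have [] := indep_event indep_fam D12 mb.
Qed.

(** Averaging over the row leaves E |<A_i, z - z'>| / (2 lambda). No tail term appears in this
    direction, because the bound on the dither holds for all values of the row. *)
Lemma flip_prob_le z z' i :
  (P [set w | flip z z' i w] <=
   (Num.sqrt (\sum_j (z j - z' j) ^+ 2) / (Num.sqrt (2 * pi) * lambda))%:E)%E.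
Proof.
have l0 := dither_gt0 i; have pi0 := @sqrt2pi_gt0 R.
have [_ ->] := flip_fubini z z' i.
apply: (@le_trans _ _ (\int[P]_w (((2 * lambda)^-1)%:E * (`|dot (fun j => z j - z' j) i w|)%:E))%E).
  apply: le_ge0_integral => w //.
  by rewrite -EFinM mulrC -dotB; exact: flip_tau_le.
rewrite ge0_integralZl//; last 2 first.
- by apply/measurable_EFinP; apply: measurableT_comp => //; exact: measurable_dotT.
- by rewrite lee_fin invr_ge0 mulr_ge0// ltW.
rewrite integral_abs_dot -EFinM lee_fin le_eqVlt; apply/orP; left; apply/eqP.
by field; rewrite !gt_eqF.
Qed.

(** The error is that of two excesses, each of mean at most
    [4 / lambda * expR (- (lambda ^+ 2 / 4))], divided by 2 lambda. *)
Lemma flip_prob_ge (z z' : 'I_n -> R) i :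
  \sum_j z j ^+ 2 <= 2 -> \sum_j z' j ^+ 2 <= 2 ->
  ((Num.sqrt (\sum_j (z j - z' j) ^+ 2) / (Num.sqrt (2 * pi) * lambda)
    - 4 / lambda ^+ 2 * expR (- (lambda ^+ 2 / 4)))%:E <= P [set w | flip z z' i w])%E.
Proof.
move=> z2 z2'.
have l0 := dither_gt0 i; have pi0 := @sqrt2pi_gt0 R.
have [mf e] := flip_fubini z z' i.
pose c := ((2 * lambda)^-1)%:E.
have c0 : (0 <= c)%E by rewrite lee_fin invr_ge0 mulr_ge0// ltW.
have mex x : measurable_fun setT (fun w => (excess lambda (dot x i w))%:E).
  by apply/measurable_EFinP; exact: measurable_excess.
have ex0 x w : (0 <= (excess lambda (dot x i w))%:E)%E.
  by rewrite lee_fin; case: (excessP lambda (dot x i w)).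
have := @le_ge0_integral _ _ _ P (fun w => c * (`|dot (fun j => z j - z' j) i w|)%:E)%E
  (fun w => P [set w' | tau_flip (dot z i w) (dot z' i w) i w'] +
     c * ((excess lambda (dot z i w))%:E + (excess lambda (dot z' i w))%:E))%E.
rewrite ge0_integralZl//; last first.
  by apply/measurable_EFinP; apply: measurableT_comp => //; exact: measurable_dotT.
rewrite integral_abs_dot ge0_integralD//; last 2 first.
- by move=> w _; rewrite mule_ge0// adde_ge0.
- by apply: emeasurable_funM => //; exact: emeasurable_funD.
rewrite -e ge0_integralZl//; last 2 first.
- exact: emeasurable_funD.
- by move=> w _; rewrite adde_ge0.
rewrite ge0_integralD// => H.
have mF : measurable [set w | flip z z' i w].
  exact: measurable_flip_set.
have {}H : (c * (Num.sqrt (\sum_j (z j - z' j) ^+ 2) * (2 / Num.sqrt (2 * pi)))%:E <=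
   P [set w | flip z z' i w] + c * (((4 / lambda) * expR (- (lambda ^+ 2 / 4)))%:E + ((4 / lambda) * expR (- (lambda ^+ 2 / 4)))%:E))%E.
  apply: (le_trans (H _ _)).
  - by move=> w; rewrite mule_ge0.
  - move=> w; rewrite /c -EFinD -!EFinM mulrC -dotB [_ * (_ + _)]mulrC; exact: flip_tau_ge.
  - by rewrite leeD2l// lee_wpmul2l// leeD// integral_excess_dot.
have PF : P [set w | flip z z' i w] \is a fin_num by exact: fin_num_measure.
move: H; rewrite /c -(fineK PF); set p := fine _; set a := 4 / lambda * _ => H.
have {}H : (2 * lambda)^-1 * (Num.sqrt (\sum_j (z j - z' j) ^+ 2) * (2 / Num.sqrt (2 * pi)))
    <= p + (2 * lambda)^-1 * (a + a) by rewrite -lee_fin; exact: H.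
rewrite lee_fin.
rewrite lerBlDr; apply: le_trans (le_trans H _); rewrite le_eqVlt; apply/orP; left; apply/eqP.
  by field; rewrite !gt_eqF.
by rewrite /a; congr (_ + _); field; rewrite !gt_eqF.
Qed.

(** For a frozen row, the dither must fall in an interval of length 2 r. *)
Lemma band_prob_le z (r : R) i : 0 <= r ->
  (P [set w | in_band z r i w] <= (r / lambda)%:E)%E.
Proof.
move=> r0; have l0 := dither_gt0 i.
pose b (w1 w2 : T) := `|dot z i w1 + tau i w2| <= r.
have D12 : [disjoint arow_set i & [set inr i]%SET]%B.
  by rewrite disjoint_sym finset.disjoints1 finset.inE.
have md : measurable_fun setT (dot z i : sigT fam (arow_set i) -> R).
  by apply: measurable_dot => j; rewrite finset.inE.
have mt : measurable_fun setT (tau i : sigT fam [set inr i]%SET -> R).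
  by apply: measurable_tau; rewrite finset.inE.
have mb : measurable_fun setT (fun x : sigT fam (arow_set i) * sigT fam [set inr i]%SET => b x.1 x.2).
  apply: measurable_fun_ler => //; apply: measurableT_comp => //.
  apply: measurable_funD; first exact: (measurableT_comp md).
  exact: (measurableT_comp mt).
have [mbw mF ->] := indep_event indep_fam D12 mb.
apply: (@le_trans _ _ (\int[P]_w (r / lambda)%:E)%E); last by rewrite integral_cst//= probability_setT mule1.
apply: le_ge0_integral => w1 //.
have := @uniform_itv_le _ _ _ _ _ _ (tau_uniform i) true false (- r - dot z i w1) (r - dot z i w1).
have -> : r - dot z i w1 - (- r - dot z i w1) = 2 * r by lra.
rewrite -mulf_div mulfV// mul1r lerD2r => h.
apply: le_trans (h _); last lra.
rewrite (_ : [set w | b w1 w] = [set w | tau i w \in `[- r - dot z i w1, r - dot z i w1]])//.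
apply/funext => w; apply/propext; rewrite /b /= in_itv /= ler_norml.
by rewrite -lerBlDl -[_ + _ <= r]lerBrDl.
Qed.

(** * Columns of the Gaussian matrix: exponential moments for A^T u *)

Notation acol_set j := [set k : K | entry_col k == Some j]%SET.

Lemma column_prod (s : seq 'I_n) (f : 'I_n -> T -> R) : uniq s ->
  (forall j, measurable_fun setT (f j : sigT fam (acol_set j) -> R)) ->
  (forall j w, 0 <= f j w) ->
  (\int[P]_w (\prod_(j <- s) f j w)%:E = \prod_(j <- s) \int[P]_w (f j w)%:E)%E.
Proof.
move=> us mf f0.
apply: (indep_integral_prod indep_fam (D := fun j => acol_set j)) => //.
by move=> j j' _ _ jj'; apply: (@disjoint_fibers _ _ entry_col); apply: contra_neq jj' => -[].
Qed.

Definition tdot (u : 'I_m -> R) (j : 'I_n) (w : T) : R := \sum_i u i * A i j w.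

Lemma measurable_tdot u j (D : {set K}) : (forall i, inl (i, j) \in D) ->
  measurable_fun setT (tdot u j : sigT fam D -> R).
Proof.
by move=> hD; apply: (@measurable_comb _ _ _ _ _ fam _ _ (fun i => inl (i, j))) => i _.
Qed.

(** The coordinates of A^T u are independent of law N(0, |u|^2). With the factor 1 / (4 |u|^2) each
    contributes E exp(g^2 / 4) = sqrt 2, which is at most exp(1/2) because e >= 2. *)
Lemma tdot_sqr_mgf (u : 'I_m -> R) (s : seq 'I_n) : uniq s -> 0 < \sum_i u i ^+ 2 ->
  (\int[P]_w (expR ((\sum_(j <- s) tdot u j w ^+ 2) / (4 * \sum_i u i ^+ 2)))%:E <=
   (expR ((size s)%:R / 2))%:E)%E.
Proof.
move=> us; set q := \sum_i _ => q0.
under eq_integral do rewrite mulr_suml expR_sum.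
rewrite column_prod//; first last.
- move=> j; apply: measurableT_comp => //; apply: measurable_funM => //.
  by apply: measurable_funX; apply: measurable_tdot => i; rewrite finset.inE.
have h j : (\int[P]_w (expR (tdot u j w ^+ 2 / (4 * q)))%:E <= (expR (1 / 2))%:E)%E.
  rewrite (@gaussian_comb _ _ _ _ _ fam indep_fam 'I_m (index_enum _) (fun i => inl (i, j)) u (fun x => expR (x ^+ 2 / (4 * q))))//; first last.
  - move=> x; apply: (@cvg_comp _ _ _ (fun x => x ^+ 2 / (4 * q)) (@expR R)); last exact: continuous_expR.
    by apply: cvgM; [exact: sqr_continuous|exact: cvg_cst].
  - by move=> i _; exact: entry_normal.
  - by move=> i i' _ _ [].
  - exact: index_enum_uniq.
  rewrite -/q.
  under eq_integral => x _.
    rewrite exprMn sqr_sqrtr ?(ltW q0)// (_ : q * x ^+ 2 / (4 * q) = - ((- (1 / 2)) * x ^+ 2 / 2)); last by field; rewrite gt_eqF.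
    over.
  rewrite normal_expR_sqr; last lra.
  rewrite lee_fin -[leRHS]invrK -expRN lef_pV2 ?posrE ?expR_gt0 ?sqrtr_gt0//; last lra.
  rewrite -(@ler_pXn2r _ 2)// ?nnegrE ?expR_ge0 ?sqrtr_ge0// sqr_sqrtr; last lra.
  rewrite -expRM_natl (_ : 2%:R * - (1 / 2) = - 1); last lra.
  have e2 := expR_ge1Dx (1 : R); have e3 := expR_gt0 (- 1 : R).
  have : expR 1 * expR (- 1) = 1 :> R by rewrite -expRD subrr expR0.
  by nra.
elim: s {us} => [|j s ih]; first by rewrite big_nil mul0r expR0.
rewrite big_cons (_ : (size (j :: s))%:R / 2 = 1 / 2 + (size s)%:R / 2); last first.
  by rewrite /= -natr1; lra.
rewrite expRD EFinM.
apply: lee_pmul => //.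
- by apply: integral_ge0 => w _; rewrite lee_fin expR_ge0.
- apply: (big_ind (fun x => 0 <= x)%E) => //; first by move=> x y x0 y0; rewrite mule_ge0.
  by move=> j' _; apply: integral_ge0 => w _; rewrite lee_fin expR_ge0.
Qed.

Definition tdot' (v : 'I_m -> R) (i0 : 'I_m) (j : 'I_n) (w : T) : R :=
  \sum_(i <- [seq i <- index_enum 'I_m | i != i0]) v i * A i j w.

(* Conditionally on the entry a of row i0, the rest of column j contributes a
   centred Gaussian of variance a^2 (|v|^2 - 1). *)
Lemma column_mgf (v : 'I_m -> R) (i0 : 'I_m) (j : 'I_n) (t : R) :
  v i0 ^+ 2 = 1 -> let q := \sum_i v i ^+ 2 in -1 < 2 * t - t ^+ 2 * (q - 1) ->
  (\int[P]_w (expR (- t * (v i0 * A i0 j w * tdot v j w)))%:E =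
   ((Num.sqrt (1 + (2 * t - t ^+ 2 * (q - 1))))^-1)%:E)%E.
Proof.
move=> vi q tq.
have tdE w : tdot v j w = v i0 * A i0 j w + tdot' v i0 j w.
  rewrite /tdot (bigD1 i0)//= /tdot' big_filter; congr (_ + _).
have qE : \sum_(i <- [seq i <- index_enum 'I_m | i != i0]) v i ^+ 2 = q - 1.
  by rewrite big_filter /q [in RHS](bigD1 i0)//= vi addrAC subrr add0r.
pose H (w1 w2 : T) := (expR (- t * (A i0 j w1 ^+ 2 + v i0 * A i0 j w1 * tdot' v i0 j w2)))%:E.
transitivity (\int[P]_w H w w)%E.
  apply: eq_integral => w _; rewrite /H tdE; congr (expR (- t * _))%:E.
  rewrite mulrDr; congr (_ + _).
  by rewrite mulrACA -!expr2 vi mul1r.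
pose D2 := [set inl (i, j) | i in [set i | i != i0]]%SET : {set K}.
have D12 : [disjoint [set inl (i0, j)]%SET & D2]%B.
  rewrite finset.disjoints1; apply/imsetP => -[i]; rewrite finset.inE => ii0 [e].
  by rewrite e eqxx in ii0.
have mA : measurable_fun setT (A i0 j : sigT fam [set inl (i0, j)]%SET -> R).
  by apply: (@measurable_sigT _ _ _ _ _ fam _ (inl (i0, j))); exact: finset.set11.
have mt : measurable_fun setT (tdot' v i0 j : sigT fam D2 -> R).
  apply: (@measurable_comb _ _ _ _ _ fam _ _ (fun i => inl (i, j))) => i.
  by rewrite mem_filter => /andP[ii0 _]; apply: imset_f; rewrite finset.inE.
have [||_ ->] := @indep_fubini _ _ _ _ _ _ indep_fam _ _ H D12.
- apply/measurable_EFinP; apply: measurableT_comp => //; apply: measurable_funM => //.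
  apply: measurable_funD.
    by apply: measurable_funX; exact: (measurableT_comp mA).
  apply: measurable_funM; last exact: (measurableT_comp mt).
  by apply: measurable_funM => //; exact: (measurableT_comp mA).
- by move=> w1 w2; rewrite lee_fin expR_ge0.
(* With x the entry of row [i0], averaging over the other rows gives exp(- t x^2) exp(t^2 x^2 (q -
   1) / 2). *)
transitivity (\int[P]_w (expR (- ((2 * t - t ^+ 2 * (q - 1)) * A i0 j w ^+ 2 / 2)))%:E)%E.
  apply: eq_integral => w _; rewrite /H; set x := A i0 j w.
  under eq_integral do rewrite mulrDr expRD EFinM.
  rewrite ge0_integralZl//; last first.
  - apply/measurable_EFinP; apply: measurableT_comp => //; apply: measurable_funM => //.
    by apply: measurable_funM => //; exact: sigT_measurable_fun mt.
  transitivity ((expR (- t * x ^+ 2))%:E * (expR (t ^+ 2 * x ^+ 2 * (q - 1) / 2))%:E)%E; last first.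
    by rewrite -EFinM -expRD; congr (expR _)%:E; field.
  congr (_ * _)%E.
  transitivity (\int[P]_w (expR (\sum_(i <- [seq i <- index_enum 'I_m | i != i0]) (- t * v i0 * x * v i) * A i j w))%:E)%E.
    apply: eq_integral => w' _; congr (expR _)%:E; rewrite /tdot' !mulr_sumr.
    by apply: eq_bigr => i _; ring.
  rewrite (@gaussian_comb _ _ _ _ _ fam indep_fam 'I_m _ (fun i => inl (i, j)) _ (@expR R))//; first last.
  - exact: continuous_expR.
  - by move=> i _; exact: entry_normal.
  - by move=> i i' _ _ [].
  - by apply: filter_uniq; exact: index_enum_uniq.
  rewrite normal_expR sqr_sqrtr; last by apply: sumr_ge0 => i _; exact: sqr_ge0.
  congr (expR (_ / 2))%:E.
  under eq_bigr do rewrite exprMn.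
  rewrite -mulr_sumr qE; congr (_ * _).
  by rewrite !exprMn vi sqrrN mulr1.
rewrite (@ge0_integral_std_normal _ _ _ _ (A i0 j) (fun x => (expR (- ((2 * t - t ^+ 2 * (q - 1)) * x ^+ 2 / 2)))%:E) (entry_normal i0 j)).
- by rewrite normal_expR_sqr.
- apply/measurable_EFinP; apply: measurableT_comp => //; apply: measurableT_comp => //.
  by apply: measurable_funM => //; apply: measurable_funM => //; exact: measurable_funX.
- by move=> x; rewrite lee_fin expR_ge0.
Qed.

(** [column_mgf] at t = 1 / q, where 2 t - t^2 (q - 1) = 1 / q + 1 / q^2 >= 1 / q. Each column then
    contributes at most (1 + 1 / q)^(-1/2) <= exp(- 1 / (4 q)), by [expR_le_quad] at 1 / (2 q). *)
Lemma row_tdot_mgf (v : 'I_m -> R) (i0 : 'I_m) (s : seq 'I_n) : uniq s ->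
  v i0 ^+ 2 = 1 -> let q := \sum_i v i ^+ 2 in 1 <= q ->
  (\int[P]_w (expR (- (v i0 * \sum_(j <- s) A i0 j w * tdot v j w) / q))%:E <=
   (expR (- ((size s)%:R / (4 * q))))%:E)%E.
Proof.
move=> us vi q q1; have q0 : 0 < q by lra.
pose f j w := expR (- q^-1 * (v i0 * A i0 j w * tdot v j w)).
have -> : (\int[P]_w (expR (- (v i0 * \sum_(j <- s) A i0 j w * tdot v j w) / q))%:E =
    \int[P]_w (\prod_(j <- s) f j w)%:E)%E.
  apply: eq_integral => w _; rewrite -expR_sum mulr_sumr -sumrN mulr_suml.
  by congr (expR _)%:E; apply: eq_bigr => j _; field; rewrite gt_eqF.
rewrite column_prod//; first last.
- by move=> j w; exact: expR_ge0.
- move=> j; apply: measurableT_comp => //; apply: measurable_funM => //.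
  apply: measurable_funM.
    apply: measurable_funM => //.
    by apply: (@measurable_sigT _ _ _ _ _ fam _ (inl (i0, j))); rewrite finset.inE.
  by apply: measurable_tdot => i; rewrite finset.inE.
pose x := 2 * q^-1 - q^-1 ^+ 2 * (q - 1).
have qi0 : 0 < q^-1 by rewrite invr_gt0.
have qq : q * q^-1 = 1 by rewrite mulfV// gt_eqF.
have qi1 : q^-1 <= 1 by nra.
have xq : q^-1 <= x.
  rewrite /x (_ : q^-1 ^+ 2 * (q - 1) = q^-1 - q^-1 ^+ 2); last by field; rewrite gt_eqF.
  have := sqr_ge0 q^-1; lra.
have h j : (\int[P]_w (f j w)%:E <= (expR (- (q^-1 / 4)))%:E)%E.
  rewrite /f (@column_mgf v i0 j q^-1 vi); last by rewrite -/x; lra.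
  rewrite -/x lee_fin expRN lef_pV2 ?posrE ?expR_gt0 ?sqrtr_gt0//; last lra.
  rewrite -(@ler_pXn2r _ 2)// ?nnegrE ?expR_ge0 ?sqrtr_ge0// sqr_sqrtr; last lra.
  rewrite -expRM_natl (_ : 2%:R * (q^-1 / 4) = q^-1 / 2); last lra.
  have /expR_le_quad : q^-1 / 2 <= 1 / 2 by lra.
  rewrite expr2; nra.
elim: s {us} => [|j s ih]; first by rewrite big_nil mul0r oppr0 expR0.
rewrite big_cons (_ : - ((size (j :: s))%:R / (4 * q)) = - (q^-1 / 4) - (size s)%:R / (4 * q)); last first.
  by rewrite /= -natr1; field; rewrite gt_eqF.
rewrite expRD EFinM.
apply: lee_pmul => //.
- by apply: integral_ge0 => w _; rewrite lee_fin expR_ge0.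
- apply: (big_ind (fun x => 0 <= x)%E) => //; first by move=> y z y0 z0; rewrite mule_ge0.
  by move=> j' _; apply: integral_ge0 => w _; rewrite lee_fin expR_ge0.
Qed.

End model.

(** * Gaussian width and nets of the ellipsoid *)

Section ell_star_bounds.
Context {R : realType}.
Local Notation RR := (measurableTypeR R).
Local Notation gamma := (normal_prob (0 : R) 1).

Lemma std_gaussian_marginal (n : nat) (i : 'I_n) (h : RR -> \bar R) :
  measurable_fun setT h -> (forall x, 0 <= h x)%E ->
  (\int[std_gaussian R n]_g h (tnth g i) = \int[gamma]_x h x)%E.
Proof.
move=> mh h0; elim: n i => [[]//|n ih i].
have mt (j : 'I_n.+1) : measurable_fun setT (fun g : n.+1.-tuple RR => h (tnth g j)).
  by apply: measurableT_comp => //; exact: measurable_tnth.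
rewrite [std_gaussian _ _]/= ge0_integral_distribution//=.
rewrite fubini_tonelli1//=; last first.
  by apply: (measurableT_comp (mt i)); exact: measurable_tuple_cons.
rewrite /fubini_F /=.
have [->|] := eqVneq i ord0.
  apply: eq_integral => x _.
  transitivity (\int[std_gaussian R n]_y (cst (h x)) y)%E.
    by apply: eq_integral => y _; congr h; rewrite (tnth_nth x).
  by rewrite integral_cst//= probability_setT mule1.
move=> /eqP i0; have [j ->] : exists j, i = lift ord0 j.
  by case: (unliftP ord0 i) => [j ->|//]; exists j.
under eq_integral => x _.
  under eq_integral => y _ do rewrite tnthS /=.
  rewrite ih; over.
by rewrite integral_cst//= probability_setT mule1.
Qed.

(** x^2 <= 4 exp(x^2 / 4), whose integral is 4 sqrt 2 < 6. *)
Lemma normal_sqr_le : (\int[gamma]_x (x ^+ 2)%:E <= 6%:E)%E.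
Proof.
apply: (@le_trans _ _ (\int[gamma]_x (4%:E * (expR (- (- (1 / 2) * x ^+ 2 / 2)))%:E))%E).
  apply: le_ge0_integral => x; first by rewrite lee_fin sqr_ge0.
  rewrite -EFinM lee_fin; have := expR_ge1Dx (- (- (1 / 2) * x ^+ 2 / 2)); lra.
rewrite ge0_integralZl//; last first.
  apply/measurable_EFinP; apply: measurableT_comp => //; apply: measurableT_comp => //.
  by apply: measurable_funM => //; apply: measurable_funM => //; exact: measurable_funX.
rewrite normal_expR_sqr; last lra.
rewrite -EFinM lee_fin -ler_pdivlMl// -[leRHS]invrK lef_pV2 ?posrE ?sqrtr_gt0//; try lra.
rewrite -(@ler_pXn2r _ 2)// ?nnegrE ?sqrtr_ge0// sqr_sqrtr; lra.
Qed.

Lemma l2norm_le_sqr (n : nat) (x : 'cV[R]_n) (e : R) : 0 <= e ->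
  l2norm x <= e -> \sum_i x i 0 ^+ 2 <= e ^+ 2.
Proof.
move=> e0 h; have s0 : 0 <= \sum_i x i 0 ^+ 2 by apply: sumr_ge0 => i _; exact: sqr_ge0.
by rewrite -(sqr_sqrtr s0) ler_pXn2r// nnegrE sqrtr_ge0.
Qed.

(** Weighted arithmetic-geometric inequality in each coordinate. Compared with Cauchy-Schwarz, the
    right side is affine in the squares of a and can be integrated term by term. *)
Lemma sum_mul_le (n : nat) (a b : 'I_n -> R) (q v : R) : 0 < q -> 0 < v ->
  \sum_i b i ^+ 2 <= v ->
  `|\sum_i a i * b i| <= q / 2 + \sum_i v / (2 * q) * a i ^+ 2.
Proof.
move=> q0 v0 bv.
apply: (le_trans (ler_norm_sum _ _ _)).
apply: (@le_trans _ _ (\sum_i (v / (2 * q) * a i ^+ 2 + q / (2 * v) * b i ^+ 2))).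
  apply: ler_sum => i _; rewrite -subr_ge0 normrM -(real_normK (num_real (a i))) -(real_normK (num_real (b i))).
  rewrite (_ : _ - _ = (2 * q * v)^-1 * (v * `|a i| - q * `|b i|) ^+ 2); last by field; rewrite !gt_eqF.
  by rewrite mulr_ge0 ?sqr_ge0// invr_ge0 !mulr_ge0// ltW.
rewrite big_split /= addrC lerD2r -mulr_sumr.
rewrite (_ : q / 2 = q / (2 * v) * v); last by field; rewrite gt_eqF.
by rewrite ler_wpM2l// divr_ge0 ?mulr_ge0// ltW.
Qed.

Variables (r k : nat) (eps : R).
Hypothesis r0 : (0 < r)%N.
Hypothesis eps0 : 0 < eps.

(** The block I suffices: testing against the signs of g divided by sqrt r gives the l1-norm of g on
    I over sqrt r, whose mean is sqrt r E |g_1|. *)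
Lemma ell_star_ge :
  ((2 / Num.sqrt (2 * pi) * Num.sqrt r%:R)%:E <= ell_star (@ellipsoid R r k eps))%E.
Proof.
have sr0 : 0 < Num.sqrt r%:R :> R by rewrite sqrtr_gt0 ltr0n.
have rE : r%:R = Num.sqrt r%:R * Num.sqrt r%:R :> R by rewrite -expr2 sqr_sqrtr.
apply: (@le_trans _ _ (\int[std_gaussian R (r + k)]_g (\sum_(i < r) ((Num.sqrt r%:R)^-1 * `|tnth g (lshift k i)|)%:E))%E).
  rewrite ge0_integral_sum//; last first.
    move=> i; apply/measurable_EFinP; apply: measurable_funM => //.
    by apply: measurableT_comp => //; exact: measurable_tnth.
  under eq_bigr => i _.
    rewrite (@std_gaussian_marginal _ (lshift k i) (fun x => ((Num.sqrt r%:R)^-1 * `|x|)%:E))//; last first.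
      by apply/measurable_EFinP; apply: measurable_funM => //; exact: normr_measurable.
    under eq_integral do rewrite EFinM.
    rewrite ge0_integralZl//; last by apply/measurable_EFinP; exact: normr_measurable.
    rewrite normal_abs -EFinM; over.
  rewrite sumEFin lee_fin sumr_const card_ord -[leRHS]mulr_natr.
  set q := Num.sqrt r%:R in sr0 rE *; rewrite rE le_eqVlt; apply/orP; left; apply/eqP.
  by field; rewrite !gt_eqF// sqrt2pi_gt0.
apply: le_ge0_integral => g.
  by rewrite sumEFin lee_fin; apply: sumr_ge0 => i _; rewrite mulr_ge0// invr_ge0 ltW.
(* [Num.sg] vanishes where g does, so the norm of this block is only at most 1. *)
pose t : 'cV[R]_(r + k) := \col_j match fintype.split j with
  | inl i => (Num.sqrt r%:R)^-1 * Num.sg (tnth g j) | inr _ => 0 end.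
apply: (@le_trans _ _ `|\sum_i tnth g i * t i 0|%:E); last first.
  apply: ereal_sup_ubound; exists t => //; split.
    rewrite -[leRHS]sqrtr1 ler_wsqrtr//.
    apply: (@le_trans _ _ (\sum_(i < r) r%:R^-1)).
      apply: ler_sum => i _; rewrite !mxE (unsplitK (inl _ i)) exprMn exprVn sqr_sqrtr//.
      by rewrite ler_piMr ?invr_ge0// sqr_sg lern1 leq_b1.
    by rewrite sumr_const card_ord -[_ *+ r]mulr_natr mulVf// pnatr_eq0 -lt0n.
  rewrite (_ : l2norm _ = 0) ?ltW// /l2norm big1 ?sqrtr0// => i _.
  by rewrite !mxE (unsplitK (inr _ i)) expr0n.
rewrite big_split_ord /= [X in _ + X]big1 => [|i _]; last by rewrite mxE (unsplitK (inr _ i)) mulr0.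
rewrite addr0 sumEFin lee_fin; apply: le_trans (ler_norm _).
apply: ler_sum => i _; rewrite mxE (unsplitK (inl _ i)) mulrCA; apply: ler_wpM2l.
  by rewrite invr_ge0 ltW.
by rewrite [leRHS]mulrC -normrEsg.
Qed.

(** [sum_mul_le] with q = sqrt r on each block bounds the supremum by q + (|g_I|^2 + eps^2 |g_J|^2)
    / (2 q). With second moments at most 6 and k eps^2 <= r, the mean is at most q + 6 q. *)
Lemma ell_star_le : k%:R * eps ^+ 2 <= r%:R ->
  (ell_star (@ellipsoid R r k eps) <= (7 * Num.sqrt r%:R)%:E)%E.
Proof.
move=> hk.
have sr0 : 0 < Num.sqrt r%:R :> R by rewrite sqrtr_gt0 ltr0n.
have rE : r%:R = Num.sqrt r%:R * Num.sqrt r%:R :> R by rewrite -expr2 sqr_sqrtr.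
set q := Num.sqrt r%:R in sr0 rE *.
pose cI : R := (2 * q)^-1; pose cJ : R := eps ^+ 2 / (2 * q).
have cI0 : 0 <= cI by rewrite invr_ge0 mulr_ge0// ltW.
have cJ0 : 0 <= cJ by rewrite divr_ge0 ?sqr_ge0// mulr_ge0// ltW.
pose c (j : 'I_(r + k)) := match fintype.split j with inl _ => cI | inr _ => cJ end.
have c0 j : 0 <= c j by rewrite /c; case: fintype.split.
apply: (@le_trans _ _ (\int[std_gaussian R (r + k)]_g (q%:E + \sum_j (c j * tnth g j ^+ 2)%:E))%E).
  apply: le_ge0_integral => g.
    apply: (@le_trans _ _ `|\sum_i tnth g i * (0 : 'cV[R]_(r + k)) i 0|%:E); first by rewrite lee_fin.
    apply: ereal_sup_ubound; exists 0 => //; split.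
      rewrite /l2norm big1 ?sqrtr0// => i _; by rewrite !mxE expr0n.
    rewrite /l2norm big1 ?sqrtr0 ?ltW// => i _; by rewrite !mxE expr0n.
  apply: ge_ereal_sup => _ [t [tI tJ] <-].
  rewrite sumEFin -EFinD lee_fin.
  have tI2 := l2norm_le_sqr ler01 tI; have tJ2 := l2norm_le_sqr (ltW eps0) tJ.
  rewrite expr1n in tI2.
  rewrite !big_split_ord /=.
  have hI : `|\sum_(i < r) tnth g (lshift k i) * t (lshift k i) 0| <= q / 2 + \sum_(i < r) c (lshift k i) * tnth g (lshift k i) ^+ 2.
    under [X in _ <= _ + X]eq_bigr do rewrite /c (unsplitK (inl _ _)) /cI -[(2 * q)^-1]mul1r.
    apply: sum_mul_le => //; apply: le_trans tI2.
    by apply: ler_sum => i _; rewrite mxE.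
  have hJ : `|\sum_(i < k) tnth g (rshift r i) * t (rshift r i) 0| <= q / 2 + \sum_(i < k) c (rshift r i) * tnth g (rshift r i) ^+ 2.
    under [X in _ <= _ + X]eq_bigr do rewrite /c (unsplitK (inr _ _)) /cJ.
    apply: sum_mul_le => //; first by rewrite exprn_gt0.
    by apply: le_trans tJ2; apply: ler_sum => i _; rewrite mxE.
  by apply: (le_trans (ler_normD _ _)); lra.
have mcg j : measurable_fun setT (fun g : (r + k).-tuple RR => (c j * tnth g j ^+ 2)%:E).
  apply/measurable_EFinP; apply: measurable_funM => //.
  by apply: measurable_funX; exact: measurable_tnth.
have cg0 j (g : (r + k).-tuple RR) : (0 <= (c j * tnth g j ^+ 2)%:E)%E.
  by rewrite lee_fin mulr_ge0 ?sqr_ge0.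
rewrite ge0_integralD//; first last.
- exact: emeasurable_sum.
- by move=> g _; apply: sume_ge0 => j _.
- by move=> g _; rewrite lee_fin ltW.
rewrite integral_cst//= probability_setT mule1 ge0_integral_sum//.
apply: (@le_trans _ _ (q%:E + \sum_j (c j * 6)%:E)%E).
  apply: leeD => //; apply: lee_sum => j _.
  rewrite (@std_gaussian_marginal _ j (fun x => (c j * x ^+ 2)%:E)); last 2 first.
  - by apply/measurable_EFinP; apply: measurable_funM => //; exact: measurable_funX.
  - by move=> x; rewrite lee_fin mulr_ge0 ?sqr_ge0.
  under eq_integral do rewrite EFinM.
  rewrite ge0_integralZl//; last 3 first.
  - by apply/measurable_EFinP; exact: measurable_funX.
  - by move=> x _; rewrite lee_fin sqr_ge0.
  - by rewrite lee_fin.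
  by rewrite EFinM lee_wpmul2l ?lee_fin// normal_sqr_le.
rewrite sumEFin -EFinD lee_fin big_split_ord /=.
under eq_bigr do rewrite /c (unsplitK (inl _ _)).
under [X in _ + (_ + X)]eq_bigr do rewrite /c (unsplitK (inr _ _)).
rewrite !sumr_const !card_ord -[(cI * 6) *+ r]mulr_natr -[(cJ * 6) *+ k]mulr_natr /cI /cJ.
rewrite (_ : _ + (_ + _) = q + 3 / q * (r%:R + k%:R * eps ^+ 2)); last by field; rewrite gt_eqF.
apply: (@le_trans _ _ (q + 3 / q * (r%:R + r%:R))).
  by rewrite lerD2l ler_wpM2l ?lerD2l// divr_ge0// ltW.
rewrite rE le_eqVlt; apply/orP; left; apply/eqP.
by field; rewrite gt_eqF.
Qed.

End ell_star_bounds.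

(** * A lattice net of the Euclidean unit ball *)

Section lattice_net.
Context {R : realType}.
Variables (r : nat) (eps : R).
Hypothesis r0 : (0 < r)%N.
Hypothesis eps0 : 0 < eps.
Hypothesis eps1 : eps <= 1 / 4.

Definition mesh : R := eps / Num.sqrt r%:R.

(** The absolute values in [0, 1] are rounded down to multiples of [mesh]; the multipliers range
    from 0 to the integer part of 1 / [mesh]. *)
Definition mesh_size : nat := (Num.truncn (Num.sqrt r%:R / eps)).+1.

(* Sign and absolute value of each coordinate in the lattice of mesh eps / sqrt r;
   a point of the unit ball has l1-norm at most sqrt r, hence the bound in [net]. *)
Definition code := {ffun 'I_r -> bool * 'I_mesh_size}.

Definition net : {set code} := [set f : code | (\sum_i (f i).2)%:R <= r%:R / eps]%SET.

Definition net_point (f : code) (i : 'I_r) : R := (-1) ^+ (f i).1 * ((f i).2)%:R * mesh.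

Lemma sqrt_r_gt0 : 0 < Num.sqrt r%:R :> R.
Proof. by rewrite sqrtr_gt0 ltr0n. Qed.

Lemma mesh_gt0 : 0 < mesh.
Proof. by rewrite divr_gt0// sqrt_r_gt0. Qed.

(* Weighting a code by x^(sum of its entries) with x = exp(-eps) and summing
   over all codes gives a product of geometric series. *)
Lemma card_net : #|net|%:R <= expR (r%:R * (1 + ln (4 / eps))) :> R.
Proof.
set x := expR (- eps).
have x0 : 0 < x by exact: expR_gt0.
have x1 : x <= 1 - eps / 2.
  have : - eps <= 1 / 2 by move: eps0; lra.
  by move=> /expR_le_quad; rewrite -/x sqrrN => h; move: eps0 eps1 => e0 e1; nra.
have e0 : 0 < 4 / eps by rewrite divr_gt0.
have geo (N : nat) : \sum_(k < N) x ^+ k <= 2 / eps.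
  have h := subrX1 x N; have xN : 0 <= x ^+ N by rewrite exprn_ge0// ltW.
  have S0 : 0 <= \sum_(k < N) x ^+ k by apply: sumr_ge0 => k _; rewrite exprn_ge0// ltW.
  rewrite ler_pdivlMr//; have : 0 <= (1 - eps / 2 - x) * \sum_(k < N) x ^+ k.
    by rewrite mulr_ge0// subr_ge0.
  by nra.
have sumall : \sum_(f : code) \prod_i x ^+ (f i).2 <= (4 / eps) ^+ r.
  rewrite -(bigA_distr_bigA (fun (i : 'I_r) (c : bool * 'I_mesh_size) => x ^+ c.2)) /=.
  rewrite prodr_const card_ord; apply: lerXn2r.
  - by rewrite nnegrE; apply: sumr_ge0 => c _; rewrite exprn_ge0// ltW.
  - by rewrite nnegrE ltW.
  rewrite -(pair_bigA _ (fun (b : bool) (k : 'I_mesh_size) => x ^+ k)) /= big_bool.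
  have h := geo mesh_size; apply: (le_trans (lerD h h)); lra.
have low : #|net|%:R * expR (- r%:R) <= \sum_(f : code) \prod_i x ^+ (f i).2.
  rewrite (bigID (fun f => f \in net)) /=; apply: ler_wpDr.
    by apply: sumr_ge0 => f _; apply: prodr_ge0 => i _; rewrite exprn_ge0// ltW.
  rewrite mulrC mulr_natr -sumr_const; apply: ler_sum => f; rewrite finset.inE => hf.
  rewrite prodrXr /x -expRM_natl ler_expR.
  by rewrite mulrN lerN2 -ler_pdivlMr.
have := le_trans low sumall.
rewrite -ler_pdivlMr ?expR_gt0// => /le_trans; apply.
rewrite -expRN opprK mulrDr mulr1 expRD mulrC ler_pM2l ?expR_gt0//.
by rewrite expRM_natl lnK.
Qed.

(** Each coordinate is rounded towards zero. This does not increase the norm, changes each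
    coordinate by at most eps / sqrt r, and keeps the code sum below sqrt r / [mesh] = r / eps. *)
Lemma net_cover (x : 'I_r -> R) : \sum_i x i ^+ 2 <= 1 ->
  exists2 f, f \in net & \sum_i net_point f i ^+ 2 <= 1 /\
    \sum_i (x i - net_point f i) ^+ 2 <= eps ^+ 2.
Proof.
move=> x1; have m0 := mesh_gt0; have sr0 := sqrt_r_gt0.
have rE : r%:R = Num.sqrt r%:R * Num.sqrt r%:R :> R by rewrite -expr2 sqr_sqrtr.
have xi i : `|x i| <= 1.
  rewrite -(@ler_pXn2r _ 2)// ?nnegrE// expr1n real_normK ?num_real//.
  by apply: le_trans x1; rewrite (bigD1 i)//= lerDl; apply: sumr_ge0 => j _; exact: sqr_ge0.
pose t i := Num.truncn (`|x i| / mesh).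
have t_le i : (t i)%:R <= `|x i| / mesh by have /truncn_itv/andP[] : 0 <= `|x i| / mesh by rewrite divr_ge0// ltW.
have t_gt i : `|x i| / mesh < (t i)%:R + 1 by rewrite natr1; exact: truncnS_gt.
have tm i : (t i < mesh_size)%N.
  rewrite ltnS; apply: le_truncn.
  rewrite /mesh invf_div mulrA ler_pM2r ?invr_gt0//.
  by rewrite ler_piMl// ltW.
pose f : code := [ffun i => (x i < 0, Ordinal (tm i))].
have fi i : net_point f i = (-1) ^+ (x i < 0)%R * ((t i)%:R * mesh).
  by rewrite /net_point /f ffunE -mulrA.
have xE i : x i = (-1) ^+ (x i < 0)%R * `|x i|.
  exact: realEsign (num_real _).
have tmesh i : (t i)%:R * mesh <= `|x i| by rewrite -ler_pdivlMr.
have tmesh0 i : 0 <= (t i)%:R * mesh by rewrite mulr_ge0// ltW.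
exists f; last split.
- rewrite finset.inE natr_sum.
  apply: (@le_trans _ _ (\sum_i (`|x i| / mesh))).
    by apply: ler_sum => i _; rewrite ffunE /=.
  rewrite -mulr_suml ler_pdivrMr//.
  have h : \sum_i `|x i| <= Num.sqrt r%:R.
    have := @sum_mul_le R r (fun=> 1) (fun i => `|x i|) (Num.sqrt r%:R) 1 sr0 ltr01.
    under [X in X <= 1]eq_bigr do rewrite real_normK ?num_real//.
    move=> /(_ x1) /(le_trans (ler_norm _)).
    under eq_bigr do rewrite mul1r.
    move=> /le_trans; apply.
    under eq_bigr do rewrite expr1n mulr1.
    set q := Num.sqrt r%:R in sr0 rE *.
    rewrite sumr_const card_ord -[X in _ + X <= _]mulr_natr rE le_eqVlt; apply/orP; left; apply/eqP.
    by field; rewrite gt_eqF.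
  apply: (le_trans h); rewrite /mesh le_eqVlt; apply/orP; left; apply/eqP.
  by set q := Num.sqrt r%:R in sr0 rE *; rewrite rE; field; rewrite !gt_eqF.
- apply: le_trans x1; apply: ler_sum => i _.
  rewrite fi exprMn sqrr_sign mul1r -[leRHS]real_normK ?num_real//.
  by rewrite ler_pXn2r// nnegrE.
- apply: (@le_trans _ _ (\sum_(i < r) mesh ^+ 2)).
    apply: ler_sum => i _.
    rewrite fi {1}[x i]xE -mulrBr exprMn sqrr_sign mul1r.
    apply: lerXn2r; rewrite ?nnegrE ?subr_ge0//; first exact: ltW.
    by have := t_gt i; rewrite ltr_pdivrMr// mulrDl mul1r => h; rewrite lerBlDl ltW.
  rewrite sumr_const card_ord -[_ *+ r]mulr_natr /mesh le_eqVlt; apply/orP; left; apply/eqP.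
  by set q := Num.sqrt r%:R in sr0 rE *; rewrite rE; field; rewrite gt_eqF.
Qed.

End lattice_net.

(** With y = s / m, a single term of the binomial expansion gives C(m, s) y^s <= (1 + y)^m <=
    exp(s). *)
Lemma binomial_le_exp (R : realType) (m s : nat) : (0 < s)%N -> (s <= m)%N ->
  'C(m, s)%:R <= expR (s%:R * (1 + ln (m%:R / s%:R))) :> R.
Proof.
move=> s0 sm; have m0 : (0 < m)%N by exact: leq_trans sm.
pose y : R := s%:R / m%:R.
have y0 : 0 < y by rewrite divr_gt0// ltr0n.
have h1 : 'C(m, s)%:R * y ^+ s <= (1 + y) ^+ m.
  rewrite exprDn (bigD1 (Ordinal (sm : s < m.+1)%N))//= expr1n mul1r mulr_natl.
  rewrite lerDl; apply: sumr_ge0 => i _.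
  by rewrite expr1n mul1r mulrn_wge0// exprn_ge0// ltW.
have h2 : (1 + y) ^+ m <= expR s%:R.
  have -> : s%:R = m%:R * y by rewrite /y mulrCA mulfV ?mulr1// pnatr_eq0 -lt0n.
  rewrite expRM_natl; apply: lerXn2r; rewrite ?nnegrE ?expR_ge0 ?expR_ge1Dx//.
  by rewrite addr_ge0// ltW.
have := le_trans h1 h2; rewrite -ler_pdivlMr ?exprn_gt0// => /le_trans; apply.
rewrite mulrDr mulr1 expRD ler_pM2l ?expR_gt0// expRM_natl lnK ?posrE ?divr_gt0 ?ltr0n//.
by rewrite -exprVn /y invf_div.
Qed.

(** * The uniform upper bound *)

Section euclidean_norm.
Context {R : realType} {n : nat}.
Implicit Types a b c : 'I_n -> R.

Definition nrm a : R := Num.sqrt (\sum_i a i ^+ 2).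

Lemma sum_sqr_ge0 a : 0 <= \sum_i a i ^+ 2.
Proof. by apply: sumr_ge0 => i _; exact: sqr_ge0. Qed.

Lemma nrm_sqr a : nrm a ^+ 2 = \sum_i a i ^+ 2.
Proof. by rewrite sqr_sqrtr// sum_sqr_ge0. Qed.

Lemma nrm_eq0 a : nrm a = 0 -> forall i, a i = 0.
Proof.
move=> h i; apply/eqP; rewrite -sqrf_eq0; apply/eqP.
have := nrm_sqr a; rewrite h expr0n /= => /esym/psumr_eq0P; apply=> //.
by move=> j _; exact: sqr_ge0.
Qed.

Lemma cauchy_schwarz a b : `|\sum_i a i * b i| <= nrm a * nrm b.
Proof.
have [a0|a0] := eqVneq (nrm a) 0.
  by rewrite a0 mul0r big1 ?normr0// => i _; rewrite nrm_eq0 ?mul0r.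
have [b0|b0] := eqVneq (nrm b) 0.
  by rewrite b0 mulr0 big1 ?normr0// => i _; rewrite (nrm_eq0 b0) ?mulr0.
have ap : 0 < nrm a by rewrite lt0r a0 sqrtr_ge0.
have bp : 0 < nrm b by rewrite lt0r b0 sqrtr_ge0.
have q0 : 0 < nrm a * nrm b by rewrite mulr_gt0.
have v0 : 0 < nrm b ^+ 2 by rewrite exprn_gt0.
have := @sum_mul_le R n a b _ _ q0 v0; rewrite -nrm_sqr => /(_ (lexx _)) /le_trans; apply.
rewrite -mulr_sumr -nrm_sqr le_eqVlt; apply/orP; left; apply/eqP.
by field; rewrite a0 b0.
Qed.

Lemma nrm_triangle a b : nrm (fun i => a i + b i) <= nrm a + nrm b.
Proof.
rewrite -(@ler_pXn2r _ 2)// ?nnegrE ?addr_ge0 ?sqrtr_ge0//.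
rewrite nrm_sqr sqrrD !nrm_sqr.
under eq_bigr do rewrite sqrrD.
rewrite !big_split /= lerD2r lerD2l -mulrnAr -mulr_natr.
by have := le_trans (ler_norm _) (cauchy_schwarz a b); lra.
Qed.

Lemma nrm_sub_le a b c : nrm (fun i => a i - c i) <= nrm (fun i => a i - b i) + nrm (fun i => b i - c i).
Proof.
apply: le_trans (nrm_triangle _ _); rewrite le_eqVlt; apply/orP; left; apply/eqP.
by congr Num.sqrt; apply: eq_bigr => i _; rewrite addrA subrK.
Qed.

Lemma nrm_subC a b : nrm (fun i => a i - b i) = nrm (fun i => b i - a i).
Proof. by congr Num.sqrt; apply: eq_bigr => i _; rewrite -opprB sqrrN. Qed.

Lemma nrm_dist a b a' b' :
  `|nrm (fun i => a i - b i) - nrm (fun i => a' i - b' i)| <=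
  nrm (fun i => a i - a' i) + nrm (fun i => b i - b' i).
Proof.
have h1 := nrm_sub_le a a' b; have h2 := nrm_sub_le a' b' b.
have h3 := nrm_sub_le a' a b'; have h4 := nrm_sub_le a b b'.
rewrite (nrm_subC b' b) in h2; rewrite (nrm_subC a' a) in h3.
by rewrite ler_norml; apply/andP; split; lra.
Qed.

End euclidean_norm.

Lemma sqrt2pi_ge2 (R : realType) : 2 <= Num.sqrt (2 * pi) :> R.
Proof.
rewrite -(@ler_pXn2r _ 2)// ?nnegrE ?sqrtr_ge0// sqr_sqrtr ?mulr_ge0 ?pi_ge0//.
by have := @pi_ge2 R; lra.
Qed.

Lemma sqrt2pi_le3 (R : realType) : Num.sqrt (2 * pi) <= 3 :> R.
Proof.
rewrite -(@ler_pXn2r _ 2)// ?nnegrE ?sqrtr_ge0// sqr_sqrtr ?mulr_ge0 ?pi_ge0//.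
have /andP[_ h] := @pihalf_02 R; lra.
Qed.

Section union_bound.
Context d (T : measurableType d) (R : realType) (P : probability T R).

Lemma union_bound (I : eqType) (s : seq I) (B : I -> set T) (q : R) :
  (forall i, measurable (B i)) -> {in s, forall i, P (B i) <= q%:E}%E ->
  measurable [set w | exists2 i, i \in s & B i w] /\
  (P [set w | exists2 i, i \in s & B i w] <= ((size s)%:R * q)%:E)%E.
Proof.
move=> mB; elim: s => [|a s ih] hB.
  rewrite (_ : [set w | _] = set0) ?measure0 ?mul0r//.
  by apply/seteqP; split => w //= -[].
have [|ms hs] := ih; first by move=> i si; apply: hB; rewrite inE si orbT.
have -> : [set w | exists2 i, i \in a :: s & B i w] =
    B a `|` [set w | exists2 i, i \in s & B i w].
  apply/seteqP; split => w /=.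
    move=> [i]; rewrite inE => /orP[/eqP -> h|si h]; [by left|right].
    by exists i.
  move=> [h|[i si h]]; first by exists a; rewrite ?mem_head.
  by exists i => //; rewrite inE si orbT.
split; first exact: measurableU.
apply: (le_trans (measureU2 P (mB a) ms)).
rewrite -natr1 mulrDl mul1r addrC EFinD; apply: leeD => //.
by apply: hB; exact: mem_head.
Qed.

End union_bound.

Section upper_probabilities.
Context d (T : measurableType d) (R : realType) (P : probability T R).
Context (m n : nat) (lambda : R).
Context (A : 'I_m -> 'I_n -> {RV P >-> R}) (tau : 'I_m -> {RV P >-> R}).
Hypothesis dither : gaussian_dither lambda A tau.
Hypothesis m0 : (0 < m)%N.

Notation flips z z' w := (\sum_(i < m) (flip A tau z z' i w)%:R : R).
Notation bands z r w := (\sum_(i < m) (in_band A tau z r i w)%:R : R).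

Lemma disjoint_rows (i j : 'I_m) : i != j ->
  [disjoint [set k : 'I_m * 'I_n + 'I_m | row_of k == i]%SET &
            [set k : 'I_m * 'I_n + 'I_m | row_of k == j]%SET]%B.
Proof. exact: disjoint_fibers. Qed.

Lemma measurable_flips z z' : measurable_fun setT (fun w => flips z z' w).
Proof. by apply: (@measurable_count _ _ _ _ _ (fam A tau)) => i; exact: measurable_flip. Qed.

Lemma measurable_bands z r : measurable_fun setT (fun w => bands z r w).
Proof. by apply: (@measurable_count _ _ _ _ _ (fam A tau)) => i; exact: measurable_in_band. Qed.

(** Chernoff bounds for both tails. The hypothesis on the Gaussian term makes the bias of the flip
    probabilities at most one unit [D] of deviation. *)
Lemma flips_concentration (delta : R) (z z' : 'I_n -> R) :
  0 < delta -> delta <= 1 -> 1 <= lambda ->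
  96 / lambda * expR (- (lambda ^+ 2 / 4)) <= delta ->
  \sum_j z j ^+ 2 <= 1 -> \sum_j z' j ^+ 2 <= 1 ->
  let N := nrm (fun j => z j - z' j) in
  let S := fun w => Num.sqrt (2 * pi) * (lambda / m%:R) * flips z z' w in
  (P [set w | (N + delta / 4 <= S w)%R] <= (expR (- (m%:R * delta ^+ 2 / (4608 * lambda))))%:E)%E /\
  (P [set w | (S w <= N - delta / 4)%R] <= (expR (- (m%:R * delta ^+ 2 / (4608 * lambda))))%:E)%E.
Proof.
move=> d0 d1 l1 hex hz hz' N S.
have mR : 0 < m%:R :> R by rewrite ltr0n.
have l0 : 0 < lambda by lra.
have c2 := @sqrt2pi_ge2 R; have c3 := @sqrt2pi_le3 R.
set c := Num.sqrt (2 * pi) in c2 c3 S *.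
have c0 : 0 < c by lra.
have N0 : 0 <= N by exact: sqrtr_ge0.
have N2 : N <= 2.
  have h (x : 'I_n -> R) : \sum_j x j ^+ 2 <= 1 -> nrm x <= 1.
    by move=> hx; rewrite /nrm -[leRHS]sqrtr1 ler_wsqrtr.
  have := nrm_sub_le z (fun=> 0) z'; rewrite -/N.
  have e (x : 'I_n -> R) : nrm (fun i => x i - 0) = nrm x.
    by congr Num.sqrt; apply: eq_bigr => i _; rewrite subr0.
  rewrite (nrm_subC (fun=> 0) z') !e.
  by move/h: hz; move/h: hz'; lra.
pose p := N / (c * lambda).
have p0 : 0 <= p by rewrite divr_ge0// mulr_ge0// ltW.
have pl : p <= lambda^-1.
  rewrite /p invfM mulrA ler_piMl ?invr_ge0 ?(ltW l0)//.
  by rewrite ler_pdivrMr//; lra.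
(* Since c <= 3, two units [D] rescale to at most delta / 4: one for the bias, present in the lower
   tail only, and one for the fluctuation. With u = delta / 96 and means at most m / lambda, 2 u^2 m
   / lambda is half of u D. *)
pose D := m%:R * delta / (24 * lambda).
pose u := delta / 96.
have u01 : 0 <= u <= 1 / 2 by rewrite /u; apply/andP; split; lra.
have SE w : S w = c * lambda / m%:R * flips z z' w by rewrite /S; field; rewrite gt_eqF.
have cl0 : 0 < c * lambda / m%:R by rewrite divr_gt0// mulr_gt0.
have NE : N = c * lambda / m%:R * (m%:R * p).
  by rewrite /p; field; rewrite !gt_eqF.
have dE : c * lambda / m%:R * (2 * D) <= delta / 4.
  rewrite /D (_ : _ * _ = c * (delta / 12)); last by field; rewrite !gt_eqF.
  have h : 0 <= (3 - c) * delta by rewrite mulr_ge0 ?subr_ge0// ltW.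
  by lra.
have D0 : 0 <= D by rewrite divr_ge0// ?mulr_ge0// ltW.
have expo (p' : R) : 0 <= p' -> p' <= lambda^-1 ->
    2 * u ^+ 2 * m%:R * p' - u * D <= - (m%:R * delta ^+ 2 / (4608 * lambda)).
  move=> p'0 p'l; have : 2 * u ^+ 2 * m%:R * p' <= 2 * u ^+ 2 * m%:R * lambda^-1.
    by apply: ler_wpM2l => //; rewrite !mulr_ge0 ?sqr_ge0// ltW.
  suff : 2 * u ^+ 2 * m%:R * lambda^-1 - u * D = - (m%:R * delta ^+ 2 / (4608 * lambda)) by lra.
  by rewrite /u /D; field; rewrite gt_eqF.
have cancel x y : c * lambda / m%:R * x <= c * lambda / m%:R * y -> x <= y by rewrite ler_pM2l.
split.
- apply: (@le_trans _ _ (P [set w | (m%:R * p + D <= flips z z' w)%R])).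
    apply: le_measure; rewrite ?inE.
    + by have := measurable_fun_le measurableT (measurable_cst (N + delta / 4)) (measurable_funM (measurable_cst (c * (lambda / m%:R))) (measurable_flips z z')); rewrite setTI.
    + by have := measurable_fun_le measurableT (measurable_cst (m%:R * p + D)) (measurable_flips z z'); rewrite setTI.
    + move=> w /=; rewrite SE => h; apply: cancel; apply: le_trans h.
      by rewrite mulrDr -NE; move: dE; rewrite mulrCA; have := mulr_ge0 (ltW cl0) D0; lra.
  apply: le_trans (chernoff_upper (indep_fam dither) (D := fun i => [set k | row_of k == i]%SET) _ _ _ _ u01 p0) _.
  + exact: disjoint_rows.
  + by move=> i; exact: measurable_flip.
  + by move=> i; exact: flip_prob_le.
  + by rewrite lee_fin ler_expR; exact: expo.
- pose err := 4 / lambda ^+ 2 * expR (- (lambda ^+ 2 / 4)).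
  (* For close points p - err may be negative, while the Chernoff bound asks for p' >= 0. *)
  pose p' := Num.max 0 (p - err).
  have p'0 : 0 <= p' by rewrite le_max lexx.
  have err0 : 0 <= err by rewrite mulr_ge0 ?expR_ge0// divr_ge0// sqr_ge0.
  have p'l : p' <= lambda^-1.
    by rewrite ge_max invr_ge0 (ltW l0)/=; lra.
  have errD : m%:R * err <= D.
    rewrite (_ : D = m%:R * (delta / (24 * lambda))); last by rewrite /D mulrA.
    rewrite ler_pM2l// /err ler_pdivlMr ?mulr_gt0//.
    apply: le_trans hex; rewrite le_eqVlt; apply/orP; left; apply/eqP.
    by field; rewrite gt_eqF.
  apply: (@le_trans _ _ (P [set w | (flips z z' w <= m%:R * p' - D)%R])).
    apply: le_measure; rewrite ?inE.
    + by have := measurable_fun_le measurableT (measurable_funM (measurable_cst (c * (lambda / m%:R))) (measurable_flips z z')) (measurable_cst (N - delta / 4)); rewrite setTI.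
    + by have := measurable_fun_le measurableT (measurable_flips z z') (measurable_cst (m%:R * p' - D)); rewrite setTI.
    + move=> w /=; rewrite SE => h.
      have : flips z z' w <= m%:R * p - 2 * D.
        by apply: cancel; apply: le_trans h _; rewrite mulrBr -NE; lra.
      have : m%:R * (p - err) <= m%:R * p' by rewrite ler_pM2l// le_max lexx orbT.
      lra.
  apply: le_trans (chernoff_lower (indep_fam dither) (D := fun i => [set k | row_of k == i]%SET) _ _ _ _ u01 p'0) _.
  + exact: disjoint_rows.
  + by move=> i; exact: measurable_flip.
  + move=> i; have h := @flip_prob_ge _ _ _ _ _ _ _ _ _ dither z z' i.
    rewrite /p' maxEle; case: ifPn => _; last exact: measure_ge0.
    by apply: h; lra.
  + by rewrite lee_fin ler_expR; exact: expo.
Qed.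

Lemma bands_tail (z : 'I_n -> R) (r : R) : 0 <= r -> 0 < lambda ->
  (P [set w | (2 * m%:R * r / lambda <= bands z r w)%R] <=
   (expR (- (m%:R * r / (8 * lambda))))%:E)%E.
Proof.
move=> r0 l0; pose p := r / lambda; have p0 : 0 <= p by rewrite divr_ge0// ltW.
have u01 : 0 <= (1 / 4 : R) <= 1 / 2 by apply/andP; split; lra.
have -> : 2 * m%:R * r / lambda = m%:R * p + m%:R * p by rewrite /p; field; rewrite gt_eqF.
apply: le_trans (chernoff_upper (indep_fam dither) (D := fun i => [set k | row_of k == i]%SET) _ _ _ _ u01 p0) _.
- exact: disjoint_rows.
- by move=> i; exact: measurable_in_band.
- by move=> i; exact: band_prob_le.
- rewrite lee_fin ler_expR /p le_eqVlt; apply/orP; left; apply/eqP.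
  by field; rewrite gt_eqF.
Qed.

Lemma measurable_tdot_sqr (s : seq 'I_n) (u : 'I_m -> R) :
  measurable_fun setT (fun w => \sum_(j <- s) tdot A u j w ^+ 2).
Proof.
apply: measurable_sum => j; apply: measurable_funX.
apply: (@sigT_measurable_fun _ _ _ _ _ (fam A tau) [set: _]%SET).
by apply: measurable_tdot => i; rewrite finset.inE.
Qed.

Lemma tdot_sqr_tail (s : seq 'I_n) (u : 'I_m -> R) (x : R) : uniq s ->
  0 < \sum_i u i ^+ 2 ->
  (P [set w | (x <= \sum_(j <- s) tdot A u j w ^+ 2)%R] <=
   (expR ((size s)%:R / 2 - x / (4 * \sum_i u i ^+ 2)))%:E)%E.
Proof.
move=> us q0; set q := \sum_i u i ^+ 2 in q0 *.
have ms := measurable_tdot_sqr s u.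
pose g w := (\sum_(j <- s) tdot A u j w ^+ 2) / (4 * q).
have mg : measurable_fun setT g by exact: measurable_funM.
apply: (le_trans (@exp_markov _ _ _ P _ g (x / (4 * q)) _ mg _)).
- by have := measurable_fun_le measurableT (measurable_cst x) ms; rewrite setTI.
- by move=> w /= h; rewrite /g ler_pM2r// invr_gt0 mulr_gt0.
- rewrite addrC expRD EFinM lee_pmul2l//; last by rewrite lte_fin expR_gt0.
  exact: (tdot_sqr_mgf dither us q0).
Qed.

End upper_probabilities.

(** * Deterministic estimates for a fixed sample *)

Section deterministic.
Context d (T : measurableType d) (R : realType) (P : probability T R).
Context (m n : nat).
Context (A : 'I_m -> 'I_n -> {RV P >-> R}) (tau : 'I_m -> {RV P >-> R}).

Definition coords (x : 'cV[R]_n) (j : 'I_n) : R := x j 0.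

Lemma l2norm_nrm (x y : 'cV[R]_n) :
  l2norm (x - y) = nrm (fun j => coords x j - coords y j).
Proof. by congr Num.sqrt; apply: eq_bigr => i _; rewrite !mxE. Qed.

Lemma sign1_neq (a b : R) : (sign1 a != sign1 b) = ((0 <= a) != (0 <= b)).
Proof.
rewrite /sign1; case: (0 <= a); case: (0 <= b); rewrite ?eqxx//.
  by rewrite -subr_eq0 opprK -[1 + 1]/(2%:R) pnatr_eq0.
by rewrite eq_sym -subr_eq0 opprK -[1 + 1]/(2%:R) pnatr_eq0.
Qed.

Lemma hammingE (w : T) (x y : 'cV[R]_n) :
  (hamming (random_map A tau w x) (random_map A tau w y))%:R =
  \sum_(i < m) (flip A tau (coords x) (coords y) i w)%:R :> R.
Proof.
have e (z : 'cV[R]_n) i : random_map A tau w z i 0 = sign1 (dot A (coords z) i w + tau i w).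
  rewrite /random_map /sign_map !mxE; congr (sign1 (_ + _)).
  by apply: eq_bigr => j _; rewrite mxE mulrC.
rewrite /hamming cardsE -sum1_card natr_sum big_mkcond /=.
by apply: eq_bigr => i _; rewrite unfold_in !e sign1_neq /flip /tau_flip; case: (_ != _).
Qed.

(** If the two values differ by at most r and have different signs, both lie within r of zero. *)
Lemma flip_local (t z : 'I_n -> R) (r : R) i w : flip A tau t z i w ->
  in_band A tau z r i w || (r < `|dot A (fun j => t j - z j) i w|).
Proof.
rewrite /flip /tau_flip /in_band -dotB; set a := dot A t i w; set b := dot A z i w; set c := tau i w.
move=> h; rewrite orbC -implyNb -leNgt; apply/implyP; rewrite ler_norml => /andP[h1 h2].
rewrite ler_norml; move: h; case: (leP 0 (a + c)) => ha; case: (leP 0 (b + c)) => hb // _.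
  by apply/andP; split; lra.
by apply/andP; split; lra.
Qed.

(** [S] is the support and [U] lists the positive entries; the pairs with #|S| = s and U inside S
    number C(m, s) 2^s. *)
Definition sign_vector (S U : {set 'I_m}) (i : 'I_m) : R :=
  if i \in S then (if i \in U then 1 else -1) else 0.

Lemma sign_vector_sqr S U : \sum_i sign_vector S U i ^+ 2 = #|S|%:R.
Proof.
rewrite -sum1_card natr_sum [RHS]big_mkcond /=; apply: eq_bigr => i _.
by rewrite /sign_vector; case: ifP => _; [case: ifP => _; rewrite ?sqrrN expr1n|rewrite expr0n].
Qed.

Lemma subset_of_card (X : {set 'I_m}) s : (s <= #|X|)%N ->
  exists2 S : {set 'I_m}, S \subset X & #|S| = s.
Proof.
move=> sX; exists [set i in take s (enum X)]%SET.
  by apply/fintype.subsetP => i; rewrite finset.inE => /mem_take; rewrite mem_enum.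
rewrite cardsE; have /card_uniqP -> : uniq (take s (enum X)) by rewrite take_uniq// enum_uniq.
by rewrite size_takel// -cardE.
Qed.

(* If more than s coordinates of [A v] exceed q, then for s of them, with their
   signs u, <u, A v> = <A^T u, v> is large although |A^T u| is not. *)
Lemma sparse_large (s : nat) (q e : R) (v : 'I_n -> R) w :
  (0 < s)%N -> 0 < q -> 0 < e ->
  (forall S U : {set 'I_m}, #|S| = s -> U \subset S ->
    \sum_j tdot A (sign_vector S U) j w ^+ 2 < s%:R ^+ 2 * q ^+ 2 / (2 * e ^+ 2)) ->
  \sum_j v j ^+ 2 <= 2 * e ^+ 2 ->
  \sum_(i < m) (q < `|dot A v i w|)%R%:R <= s%:R :> R.
Proof.
move=> s0 q0 e0 H hv.
pose X := [set i : 'I_m | q < `|dot A v i w|]%SET.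
have -> : \sum_(i < m) (q < `|dot A v i w|)%R%:R = #|X|%:R :> R.
  rewrite -sum1_card natr_sum [RHS]big_mkcond /=; apply: eq_bigr => i _.
  by rewrite finset.inE; case: ifP.
rewrite ler_nat leqNgt; apply/negP => /ltnW /subset_of_card[S SX cS].
pose U := [set i in S | 0 < dot A v i w]%SET.
have US : U \subset S by apply/fintype.subsetP => i; rewrite finset.inE => /andP[].
have sR : 0 < s%:R :> R by rewrite ltr0n.
have e2 : 0 < 2 * e ^+ 2 by rewrite mulr_gt0// exprn_gt0.
have sq : 0 < s%:R * q by rewrite mulr_gt0.
(* With these weights |<A^T u, v>| <= s q / 2 + (e^2 / (s q)) |A^T u|^2; the assumed threshold for
   |A^T u|^2 makes the second term less than s q / 2. *)
have h1 := @sum_mul_le R n (fun j => tdot A (sign_vector S U) j w) v _ _ sq e2 hv.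
have h2 : s%:R * q <= `|\sum_j tdot A (sign_vector S U) j w * v j|.
  apply: le_trans (ler_norm _).
  have -> : \sum_j tdot A (sign_vector S U) j w * v j =
      \sum_i sign_vector S U i * dot A v i w.
    rewrite /tdot /dot; under eq_bigr do rewrite mulr_suml.
    rewrite exchange_big; apply: eq_bigr => i _; rewrite mulr_sumr.
    by apply: eq_bigr => j _; rewrite mulrAC mulrA.
  rewrite -cS -sum1_card natr_sum mulr_suml big_mkcond /=; apply: ler_sum => i _.
  rewrite /sign_vector; case: ifP => iS; last by rewrite mul0r.
  have := fintype.subsetP SX _ iS; rewrite finset.inE mul1r.
  have -> : (i \in U) = (0 < dot A v i w) by rewrite finset.inE iS.
  move/ltW; case: ltP => h.
    by rewrite gtr0_norm// mul1r.
  by rewrite ler0_norm// mulN1r.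
have := H S U cS US; rewrite -mulr_sumr in h1.
set Q := \sum_j _ ^+ 2 in h1 *.
rewrite ltr_pdivlMr// => h3.
have : 2 * e ^+ 2 / (2 * (s%:R * q)) * Q < s%:R * q / 2.
  rewrite mulrAC ltr_pdivrMr ?mulr_gt0//.
  rewrite (_ : s%:R * q / 2 * (2 * (s%:R * q)) = s%:R ^+ 2 * q ^+ 2); last by field.
  by rewrite mulrC.
by lra.
Qed.

Lemma flip_triangle (x y x' y' : 'I_n -> R) w :
  `|\sum_(i < m) (flip A tau x y i w)%:R - \sum_(i < m) (flip A tau x' y' i w)%:R| <=
  \sum_(i < m) (flip A tau x x' i w)%:R + \sum_(i < m) (flip A tau y y' i w)%:R :> R.
Proof.
rewrite -sumrB -big_split /=; apply: (le_trans (ler_norm_sum _ _ _)); apply: ler_sum => i _.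
rewrite /flip /tau_flip.
case: (0 <= _ + _); case: (0 <= _ + _); case: (0 <= _ + _); case: (0 <= _ + _);
  rewrite /= ?subrr ?subr0 ?sub0r ?normrN ?normr0 ?normr1 ?addr0 ?add0r ?addr_ge0 ?lexx//; lra.
Qed.

End deterministic.

(** * Assembling the upper bound *)

Section upper_bound.
Context d (T : measurableType d) (R : realType) (P : probability T R).
Context (m r k : nat) (lambda delta eps : R).
Context (A : 'I_m -> 'I_(r + k) -> {RV P >-> R}) (tau : 'I_m -> {RV P >-> R}).
Hypothesis dither : gaussian_dither lambda A tau.
Hypothesis m0 : (0 < m)%N.
Hypothesis r0 : (0 < r)%N.
Hypothesis eps0 : 0 < eps.
Hypothesis epsd : eps <= delta / 24.
Hypothesis d0 : 0 < delta.
Hypothesis d1 : delta <= 1.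

Definition net_vec (f : code r eps) (j : 'I_(r + k)) : R :=
  match fintype.split j with inl i => net_point f i | inr _ => 0 end.

Lemma net_vec_sqr f : \sum_j net_vec f j ^+ 2 = \sum_i net_point f i ^+ 2.
Proof.
rewrite big_split_ord /= [X in _ + X]big1 ?addr0; last first.
  by move=> j _; rewrite /net_vec (unsplitK (inr j)) expr0n.
by apply: eq_bigr => i _; rewrite /net_vec (unsplitK (inl i)).
Qed.

(** The l1 constraint of [net] admits points outside the unit ball, while the concentration of flips
    is proved for norms at most 1. *)
Definition ball_net : {set code r eps} :=
  [set f in net r eps | (\sum_j net_vec f j ^+ 2 <= 1)%R]%SET.

Lemma net_vec_cover (x : 'cV[R]_(r + k)) : ellipsoid eps x ->
  exists2 f, f \in ball_net & \sum_j (coords x j - net_vec f j) ^+ 2 <= 2 * eps ^+ 2.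
Proof.
move=> [/(l2norm_le_sqr ler01) h1 /(l2norm_le_sqr (ltW eps0)) h2].
have e1 : eps <= 1 / 4 by move: epsd d1; lra.
have [|f fn [hf hx]] := net_cover r0 eps0 (x := fun i => usubmx x i 0).
  by move: h1; rewrite expr1n.
exists f; first by rewrite finset.inE fn net_vec_sqr.
rewrite big_split_ord /=.
have -> : \sum_(i < r) (coords x (lshift k i) - net_vec f (lshift k i)) ^+ 2 =
    \sum_i (usubmx x i 0 - net_point f i) ^+ 2.
  by apply: eq_bigr => i _; rewrite /coords /net_vec (unsplitK (inl i)) mxE.
have -> : \sum_(i < k) (coords x (rshift r i) - net_vec f (rshift r i)) ^+ 2 =
    \sum_i dsubmx x i 0 ^+ 2.
  by apply: eq_bigr => i _; rewrite /coords /net_vec (unsplitK (inr i)) mxE subr0.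
lra.
Qed.

Notation flips z z' w := (\sum_(i < m) (flip A tau z z' i w)%:R : R).
Notation bands z r w := (\sum_(i < m) (in_band A tau z r i w)%:R : R).

(** Moving a point to the net changes at most m delta / (50 lambda) bits, half from the band and
    half from large <A_i, t - z>. Two points cost 3 delta / 25 after scaling, the distances 3 eps <=
    delta / 8, the net delta / 4: in all less than delta. *)
Lemma distortion_le (s : nat) (w : T) : 0 < lambda -> (0 < s)%N ->
  s%:R <= m%:R * delta / (100 * lambda) ->
  {in ball_net &, forall f g,
    `|Num.sqrt (2 * pi) * (lambda / m%:R) * flips (net_vec f) (net_vec g) w -
      nrm (fun j => net_vec f j - net_vec g j)| <= delta / 4} ->
  {in ball_net, forall f,
    bands (net_vec f) (delta / 200) w <= 2 * m%:R * (delta / 200) / lambda} ->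
  (forall S U : {set 'I_m}, #|S| = s -> U \subset S ->
    \sum_j tdot A (sign_vector R S U) j w ^+ 2 <
    s%:R ^+ 2 * (delta / 200) ^+ 2 / (2 * eps ^+ 2)) ->
  forall x y, ellipsoid eps x -> ellipsoid eps y ->
  distortion lambda (random_map A tau w) x y <= delta.
Proof.
move=> l0 s0 sd G1 G2 G3.
have q0 : 0 < delta / 200 by move: d0; lra.
have mR : 0 < m%:R :> R by rewrite ltr0n.
have local (x : 'cV[R]_(r + k)) f : f \in ball_net ->
    \sum_j (coords x j - net_vec f j) ^+ 2 <= 2 * eps ^+ 2 ->
    flips (coords x) (net_vec f) w <= m%:R * delta / (50 * lambda).
  move=> fn hx.
  apply: (@le_trans _ _ (bands (net_vec f) (delta / 200) w +
     \sum_(i < m) (delta / 200 < `|dot A (fun j => coords x j - net_vec f j) i w|)%R%:R)).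
    rewrite -big_split /=; apply: ler_sum => i _.
    have := @flip_local _ _ _ _ _ _ A tau (coords x) (net_vec f) (delta / 200) i w.
    case: flip => [/(_ isT)|_]; last by rewrite addr_ge0.
    by case: in_band; case: ltP => //= _ _; rewrite ?addr0 ?add0r// lerDl.
  have h1 := G2 f fn; have h2 := sparse_large s0 q0 eps0 G3 hx.
  apply: (le_trans (lerD h1 h2)).
  apply: (le_trans (lerD (lexx _) sd)).
  by rewrite le_eqVlt; apply/orP; left; apply/eqP; field; rewrite gt_eqF.
move=> x y /net_vec_cover[f fn hf] /net_vec_cover[g gn hg].
rewrite /distortion hammingE l2norm_nrm.
have c3 := @sqrt2pi_le3 R; have c2 := @sqrt2pi_ge2 R.
have nd := nrm_dist (coords x) (coords y) (net_vec f) (net_vec g).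
have nle (u v : 'I_(r + k) -> R) : \sum_j (u j - v j) ^+ 2 <= 2 * eps ^+ 2 ->
    nrm (fun j => u j - v j) <= 3 / 2 * eps.
  move=> h; rewrite -(@ler_pXn2r _ 2)// ?nnegrE ?sqrtr_ge0//; last by move: eps0; lra.
  by rewrite nrm_sqr; apply: (le_trans h); have := sqr_ge0 eps; rewrite exprMn; lra.
have hfl := flip_triangle A tau (coords x) (coords y) (net_vec f) (net_vec g) w.
have {}hfl := le_trans hfl (lerD (local x f fn hf) (local y g gn hg)).
have h1 := G1 f g fn gn.
move: (nle _ _ hf) (nle _ _ hg) => nf ng.
set F := \sum_(i < m) _ in hfl *.
set F' := \sum_(i < m) _ in hfl h1.
set N := nrm _ in nd *; set N' := nrm _ in nd h1.
set c := Num.sqrt (2 * pi) * (lambda / m%:R) in h1 *.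
have c0 : 0 <= c by rewrite mulr_ge0 ?sqrtr_ge0// divr_ge0// ltW.
have hc : `|c * F - c * F'| <= 3 * delta / 25.
  rewrite -mulrBr normrM (ger0_norm c0); apply: (le_trans (ler_wpM2l c0 hfl)).
  rewrite (_ : c * _ = Num.sqrt (2 * pi) * (delta / 25)); last by rewrite /c; field; rewrite !gt_eqF.
  by rewrite -mulrA ler_wpM2r//; move: d0; lra.
have -> : c * F - N = (c * F - c * F') + (c * F' - N') - (N - N') by ring.
apply: (le_trans (ler_normB _ _)).
apply: (le_trans (lerD (ler_normD _ _) (lexx _))).
move: epsd; lra.
Qed.

(** The 99 here and in the later hypotheses comes from exp(99) >= 100, a consequence of 1 + x <= exp
    x. *)
Lemma union_small (I : finType) (X : {set I}) (B : I -> set T) (a b : R) :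
  #|X|%:R <= expR a -> a + b <= - 99 -> (forall i, measurable (B i)) ->
  {in X, forall i, P (B i) <= (expR b)%:E}%E ->
  measurable [set w | exists2 i, i \in X & B i w] /\
  (P [set w | exists2 i, i \in X & B i w] <= (1 / 100)%:E)%E.
Proof.
move=> Xa ab mB hB.
have -> : [set w | exists2 i, i \in X & B i w] = [set w | exists2 i, i \in enum X & B i w].
  by apply/seteqP; split => w [i hi hw]; exists i => //; move: hi; rewrite mem_enum.
have [||mu hu] := @union_bound _ _ _ P _ (enum X) B (expR b).
- exact: mB.
- by move=> i; rewrite mem_enum; exact: hB.
split => //; apply: (le_trans hu); rewrite lee_fin -cardE.
apply: (le_trans (ler_wpM2r (expR_ge0 _) Xa)); rewrite -expRD.
apply: (@le_trans _ _ (expR (- 99))); first by rewrite ler_expR.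
rewrite expRN div1r lef_pV2 ?posrE ?expR_gt0//.
by have := expR_ge1Dx (99 : R); lra.
Qed.

(** The last three hypotheses pay for the union bounds over pairs of net points, over net points and
    over sign vectors. The four exceptional events have probability at most 1/100 each. *)
Lemma upper_estimate (s : nat) : 1 <= lambda ->
  96 / lambda * expR (- (lambda ^+ 2 / 4)) <= delta ->
  (0 < s)%N -> (s <= m)%N -> s%:R <= m%:R * delta / (100 * lambda) ->
  2 * (r%:R * (1 + ln (4 / eps))) + 99 <= m%:R * delta ^+ 2 / (4608 * lambda) ->
  r%:R * (1 + ln (4 / eps)) + 99 <= m%:R * delta / (1600 * lambda) ->
  s%:R * (1 + ln (2 * m%:R / s%:R)) + (r + k)%:R / 2 + 99 <=
    s%:R * delta ^+ 2 / (32 * (100 * eps) ^+ 2) ->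
  with_prob_at_least P (9 / 10) [set w | forall x y, ellipsoid eps x -> ellipsoid eps y ->
    distortion lambda (random_map A tau w) x y <= delta].
Proof.
move=> l1 hex s0 sm sd h1 h2 h3.
have e1 : eps <= 1 / 4 by move: epsd d1; lra.
have l0 : 0 < lambda by lra.
have q0 : 0 <= delta / 200 by move: d0; lra.
have sR : 0 < s%:R :> R by rewrite ltr0n.
pose c := Num.sqrt (2 * pi) * (lambda / m%:R).
pose N (p : code r eps * code r eps) := nrm (fun j => net_vec p.1 j - net_vec p.2 j).
pose B1 p := [set w | (N p + delta / 4 <= c * flips (net_vec p.1) (net_vec p.2) w)%R].
pose B1' p := [set w | (c * flips (net_vec p.1) (net_vec p.2) w <= N p - delta / 4)%R].
pose B2 f := [set w | (2 * m%:R * (delta / 200) / lambda <= bands (net_vec f) (delta / 200) w)%R].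
pose X := s%:R ^+ 2 * (delta / 200) ^+ 2 / (2 * eps ^+ 2).
pose B3 (S U : {set 'I_m}) := [set w | (X <= \sum_j tdot A (sign_vector R S U) j w ^+ 2)%R].
have mB1 p : measurable (B1 p).
  by have := measurable_fun_le measurableT (measurable_cst (N p + delta / 4)) (measurable_funM (measurable_cst c) (measurable_flips A tau (net_vec p.1) (net_vec p.2))); rewrite setTI.
have mB1' p : measurable (B1' p).
  by have := measurable_fun_le measurableT (measurable_funM (measurable_cst c) (measurable_flips A tau (net_vec p.1) (net_vec p.2))) (measurable_cst (N p - delta / 4)); rewrite setTI.
have mB2 f : measurable (B2 f).
  by have := measurable_fun_le measurableT (measurable_cst (2 * m%:R * (delta / 200) / lambda)) (measurable_bands A tau (net_vec f) (delta / 200)); rewrite setTI.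
have mB3 S U : measurable (B3 S U).
  by have := measurable_fun_le measurableT (measurable_cst X) (measurable_tdot_sqr A tau (index_enum _) (sign_vector R S U)); rewrite setTI.
have net_sqr f : f \in ball_net -> \sum_j net_vec f j ^+ 2 <= 1.
  by rewrite finset.inE => /andP[].
have cn : #|ball_net|%:R <= expR (r%:R * (1 + ln (4 / eps))).
  apply: (le_trans _ (card_net r eps0 e1)); rewrite ler_nat; apply: subset_leq_card.
  by apply/fintype.subsetP => f; rewrite finset.inE => /andP[].
pose NN := finset.setX ball_net ball_net.
have cNN : #|NN|%:R <= expR (2 * (r%:R * (1 + ln (4 / eps)))).
  rewrite finset.cardsX natrM expRM_natl expr2.
  by apply: ler_pM.
have [|||mU1 hU1] := @union_small _ NN B1 _ (- (m%:R * delta ^+ 2 / (4608 * lambda))) cNN.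
- by move: h1; lra.
- exact: mB1.
- move=> [f g]; rewrite finset.in_setX => /andP[fn gn].
  by have [] := flips_concentration dither m0 d0 d1 l1 hex (net_sqr f fn) (net_sqr g gn).
have [|||mU1' hU1'] := @union_small _ NN B1' _ (- (m%:R * delta ^+ 2 / (4608 * lambda))) cNN.
- by move: h1; lra.
- exact: mB1'.
- move=> [f g]; rewrite finset.in_setX => /andP[fn gn].
  by have [] := flips_concentration dither m0 d0 d1 l1 hex (net_sqr f fn) (net_sqr g gn).
have [|||mU2 hU2] := @union_small _ (ball_net) B2 _ (- (m%:R * delta / (1600 * lambda))) cn.
- by move: h2; lra.
- exact: mB2.
- move=> f fn; apply: (le_trans (bands_tail dither (net_vec f) q0 l0)).
  rewrite lee_fin ler_expR le_eqVlt; apply/orP; left; apply/eqP.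
  by field; rewrite gt_eqF.
(* The exponent of [tdot_sqr_tail] at level X, since a sign vector on s coordinates has squared norm
   s. The 2^s choices of U then add s ln 2, whence the ln (2 m / s) of the hypothesis. *)
pose b := (r + k)%:R / 2 - s%:R * delta ^+ 2 / (32 * (100 * eps) ^+ 2).
pose U3 (S : {set 'I_m}) := [set w | exists2 U, U \in enum (powerset S) & B3 S U w].
have hS (S : {set 'I_m}) : #|S| = s ->
    measurable (U3 S) /\ (P (U3 S) <= (expR (s%:R * ln 2 + b))%:E)%E.
  move=> cS; have [||mu hu] := @union_bound _ _ _ P _ (enum (powerset S)) (B3 S) (expR b).
  - exact: mB3.
  - move=> U _.
    have := @tdot_sqr_tail _ _ _ _ _ _ _ _ _ dither (index_enum 'I_(r + k)) (sign_vector R S U) X (index_enum_uniq _).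
    rewrite sign_vector_sqr cS => /(_ sR) h; apply: (le_trans h).
    rewrite lee_fin ler_expR /b -[index_enum _]enumT size_enum_ord lerD2l lerN2.
    rewrite le_eqVlt; apply/orP; left; apply/eqP.
    by rewrite /X; field; rewrite !gt_eqF.
  split => //; apply: (le_trans hu).
  have e2 : expR (s%:R * ln 2) = 2 ^+ s :> R by rewrite expRM_natl lnK// posrE.
  by rewrite lee_fin -cardE card_powerset cS [expR (_ + b)]expRD natrX e2.
have [||||mU3 hU3] := @union_small _ [set S : {set 'I_m} | #|S| == s]%SET (fun S => if #|S| == s then U3 S else set0) (s%:R * (1 + ln (m%:R / s%:R))) (s%:R * ln 2 + b).
- rewrite card_draws card_ord; exact: binomial_le_exp.
- have mR : 0 < m%:R :> R by rewrite ltr0n.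
  have : ln (2 * m%:R / s%:R) = ln 2 + ln (m%:R / s%:R) :> R.
    by rewrite -mulrA lnM// posrE ?divr_gt0.
  by move: h3; rewrite /b => h3 e; rewrite e in h3; lra.
- move=> S; case: eqP => cS; last exact: measurable0.
  by have [] := hS S cS.
- move=> S; rewrite finset.inE => /[dup] /eqP cS ->.
  by have [] := hS S cS.
set V1 := [set w | _] in mU1 hU1; set V1' := [set w | _] in mU1' hU1'.
set V2 := [set w | _] in mU2 hU2; set V3 := [set w | _] in mU3 hU3.
have mV : measurable (V1 `|` V1' `|` (V2 `|` V3)) by do ![apply: measurableU].
have hV : (P (V1 `|` V1' `|` (V2 `|` V3)) <= (1 / 25)%:E)%E.
  apply: (le_trans (measureU2 P (measurableU _ _ mU1 mU1') (measurableU _ _ mU2 mU3))).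
  rewrite (_ : (1 / 25)%:E = ((1 / 100)%:E + (1 / 100)%:E + ((1 / 100)%:E + (1 / 100)%:E))%E).
    apply: leeD; first by apply: (le_trans (measureU2 P mU1 mU1')); exact: leeD.
    by apply: (le_trans (measureU2 P mU2 mU3)); exact: leeD.
  by rewrite -!EFinD; congr (_%:E); lra.
exists (~` (V1 `|` V1' `|` (V2 `|` V3))); split.
- exact: measurableC.
- move=> w /= hw; apply: (@distortion_le s w) => //.
  + move=> f g fn gn; have pn : (f, g) \in NN by rewrite finset.in_setX fn gn.
    rewrite -/c ler_distl; apply/andP; split; apply/ltW; rewrite ltNge; apply/negP => h; apply: hw; left.
      by right; exists (f, g).
    by left; exists (f, g).
  + move=> f fn; apply/ltW; rewrite ltNge; apply/negP => h; apply: hw; right; left.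
    by exists f.
  + move=> S U cS US; rewrite ltNge; apply/negP => h; apply: hw; right; right.
    exists S; first by rewrite finset.inE cS.
    by rewrite cS eqxx; exists U => //; rewrite mem_enum powersetE.
- rewrite probability_setC//; apply: (@le_trans _ _ (1 - (1 / 25)%:E)%E).
    by rewrite -EFinB lee_fin; lra.
  by apply: leeB.
Qed.

End upper_bound.

(** * The lower bound *)

Section band_sign.
Context {R : realType}.

Definition band_sign (kappa t : R) : R :=
  if `|t| <= kappa then (if 0 <= t then 1 else -1) else 0.

Lemma measurable_band_sign kappa : measurable_fun setT (band_sign kappa).
Proof.
apply: measurable_fun_ifT => //; last by apply: measurable_fun_ifT => //; exact: measurable_fun_ler.
by apply: measurable_fun_ler => //; exact: normr_measurable.
Qed.

Lemma band_sign_sqr kappa t : band_sign kappa t ^+ 2 = (`|t| <= kappa)%R%:R.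
Proof.
by rewrite /band_sign; case: ifP => _; [case: ifP => _; rewrite ?sqrrN expr1n|rewrite expr0n].
Qed.

Lemma band_sign_flip kappa t a : 0 <= kappa -> band_sign kappa t != 0 ->
  kappa < - (band_sign kappa t * a) -> (0 <= a + t) != (0 <= 0 + t).
Proof.
rewrite /band_sign add0r => k0; case: ifP => [|_]; last by rewrite eqxx.
rewrite ler_norml => /andP[t1 t2]; case: (leP 0 t) => t0 _ h.
  by case: leP => //; lra.
by case: leP => //; lra.
Qed.

End band_sign.

Section lower_probabilities.
Context d (T : measurableType d) (R : realType) (P : probability T R).
Context (m n : nat) (lambda : R).
Context (A : 'I_m -> 'I_n -> {RV P >-> R}) (tau : 'I_m -> {RV P >-> R}).
Hypothesis dither : gaussian_dither lambda A tau.
Variable s : seq 'I_n.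
Hypothesis us : uniq s.

(** Its mean is (v i)^2 times the size of [s], since A^T v contains the row A_i itself with weight
    v_i. *)
Definition corr (v : 'I_m -> R) (i : 'I_m) (w : T) : R :=
  v i * \sum_(j <- s) A i j w * tdot A v j w.

Definition fails (v : 'I_m -> R) (i : 'I_m) (w : T) : bool :=
  (v i != 0) && (corr v i w <= (size s)%:R / 8).

Notation nfails v w := (\sum_(i < m) (fails v i w)%:R : R).
Notation sqr_norm v w := (\sum_(j <- s) tdot A v j w ^+ 2).

Lemma measurable_corr v i : measurable_fun setT (corr v i).
Proof.
apply: measurable_funM => //; apply: measurable_sum => j; apply: measurable_funM => //.
apply: (@sigT_measurable_fun _ _ _ _ _ (fam A tau) [set: _]%SET).
by apply: measurable_tdot => i'; rewrite finset.inE.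
Qed.

Lemma measurable_fails v i : measurable [set w | fails v i w].
Proof.
apply: measurable_bool_set; apply: measurable_and => //.
by apply: measurable_fun_ler => //; exact: measurable_corr.
Qed.

(** Markov's inequality for exp(- corr / q): the threshold costs a factor exp(|s| / (8 q)) against
    the moment exp(- |s| / (4 q)). The indicator of v_i != 0 is kept so that the sum over i is
    proportional to q. *)
Lemma fails_prob (v : 'I_m -> R) i : let q := \sum_i v i ^+ 2 in
  1 <= q -> (v i != 0 -> v i ^+ 2 = 1) ->
  (P [set w | fails v i w] <= (expR (- ((size s)%:R / (8 * q))) * (v i != 0)%:R)%:E)%E.
Proof.
move=> q q1 hv; have q0 : 0 < q by lra.
have [vi|vi] := eqVneq (v i) 0.
  rewrite mulr0 (_ : [set w | _] = set0) ?measure0//.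
  by apply/seteqP; split => w //=; rewrite /fails vi eqxx.
rewrite mulr1.
pose g w := - corr v i w / q.
have mg : measurable_fun setT g.
  by apply: measurable_funM => //; apply: measurableT_comp => //; exact: measurable_corr.
apply: (le_trans (@exp_markov _ _ _ P _ g (- ((size s)%:R / (8 * q))) (measurable_fails v i) mg _)).
  move=> w; rewrite /= /fails vi /= => h.
  rewrite (_ : - (_ / _) = - ((size s)%:R / 8) / q); last by field; rewrite gt_eqF.
  by rewrite /g ler_pM2r ?invr_gt0// lerN2.
apply: (@le_trans _ _ ((expR (- - ((size s)%:R / (8 * q))))%:E * (expR (- ((size s)%:R / (4 * q))))%:E)%E).
  by apply: lee_wpmul2l; [rewrite lee_fin expR_ge0|exact: (row_tdot_mgf dither us (hv vi) q1)].
rewrite -EFinM lee_fin -expRD ler_expR le_eqVlt; apply/orP; left; apply/eqP.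
by field; rewrite gt_eqF.
Qed.

Lemma measurable_nfails v : measurable_fun setT (fun w => nfails v w).
Proof.
apply: measurable_sum => i.
rewrite (_ : (fun w => _) = (fun w => if fails v i w then 1 else 0)); last first.
  by apply/funext => w; case: fails.
apply: measurable_fun_ifT => //; apply: measurable_and => //.
by apply: measurable_fun_ler => //; exact: measurable_corr.
Qed.

(** The events [fails v i] share the vector A^T v and are not independent, so Markov's inequality
    for their number replaces Chernoff's bound. The mean is at most q times the common
    exponential. *)
Lemma nfails_tail (v : 'I_m -> R) : let q := \sum_i v i ^+ 2 in
  1 <= q -> (forall i, v i != 0 -> v i ^+ 2 = 1) ->
  (P [set w | (q / 2 <= nfails v w)%R] <= (2 * expR (- ((size s)%:R / (8 * q))))%:E)%E.
Proof.
move=> q q1 hv; have q0 : 0 < q by lra.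
have mA : measurable [set w | (q / 2 <= nfails v w)%R].
  by have := measurable_fun_le measurableT (measurable_cst (q / 2)) (measurable_nfails v); rewrite setTI.
set B := [set w | _] in mA *.
have -> : P B = (\int[P]_w (\1_B w)%:E)%E by rewrite integral_indic// setIT.
apply: (@le_trans _ _ (\int[P]_w ((2 / q)%:E * \sum_(i < m) (\1_[set w | fails v i w] w)%:E))%E).
  apply: le_ge0_integral => w; first by rewrite lee_fin.
  have -> : (\sum_(i < m) (\1_[set w | fails v i w] w)%:E = (nfails v w)%:E)%E.
    rewrite sumEFin; congr EFin; apply: eq_bigr => i _; rewrite indicE.
    by congr (_%:R); congr nat_of_bool; apply/idP/idP => [/set_mem//|h]; exact/mem_set.
  rewrite -EFinM lee_fin indicE; case: (boolP (w \in B)) => [/set_mem h|_].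
    by rewrite mulrAC ler_pdivlMr// mul1r; rewrite /B /= in h; lra.
  by rewrite mulr_ge0 ?sumr_ge0// divr_ge0// ltW.
rewrite ge0_integralZl//; last 3 first.
- apply: emeasurable_sum => i; apply/measurable_EFinP; apply: measurable_indic; exact: measurable_fails.
- by move=> w _; apply: sume_ge0 => i _; rewrite lee_fin.
- by rewrite lee_fin divr_ge0// ltW.
rewrite ge0_integral_sum//; last first.
  by move=> i; apply/measurable_EFinP; apply: measurable_indic; exact: measurable_fails.
set e := expR _.
apply: (@le_trans _ _ ((2 / q)%:E * \sum_(i < m) (e * v i ^+ 2)%:E)%E).
  apply: lee_wpmul2l; first by rewrite lee_fin divr_ge0// ltW.
  apply: lee_sum => i _; rewrite integral_indic//; last exact: measurable_fails.
  rewrite setIT; apply: (le_trans (fails_prob q1 (hv i))).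
  rewrite lee_fin ler_wpM2l ?expR_ge0//.
  by case: eqVneq => [->|/hv ->]//; rewrite sqr_ge0.
rewrite sumEFin -mulr_sumr -EFinM lee_fin -/q le_eqVlt; apply/orP; left; apply/eqP.
by field; rewrite gt_eqF.
Qed.

(* With w = A^T v restricted to the columns in [s], the point y = - eps w / |w| has
   <A_i, y> = - eps (corr v i) / (v_i |w|): it is useful when |w| is not too
   large and corr v i is large for most rows i. *)
Definition bad (v : 'I_m -> R) (w : T) : bool :=
  (8 * (size s)%:R * \sum_i v i ^+ 2 <= sqr_norm v w) ||
  ((\sum_i v i ^+ 2) / 2 <= nfails v w).

(** The level 8 |s| q for |A^T v|^2 gives the tail exp(|s| / 2 - 2 |s|), which is below exp(- |s| /
    (8 q)) because q >= 1. *)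
Lemma bad_prob (v : 'I_m -> R) : let q := \sum_i v i ^+ 2 in
  1 <= q -> (forall i, v i != 0 -> v i ^+ 2 = 1) ->
  (P [set w | bad v w] <= (3 * expR (- ((size s)%:R / (8 * q))))%:E)%E.
Proof.
move=> q q1 hv; have q0 : 0 < q by lra.
pose B1 := [set w | (8 * (size s)%:R * q <= sqr_norm v w)%R].
pose B2 := [set w | (q / 2 <= nfails v w)%R].
have mB1 : measurable B1.
  by have := measurable_fun_le measurableT (measurable_cst (8 * (size s)%:R * q)) (measurable_tdot_sqr A tau s v); rewrite setTI.
have mB2 : measurable B2.
  by have := measurable_fun_le measurableT (measurable_cst (q / 2)) (measurable_nfails v); rewrite setTI.
have -> : [set w | bad v w] = B1 `|` B2.
  by apply/seteqP; split => w; [move=> /orP[]; [left|right]|case => h; apply/orP; [left|right]].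
apply: (le_trans (measureU2 P mB1 mB2)).
rewrite (_ : 3 * _ = expR (- ((size s)%:R / (8 * q))) + 2 * expR (- ((size s)%:R / (8 * q)))); last by ring.
rewrite EFinD; apply: leeD; last exact: nfails_tail.
apply: (le_trans (tdot_sqr_tail dither _ us q0)); rewrite lee_fin ler_expR -/q.
rewrite (_ : 8 * (size s)%:R * q / (4 * q) = 2 * (size s)%:R); last by field; rewrite gt_eqF.
have : (size s)%:R / (8 * q) <= (size s)%:R :> R.
  by rewrite ler_pdivrMr ?mulr_gt0// ler_peMr//; lra.
have : 0 <= (size s)%:R :> R by [].
lra.
Qed.

End lower_probabilities.

(** * Assembling the lower bound *)

Section lower_bound.
Context d (T : measurableType d) (R : realType) (P : probability T R).
Context (m r k : nat) (lambda delta eps kappa : R).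
Context (A : 'I_m -> 'I_(r + k) -> {RV P >-> R}) (tau : 'I_m -> {RV P >-> R}).
Hypothesis dither : gaussian_dither lambda A tau.
Hypothesis m0 : (0 < m)%N.
Hypothesis eps0 : 0 < eps.
Hypothesis kappa0 : 0 < kappa.
Hypothesis kappal : kappa <= lambda.

Notation V w := (fun i => band_sign kappa (tau i w)).
Notation q w := (\sum_(i < m) band_sign kappa (tau i w) ^+ 2 : R).
Notation p := (m%:R * (kappa / lambda)).

Let s := map (@rshift r k) (enum 'I_k).

Let us : uniq s.
Proof. by rewrite map_inj_uniq ?enum_uniq//; exact: rshift_inj. Qed.

Let size_s : size s = k.
Proof. by rewrite size_map size_enum_ord. Qed.

Let sum_s (F : 'I_(r + k) -> R) : \sum_(j <- s) F j = \sum_(j < k) F (rshift r j).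
Proof. by rewrite big_map big_enum. Qed.

Lemma band_sign_neq0 t : band_sign kappa t != 0 -> band_sign kappa t ^+ 2 = 1.
Proof.
rewrite band_sign_sqr /band_sign; case: ifP => //.
by rewrite eqxx.
Qed.

Lemma q_bands w : q w = \sum_(i < m) (`|tau i w| <= kappa)%R%:R.
Proof. by apply: eq_bigr => i _; rewrite band_sign_sqr. Qed.

Lemma measurable_q : measurable_fun setT (fun w => q w).
Proof.
apply: measurable_sum => i; apply: measurable_funX.
by apply: measurableT_comp => //; exact: measurable_band_sign.
Qed.

(** Chernoff with u = 1/4 at twice the mean and u = 1/8 at half of it. As kappa <= lambda, each
    dither falls in the band with probability exactly kappa / lambda. *)
Lemma q_tail :
  (P [set w | (2 * p <= q w)%R] <= (expR (- (p / 8)))%:E)%E /\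
  (P [set w | (q w <= p / 2)%R] <= (expR (- (p / 32)))%:E)%E.
Proof.
have l0 : 0 < lambda by exact: lt_le_trans kappal.
have p0 : 0 <= kappa / lambda by rewrite divr_ge0// ltW.
pose b i w := (`|tau i w| <= kappa)%R.
have mb i : measurable_fun setT (b i : sigT (fam A tau) [set k | row_of k == i]%SET -> bool).
  apply: measurable_fun_ler => //; apply: measurableT_comp => //.
  by apply: measurable_tau; rewrite finset.inE.
have bE i : [set w | b i w] = [set w | tau i w \in `[- kappa, kappa]].
  by apply/funext => w; apply/propext; rewrite /b /= in_itv /= ler_norml.
have pE : (kappa - - kappa) / (2 * lambda) = kappa / lambda.
  by field; rewrite gt_eqF.
have u14 : 0 <= (1 / 4 : R) <= 1 / 2 by apply/andP; split; lra.
have u18 : 0 <= (1 / 8 : R) <= 1 / 2 by apply/andP; split; lra.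
have kk : - kappa <= kappa by rewrite (le_trans _ (ltW kappa0))// oppr_le0 ltW.
split.
- have -> : [set w | (2 * p <= q w)%R] = [set w | (m%:R * (kappa / lambda) + p <= \sum_i (b i w)%:R)%R].
    by apply/funext => w; apply/propext; rewrite /= q_bands (_ : 2 * p = p + p)//; lra.
  have h := chernoff_upper (indep_fam dither) p (@disjoint_rows m (r + k)) mb _ u14 p0.
  apply: le_trans (h _) _.
  + by move=> i; rewrite bE -pE; exact: (uniform_itv_le (tau_uniform dither i)).
  + by rewrite lee_fin ler_expR le_eqVlt; apply/orP; left; apply/eqP; field; rewrite gt_eqF.
- have -> : [set w | (q w <= p / 2)%R] = [set w | (\sum_i (b i w)%:R <= m%:R * (kappa / lambda) - p / 2)%R].
    by apply/funext => w; apply/propext; rewrite /= q_bands (_ : p - p / 2 = p / 2)//; lra.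
  have h := chernoff_lower (indep_fam dither) (p / 2) (@disjoint_rows m (r + k)) mb _ u18 p0.
  apply: le_trans (h _) _.
  + move=> i; rewrite bE -pE; apply: (uniform_itv_ge (tau_uniform dither i)) => //.
    by rewrite lerN2.
  + by rewrite lee_fin ler_expR le_eqVlt; apply/orP; left; apply/eqP; field; rewrite gt_eqF.
Qed.

(* Given tau, the vector of signs is fixed and [bad_prob] applies. *)
Lemma conditional_bad_prob : 2 <= p ->
  let b (w1 w2 : T) := [&& p / 2 < q w1, q w1 < 2 * p & bad A s (V w1) w2] in
  measurable [set w | b w w] /\
  (P [set w | b w w] <= (3 * expR (- (k%:R / (16 * p))))%:E)%E.
Proof.
move=> p2 b.
pose isA (x : 'I_m * 'I_(r + k) + 'I_m) := if x is inl _ then true else false.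
pose D1 := [set x | isA x == false]%SET; pose D2 := [set x | isA x == true]%SET.
have D12 : [disjoint D1 & D2]%B by exact: disjoint_fibers.
have mV i : measurable_fun setT ((fun w => band_sign kappa (tau i w)) : sigT (fam A tau) D1 -> R).
  apply: measurableT_comp; first exact: measurable_band_sign.
  by apply: measurable_tau; rewrite finset.inE.
have mA i j : measurable_fun setT (A i j : sigT (fam A tau) D2 -> R).
  by apply: (@measurable_sigT _ _ _ _ _ (fam A tau) _ (inl (i, j))); rewrite finset.inE.
have mV1 i : measurable_fun setT (fun z : sigT (fam A tau) D1 * sigT (fam A tau) D2 => band_sign kappa (tau i z.1)).
  exact: (measurableT_comp (mV i)).
have mA2 i j : measurable_fun setT (fun z : sigT (fam A tau) D1 * sigT (fam A tau) D2 => A i j z.2).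
  exact: (measurableT_comp (mA i j)).
have mq : measurable_fun setT (fun z : sigT (fam A tau) D1 * sigT (fam A tau) D2 => q z.1).
  by apply: measurable_sum => i; exact: measurable_funX.
have mt j : measurable_fun setT (fun z : sigT (fam A tau) D1 * sigT (fam A tau) D2 => tdot A (V z.1) j z.2).
  by apply: measurable_sum => i; exact: measurable_funM.
have mb : measurable_fun setT (fun z : sigT (fam A tau) D1 * sigT (fam A tau) D2 => b z.1 z.2).
  apply: measurable_and; first exact: measurable_fun_ltr.
  apply: measurable_and; first exact: measurable_fun_ltr.
  apply: measurable_or; apply: measurable_fun_ler => //.
  - exact: measurable_funM.
  - by apply: measurable_sum => j; exact: measurable_funX.
  - exact: measurable_funM.
  - apply: measurable_sum => i.
    rewrite (_ : (fun z => _) = (fun z => if fails A s (V z.1) i z.2 then 1 else 0)); last first.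
      by apply/funext => z; case: fails.
    apply: measurable_fun_ifT => //; apply: measurable_and.
      apply: measurable_neg; exact: measurable_fun_eqr.
    apply: measurable_fun_ler => //; apply: measurable_funM => //.
    by apply: measurable_sum => j; exact: measurable_funM.
have [mb1 mb2 e] := indep_event (indep_fam dither) D12 mb.
split.
  apply: measurable_bool_set.
  apply: (measurableT_comp mb (g := fun w : T => (w : sigT (fam A tau) D1, w : sigT (fam A tau) D2))).
  by apply: measurable_fun_pair; exact: measurable_sigT_id.
rewrite e; apply: (@le_trans _ _ (\int[P]_w (3 * expR (- (k%:R / (16 * p))))%:E)%E); last first.
  by rewrite integral_cst//= probability_setT mule1.
apply: le_ge0_integral => w1 //.
(* Outside this window the event is empty. Inside it, q >= 1 follows from p >= 2, and q < 2 p turns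
   k / (8 q) into k / (16 p). *)
case: (boolP ((p / 2 < q w1) && (q w1 < 2 * p))) => [/andP[q1 q2]|nq]; last first.
  rewrite (_ : [set w | _] = set0) ?measure0 ?lee_fin ?mulr_ge0 ?expR_ge0//.
  by apply/seteqP; split => w //=; rewrite /b andbA (negbTE nq).
apply: (@le_trans _ _ (P [set w | bad A s (V w1) w])).
  rewrite le_eqVlt; apply/orP; left; apply/eqP; congr (P _).
  by apply/funext => w; apply/propext; rewrite /b /= q1 q2.
have q3 : 1 <= q w1 by lra.
apply: (le_trans (bad_prob dither us q3 _)).
  by move=> i; exact: band_sign_neq0.
rewrite size_s lee_fin ler_wpM2l// ler_expR lerN2 ler_wpM2l// lef_pV2 ?posrE; lra.
Qed.

(** A row that does not fail is pushed by more than eps (k / 8) / |A^T v|, and |A^T v|^2 < 8 k q <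
    16 k p; the first hypothesis says that this push is at least kappa. *)
Lemma lower_point (w : T) : 1024 * (kappa ^+ 2 * p) <= eps ^+ 2 * k%:R ->
  (0 < k)%N -> p / 2 < q w -> q w < 2 * p -> ~~ bad A s (V w) w ->
  exists y, [/\ ellipsoid eps y, l2norm y <= eps &
    p / 4 <= \sum_(i < m) (flip A tau (coords y) (coords (0 : 'cV[R]_(r + k))) i w)%:R].
Proof.
move=> hk k0 q1 q2; rewrite negb_or -!ltNge size_s sum_s => /andP[W8 nf].
have l0 : 0 < lambda by exact: lt_le_trans kappal.
have mR : 0 < m%:R :> R by rewrite ltr0n.
have kR : 0 < k%:R :> R by rewrite ltr0n.
have p0 : 0 < p by rewrite mulr_gt0 ?divr_gt0.
have q0 : 0 < q w by lra.
pose t j := tdot A (V w) (rshift r j) w.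
set W := \sum_(j < k) _ in W8.
have W0 : 0 <= W by apply: sumr_ge0 => j _; exact: sqr_ge0.
have WE : W = \sum_j t j ^+ 2 by [].
(* If W = 0 the inverse is 0 and y = 0, which still satisfies the norm bound; W > 0 is derived later
   from a row that does not fail. *)
pose a := eps / Num.sqrt W.
pose y : 'cV[R]_(r + k) := col_mx 0 (\col_j (- a * t j)).
have yn : \sum_(j < k) (- a * t j) ^+ 2 <= eps ^+ 2.
  under eq_bigr do rewrite exprMn.
  rewrite -mulr_sumr -WE sqrrN /a exprMn exprVn sqr_sqrtr//.
  have [->|Wn] := eqVneq W 0; first by rewrite mulr0 sqr_ge0.
  by rewrite divfK.
have yr i : coords y (rshift r i) = - a * t i by rewrite /coords /y col_mxEd mxE.
have yl i : coords y (lshift k i) = 0 by rewrite /coords /y col_mxEu mxE.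
have yE : l2norm y <= eps.
  rewrite -(@ler_pXn2r _ 2)// ?nnegrE ?sqrtr_ge0 ?(ltW eps0)//.
  rewrite sqr_sqrtr; last by apply: sumr_ge0 => i _; exact: sqr_ge0.
  rewrite big_split_ord /= [X in X + _]big1 ?add0r; last by move=> i _; rewrite col_mxEu mxE expr0n.
  by under eq_bigr do rewrite col_mxEd mxE.
exists y; split => //.
  split.
    rewrite /y col_mxKu /l2norm big1 ?sqrtr0// => i _; by rewrite mxE expr0n.
  rewrite /y col_mxKd -(@ler_pXn2r _ 2)// ?nnegrE ?sqrtr_ge0 ?(ltW eps0)//.
  rewrite sqr_sqrtr; last by apply: sumr_ge0 => i _; exact: sqr_ge0.
  by under eq_bigr do rewrite mxE.
have dot0 i : dot A (coords (0 : 'cV[R]_(r + k))) i w = 0.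
  by rewrite /dot big1// => j _; rewrite /coords mxE mul0r.
have doty i : band_sign kappa (tau i w) * dot A (coords y) i w = - (a * corr A s (V w) i w).
  rewrite /dot big_split_ord /= [X in _ * (X + _)]big1 ?add0r; last by move=> j _; rewrite yl mul0r.
  rewrite /corr sum_s mulrCA -mulrN; congr (_ * _).
  by rewrite mulr_sumr -sumrN; apply: eq_bigr => j _; rewrite yr /t; ring.
have hflip i : band_sign kappa (tau i w) != 0 -> ~~ fails A s (V w) i w ->
    flip A tau (coords y) (coords (0 : 'cV[R]_(r + k))) i w.
  move=> vi; rewrite /fails vi /= size_s -ltNge => hc.
  have Wp : 0 < W.
    rewrite lt0r W0 andbT; apply/eqP => /psumr_eq0P W00.
    have : corr A s (V w) i w = 0.
      rewrite /corr sum_s big1 ?mulr0// => j _.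
      have /eqP := W00 (fun j _ => sqr_ge0 _) j isT; rewrite sqrf_eq0 => /eqP ->.
      by rewrite mulr0.
    by move=> c0; rewrite c0 in hc; lra.
  rewrite /flip /tau_flip dot0; apply: (band_sign_flip (ltW kappa0) vi).
  rewrite doty opprK.
  have a0 : 0 < a by rewrite divr_gt0// sqrtr_gt0.
  apply: (@le_lt_trans _ _ (a * (k%:R / 8))); last by rewrite ltr_pM2l.
  rewrite -(@ler_pXn2r _ 2)// ?nnegrE ?(ltW kappa0)//; last by rewrite mulr_ge0 ?divr_ge0// ltW.
  rewrite /a !exprMn exprVn sqr_sqrtr// mulrAC ler_pdivlMr//.
  apply: (@le_trans _ _ (kappa ^+ 2 * (8 * k%:R * (2 * p)))).
    apply: ler_wpM2l; first exact: sqr_ge0.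
    by apply: (le_trans (ltW W8)); rewrite ler_wpM2l ?mulr_ge0// ltW.
  have -> : kappa ^+ 2 * (8 * k%:R * (2 * p)) = 1024 * (kappa ^+ 2 * p) * (k%:R / 64) by field; rewrite gt_eqF.
  rewrite (_ : eps ^+ 2 * _ = eps ^+ 2 * k%:R * (k%:R / 64)); last by field.
  by rewrite ler_wpM2r// divr_ge0.
(* At most half of the q rows in the band fail, and q / 2 > p / 4. *)
apply: (@le_trans _ _ (q w - \sum_(i < m) (fails A s (V w) i w)%:R)); first by lra.
rewrite -sumrB; apply: ler_sum => i _.
have [->|vi] := eqVneq (band_sign kappa (tau i w)) 0.
  by rewrite expr0n /= sub0r; apply: (@le_trans _ _ 0).
rewrite band_sign_neq0//; have := hflip i vi.
by case: fails => [_|/(_ isT) ->]; rewrite ?subrr ?subr0.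
Qed.

(** The p / 4 flips scale to at least kappa / 2 >= 2 delta + eps, while |y| <= eps. The first two
    hypotheses bound the exceptional probabilities by 1/100, 4/100 and 5/100. *)
Lemma lower_estimate : 1000 <= p -> 99 * (16 * p) <= k%:R ->
  1024 * (kappa ^+ 2 * p) <= eps ^+ 2 * k%:R -> 2 * (2 * delta + eps) <= kappa ->
  with_prob_at_least P (9 / 10) [set w | exists x y : 'cV[R]_(r + k),
    [/\ ellipsoid eps x, ellipsoid eps y &
        2 * delta <= distortion lambda (random_map A tau w) x y]].
Proof.
move=> p1 pk hk hkap.
have l0 : 0 < lambda by exact: lt_le_trans kappal.
have mR : 0 < m%:R :> R by rewrite ltr0n.
have k0 : (0 < k)%N by rewrite -(ltr0n R); lra.
have [t1 t2] := q_tail.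
have [|mB hB] := conditional_bad_prob; first lra.
set B := [set w | _] in mB hB.
set U := [set w | _] in t1; set L := [set w | _] in t2.
have mU : measurable U.
  by have := measurable_fun_le measurableT (measurable_cst (2 * p)) measurable_q; rewrite setTI.
have mL : measurable L.
  by have := measurable_fun_le measurableT measurable_q (measurable_cst (p / 2)); rewrite setTI.
have mV : measurable (U `|` L `|` B) by do ![apply: measurableU].
have ex (x a : R) : 0 < a -> a <= x -> expR (- x) <= a^-1.
  move=> a0 ax; rewrite expRN lef_pV2 ?posrE ?expR_gt0//.
  by have := expR_ge1Dx x; lra.
exists (~` (U `|` L `|` B)); split.
- exact: measurableC.
- move=> w /= hw.
  have q2 : q w < 2 * p by rewrite ltNge; apply/negP => h; apply: hw; left; left.
  have q1 : p / 2 < q w by rewrite ltNge; apply/negP => h; apply: hw; left; right.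
  have nb : ~~ bad A s (V w) w by apply/negP => h; apply: hw; right; rewrite /B /= q1 q2.
  have [y [Ey yn hf]] := lower_point hk k0 q1 q2 nb.
  exists y, 0; split => //.
    by split; rewrite /l2norm big1 ?sqrtr0// ?(ltW eps0)// => i _; rewrite !mxE expr0n.
  rewrite /distortion hammingE subr0; apply: le_trans (ler_norm _).
  set F := \sum_(i < m) _ in hf *.
  have : Num.sqrt (2 * pi) * (lambda / m%:R) * (p / 4) <= Num.sqrt (2 * pi) * (lambda / m%:R) * F.
    by apply: ler_wpM2l => //; rewrite mulr_ge0 ?sqrtr_ge0// divr_ge0// ltW.
  rewrite (_ : _ * (p / 4) = Num.sqrt (2 * pi) * (kappa / 4)); last by field; rewrite !gt_eqF.
  have : 2 * (kappa / 4) <= Num.sqrt (2 * pi) * (kappa / 4).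
    by rewrite ler_wpM2r ?sqrt2pi_ge2// divr_ge0// ltW.
  move=> hh1 hh2; move: eps0 => e0; lra.
- rewrite probability_setC//; apply: (@le_trans _ _ (1 - (1 / 10)%:E)%E).
    by rewrite -EFinB lee_fin; lra.
  apply: leeB => //; apply: (le_trans (measureU2 P (measurableU _ _ mU mL) mB)).
  rewrite (_ : (1 / 10)%:E = ((1 / 100)%:E + (4 / 100)%:E + (5 / 100)%:E)%E); last first.
    by rewrite -!EFinD; congr (_%:E); lra.
  apply: leeD.
    apply: (le_trans (measureU2 P mU mL)); apply: leeD.
      by apply: (le_trans t1); rewrite lee_fin div1r; apply: ex => //; lra.
    apply: (le_trans t2); rewrite lee_fin (_ : 4 / 100 = 25^-1); last by lra.
    by apply: ex => //; lra.
  apply: (le_trans hB); rewrite lee_fin.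
  have := @ex (k%:R / (16 * p)) 99; rewrite ler_pdivlMr; last lra.
  move=> /(_ _ pk); lra.
Qed.

End lower_bound.

(** Valid for every outcome w: with no flip the error is the distance 4 delta itself, and one flip
    already counts for at least 8 delta. It covers the samples too small for the concentration of
    the band count. *)
Lemma small_sample_distortion d (T : measurableType d) (R : realType) (P : probability T R)
    (m r k : nat) (lambda delta eps : R)
    (A : 'I_m -> 'I_(r + k) -> {RV P >-> R}) (tau : 'I_m -> {RV P >-> R}) (w : T) :
  (0 < r)%N -> (0 < m)%N -> 0 < delta -> 4 * delta <= 1 -> 0 <= eps ->
  4 * delta * m%:R <= lambda ->
  exists x y : 'cV[R]_(r + k), [/\ ellipsoid eps x, ellipsoid eps y &
    2 * delta <= distortion lambda (random_map A tau w) x y].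
Proof.
move=> r0 m0 d0 d1 e0 ml.
pose x : 'cV[R]_(r + k) := \col_j (if val j == 0%N then 4 * delta else 0).
have n0 (z : 'cV[R]_k) : (forall i, z i 0 = 0) -> l2norm z = 0.
  by move=> h; rewrite /l2norm big1 ?sqrtr0// => i _; rewrite h expr0n.
have ux : l2norm (usubmx x) = 4 * delta.
  rewrite /l2norm (bigD1 (Ordinal r0))//= big1 ?addr0 => [|i hi].
    by rewrite !mxE /= sqrtr_sqr ger0_norm// mulr_ge0// ltW.
  by rewrite !mxE /= ifN ?expr0n.
have x0 : l2norm x = 4 * delta.
  rewrite -ux; congr Num.sqrt; rewrite big_split_ord /= [X in _ + X]big1 ?addr0 => [|i _].
    by apply: eq_bigr => i _; rewrite [usubmx x i 0]mxE.
  by rewrite !mxE /= ifN ?expr0n// -lt0n addn_gt0 r0.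
exists x, 0; split.
- split; first by rewrite ux.
  by rewrite n0// => i; rewrite !mxE /= ifN// -lt0n addn_gt0 r0.
- by split; rewrite /l2norm big1 ?sqrtr0// => i _; rewrite !mxE expr0n.
rewrite /distortion subr0 x0; case: hamming => [|h].
  by rewrite mulr0 sub0r normrN ger0_norm; lra.
apply: le_trans (ler_norm _).
have mR : 0 < m%:R :> R by rewrite ltr0n.
have c2 := @sqrt2pi_ge2 R.
have l1 : 4 * delta <= lambda / m%:R by rewrite ler_pdivlMr.
have l2 : 2 * (4 * delta) <= Num.sqrt (2 * pi) * (lambda / m%:R).
  by apply: ler_pM => //; rewrite mulr_ge0// ltW.
have : Num.sqrt (2 * pi) * (lambda / m%:R) <= Num.sqrt (2 * pi) * (lambda / m%:R) * h.+1%:R.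
  by rewrite ler_peMr ?ler1n//; lra.
lra.
Qed.

(** * Choice of the parameters *)

(** The condition 4 eps^2 <= eta makes the truncated subtraction in [cardJ] a true one, and bounds
    by eta r / 2 the loss eps^2 (r + 1) due to removing I and rounding down. *)
Lemma cardJ_bounds (R : realType) (eta eps : R) (r : nat) :
  0 < eta -> eta <= 1 -> 0 < eps -> eps <= 1 -> 4 * eps ^+ 2 <= eta -> (0 < r)%N ->
  let k := cardJ eta eps r in
  [/\ k%:R * eps ^+ 2 <= r%:R, (r + k)%:R * eps ^+ 2 <= r%:R &
      eta * r%:R / 2 <= eps ^+ 2 * k%:R].
Proof.
move=> eta0 eta1 e0 e1 he r0 k.
have rR : 1 <= r%:R :> R by rewrite ler1n.
have e2 : 0 < eps ^+ 2 by rewrite exprn_gt0.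
pose x := eta * r%:R / eps ^+ 2.
have xE : x * eps ^+ 2 = eta * r%:R by rewrite /x divfK// gt_eqF.
have x0 : 0 <= x by rewrite divr_ge0 ?mulr_ge0// ltW.
have /andP[t1 t2] := truncn_itv x0.
set t := Num.truncn x in t1 t2.
have er : eta * r%:R <= r%:R by rewrite ler_piMl//; lra.
have rt : (r <= t)%N.
  rewrite truncn_ge_nat// -(ler_pM2r e2) xE.
  have : r%:R * (4 * eps ^+ 2) <= r%:R * eta by rewrite ler_wpM2l//; lra.
  have : 0 <= r%:R * eps ^+ 2 by rewrite mulr_ge0// ltW.
  lra.
have kE : k%:R = t%:R - r%:R :> R by rewrite /k /cardJ natrB.
have te : t%:R * eps ^+ 2 <= x * eps ^+ 2 by rewrite ler_pM2r.
have te' : x * eps ^+ 2 <= t.+1%:R * eps ^+ 2 by rewrite ler_pM2r// ltW.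
have re0 : eps ^+ 2 <= r%:R * eps ^+ 2 by rewrite ler_peMl// ltW.
have re : r%:R * (4 * eps ^+ 2) <= r%:R * eta by rewrite ler_wpM2l//; lra.
rewrite natrD kE; split; [lra|by rewrite addrC subrK; lra|].
by move: te'; rewrite -natr1; lra.
Qed.

Lemma ln_le_id (R : realType) (x : R) : 0 < x -> ln x <= x.
Proof. by move=> x0; have := @ln_sublinear R x x0; lra. Qed.

(** Here y = m / lambda and t = ln (4 / eps). The sample size gives y delta^2 >= Q r / delta, of the
    same order in delta as the entropy bound r (1 + H / delta); c and c' are the denominators of the
    two Chernoff exponents. *)
Lemma net_sample_size (R : realType) (r : nat) (y delta t H Q c c' : R) :
  0 < c' -> c' <= c -> (0 < r)%N -> 0 < delta -> delta <= 1 -> 0 <= y -> 0 <= H ->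
  t <= H / delta -> Q * r%:R <= y * delta ^+ 3 -> c * (101 + 2 * H) <= Q ->
  2 * (r%:R * (1 + t)) + 99 <= y * delta ^+ 2 / c /\
  r%:R * (1 + t) + 99 <= y * delta / c'.
Proof.
move=> c0 cc r0 d0 d1 y0 H0 ht hm.
have rR : 1 <= r%:R :> R by rewrite ler1n.
pose D := delta^-1.
have D0 : 0 < D by rewrite invr_gt0.
have D1 : 1 <= D by rewrite invf_ge1.
pose X := r%:R * D.
have X1 : 1 <= X by rewrite -[leLHS]mulr1 ler_pM.
have hX : r%:R * (1 + t) <= (1 + H) * X.
  rewrite (_ : (1 + H) * _ = r%:R * (D + H / delta)); last by rewrite /X /D; field; rewrite gt_eqF.
  by rewrite ler_wpM2l//; lra.
have HX : 0 <= H * X by rewrite mulr_ge0//; lra.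
have h1 : 2 * (r%:R * (1 + t)) + 99 <= (101 + 2 * H) * X by lra.
have h2 : r%:R * (1 + t) + 99 <= (101 + 2 * H) * X by lra.
have hy : Q * X <= y * delta ^+ 2.
  rewrite /X mulrA /D ler_pdivrMr//; apply: (le_trans hm).
  by rewrite -mulrA -exprSr.
have hy' : y * delta ^+ 2 <= y * delta.
  by rewrite expr2 mulrA ler_piMr// mulr_ge0// ltW.
have X0 : 0 <= X by lra.
have HH : 0 <= (101 + 2 * H) * X by lra.
move=> /(ler_wpM2r X0); rewrite -[_ * _ * X]mulrA => hQ.
have hQ2 := le_trans hQ hy.
have Z0 : 0 <= (101 + 2 * H) * X by [].
split; rewrite ler_pdivlMr ?(lt_le_trans c0 cc)// mulrC; apply: le_trans.
- by apply: ler_wpM2l h1; lra.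
- exact: hQ2.
- by apply: ler_wpM2l h2; lra.
- by apply: le_trans (le_trans hQ2 hy'); apply: ler_wpM2r.
Qed.

(** s is the integer part of x = m delta / (100 lambda). As x >= 1, s is at least x / 2, hence 2 m /
    s <= 400 lambda / delta and the entropy per coordinate is at most 400 + l. *)
Lemma sparsity_level (R : realType) (m r k : nat) (lambda delta eps l Q : R) :
  (0 < r)%N -> 0 < delta -> delta <= 1 -> 1 <= lambda -> 0 < eps ->
  (r + k)%:R * eps ^+ 2 <= r%:R ->
  Q * r%:R <= m%:R / lambda * delta ^+ 3 -> 100 <= Q ->
  l = ln (expR 1 * lambda / delta) ->
  500 * (l * (8 * (100 * eps)) ^+ 2) <= delta ^+ 2 -> 200 * (320 * 1000) <= Q ->
  exists s : nat, [/\ (0 < s)%N, (s <= m)%N, s%:R <= m%:R * delta / (100 * lambda) &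
      s%:R * (1 + ln (2 * m%:R / s%:R)) + (r + k)%:R / 2 + 99 <=
        s%:R * delta ^+ 2 / (32 * (100 * eps) ^+ 2)].
Proof.
move=> r0 d0 d1 l1 e0 hk hm Q100 ->; rewrite -mulrA lnM ?posrE ?expR_gt0 ?divr_gt0//; last by lra.
rewrite expRK; clear l; set l := 1 + _.
have l0 : 0 < lambda by lra.
have rR : 1 <= r%:R :> R by rewrite ler1n.
set y := m%:R / lambda in hm.
have y0 : 0 <= y by rewrite divr_ge0// ltW.
have hyd : 100 <= y * delta.
  apply: (@le_trans _ _ (Q * r%:R)); first by rewrite -[leLHS]mulr1 ler_pM.
  apply: (le_trans hm); rewrite exprS mulrA ler_piMr//; first by rewrite (mulr_ge0 y0 (ltW d0)).
  by rewrite exprn_ile1// ltW.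
pose x := y * delta / 100.
have xE : x = m%:R * delta / (100 * lambda) by rewrite /x /y; field; rewrite gt_eqF.
have x1 : 1 <= x by rewrite /x; lra.
have x0 : 0 <= x by lra.
have /andP[t1 t2] := truncn_itv x0.
set s := Num.truncn x in t1 t2.
have s0 : (0 < s)%N by rewrite truncn_gt0.
have sR : 1 <= s%:R :> R by rewrite ler1n.
have sp : 0 < s%:R :> R by lra.
have xs : x <= 2 * s%:R by move: t2; rewrite -natr1; lra.
have ld : 1 <= lambda / delta by rewrite ler_pdivlMr// mul1r; lra.
have ll : 1 <= l by rewrite lerDl ln_ge0.
have mR : 0 < m%:R :> R.
  rewrite ltr0n lt0n; apply/eqP => m00.
  by move: x1; rewrite xE m00 !mul0r; lra.
have logs : 1 + ln (2 * m%:R / s%:R) <= 4 * 100 + l.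
  have p1 : 0 < 2 * m%:R / s%:R :> R by rewrite divr_gt0// mulr_gt0.
  have p2 : 0 < 4 * 100 :> R by rewrite mulr_gt0.
  have p3 : 0 < lambda / delta by rewrite divr_gt0.
  have : ln (2 * m%:R / s%:R) <= ln (4 * 100 * (lambda / delta)).
    rewrite ler_ln ?posrE ?(mulr_gt0 p2 p3)// (ler_pdivrMr _ _ sp).
    move: xs; rewrite xE ler_pdivrMr ?mulr_gt0// => xs.
    rewrite (_ : 4 * 100 * _ * _ = 2 * (2 * s%:R * (100 * lambda)) / delta); last by field; rewrite gt_eqF.
    rewrite (ler_pdivlMr _ _ d0) -[2 * _ * delta]mulrA.
    by apply: ler_wpM2l.
  rewrite (lnM p2 p3); have := ln_le_id p2.
  by rewrite /l; set u := ln (4 * 100); set v := ln (lambda / delta); set z := ln _; clear; lra.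
have sl : s%:R <= s%:R * l by rewrite ler_peMr// ltW.
have logs' : s%:R * (1 + ln (2 * m%:R / s%:R)) <= 4 * 100 * s%:R + s%:R * l.
  by rewrite [4 * 100 * _]mulrC -mulrDr ler_wpM2l// ltW.
have hs : s%:R * (1 + ln (2 * m%:R / s%:R)) + 99 <= 500 * (s%:R * l) by lra.
have E0 : 0 < 64 * (100 * eps) ^+ 2 by rewrite mulr_gt0// exprn_gt0// mulr_gt0.
move=> hel hQ.
exists s; split => //.
- rewrite -(ler_nat R); apply: (le_trans t1); rewrite xE ler_pdivrMr ?mulr_gt0//.
  rewrite ler_wpM2l ?(ltW mR)//; apply: (le_trans d1); rewrite -[leLHS]mulr1.
  by apply: ler_pM => //; rewrite ler1n.
- by rewrite -xE.
(* One half pays for s ln (2 m / s) through the smallness of eps, the other for (r + k) / 2 <= r /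
   (2 eps^2) through the size of Q. *)
rewrite addrAC (_ : _ / (32 * _) = s%:R * delta ^+ 2 / (64 * (100 * eps) ^+ 2) + s%:R * delta ^+ 2 / (64 * (100 * eps) ^+ 2)); last first.
  by field; rewrite gt_eqF.
apply: lerD.
  apply: (le_trans hs); rewrite ler_pdivlMr//.
  rewrite (_ : 500 * _ * _ = s%:R * (500 * (l * (8 * (100 * eps)) ^+ 2))); last by ring.
  by rewrite ler_wpM2l// ltW.
rewrite ler_pdivlMr//.
rewrite (_ : _ / 2 * _ = 320 * 1000 * ((r + k)%:R * eps ^+ 2)); last by field.
have K0 : 0 <= 320 * 1000 :> R by exact: mulr_ge0 (ler0n _ _) (ler0n _ _).
apply: (le_trans (ler_wpM2l K0 hk)).
have hx : x * delta ^+ 2 <= 2 * s%:R * delta ^+ 2 by rewrite ler_wpM2r// sqr_ge0.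
rewrite (_ : x * _ = y * delta ^+ 3 / 100) in hx; last by rewrite /x; field.
have := le_trans (ler_wpM2r (ler0n R r) hQ) hm; rewrite -[200 * _ * _]mulrA.
move: hx; rewrite -[2 * _ * _]mulrA; move: (320 * 1000 * r%:R) (y * delta ^+ 3) (s%:R * delta ^+ 2).
by clear => z Y S; lra.
Qed.

(** All smallness conditions on delta are carried by one number B, with delta <= exp(- B). As B <=
    exp B this gives B delta <= 1, and the logarithm exceeds B. *)
Lemma small_delta (R : realType) (delta B eta : R) :
  0 < eta -> 0 < delta -> delta <= expR (- B) -> eta^-1 + 1000 <= B ->
  [/\ 1000 * delta <= 1, delta <= eta & 1 + B <= ln (expR 1 / delta)].
Proof.
move=> e0 d0 dB hB; have ei : 0 < eta^-1 by rewrite invr_gt0.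
have B0 : 1000 <= B by apply: le_trans hB; rewrite lerDr ltW.
have Be : eta^-1 <= B by apply: le_trans hB; rewrite lerDl ler0n.
have Bp : 0 < B by exact: lt_le_trans Be.
have Bd : B * delta <= 1.
  have h : 1 + B <= expR B by exact: expR_ge1Dx.
  apply: (@le_trans _ _ (expR B * expR (- B))); last by rewrite -expRD subrr expR0.
  apply: ler_pM => //; try exact: ltW.
  by apply: le_trans h; rewrite lerDr.
split.
- by apply: le_trans Bd; apply: ler_wpM2r => //; exact: ltW.
- have : eta^-1 * delta <= 1 by apply: le_trans Bd; apply: ler_wpM2r => //; exact: ltW.
  by rewrite mulrC ler_pdivrMr// mul1r.
- rewrite lnM ?posrE ?expR_gt0 ?invr_gt0// expRK lerD2l lnV ?posrE// lerNr.
  by rewrite -(expRK (- B)) ler_ln ?posrE ?expR_gt0.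
Qed.

(** * Consequences of the sizes of lambda and eps *)

Section log_parameters.
Context {R : realType}.
Variables (delta lambda eps a b Lam : R).
Notation L := (ln (expR 1 / delta)).
Notation l := (ln (expR 1 * lambda / delta)).
Hypothesis d0 : 0 < delta.
Hypothesis d1 : 24 * delta <= 1.
Hypothesis L1 : 1 <= L.
Hypothesis lamL : 4 * Num.sqrt L <= lambda.
Hypothesis lamU : lambda <= Lam * Num.sqrt L.

Lemma sqrt_log_ge1 : 1 <= Num.sqrt L.
Proof. by rewrite -[leLHS]sqrtr1 ler_wsqrtr. Qed.

Lemma lambda_ge4 : 4 <= lambda.
Proof. by move: lamL sqrt_log_ge1; lra. Qed.

Lemma log_ratioE : l = L + ln lambda.
Proof.
have l0 : 0 < lambda by move: lambda_ge4; lra.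
have p1 : 0 < expR 1 / delta by rewrite divr_gt0// expR_gt0.
by rewrite -(lnM p1 l0) mulrAC.
Qed.

Lemma log_le_ratio : L <= l.
Proof. by rewrite log_ratioE lerDl ln_ge0//; move: lambda_ge4; lra. Qed.

(** The constant 4 in front of sqrt L gives lambda^2 / 4 >= 2 L, hence an exponential below delta^2;
    one factor delta absorbs 96 / lambda <= 24. *)
Lemma gaussian_tail_le : 96 / lambda * expR (- (lambda ^+ 2 / 4)) <= delta.
Proof.
have l4 := lambda_ge4; have l0 : 0 < lambda by lra.
have s1 := sqrt_log_ge1.
have LE : Num.sqrt L ^+ 2 = L by rewrite sqr_sqrtr//; move: L1; lra.
have h1 : expR (- (lambda ^+ 2 / 4)) <= delta ^+ 2.
  have e1 : expR (- L) <= delta.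
    rewrite lnM ?posrE ?expR_gt0 ?invr_gt0// expRK lnV ?posrE// opprD opprK.
    by rewrite expRD lnK ?posrE// ler_piMl ?(ltW d0)//.
  apply: (@le_trans _ _ (expR (- L) ^+ 2)); last by rewrite lerXn2r ?nnegrE ?expR_ge0// ltW.
  rewrite -expRM_natl ler_expR.
  have : (4 * Num.sqrt L) ^+ 2 <= lambda ^+ 2 by rewrite lerXn2r ?nnegrE//; move: lamL; lra.
  by rewrite exprMn LE; move: L1; lra.
have h2 : 96 / lambda <= 24 by rewrite ler_pdivrMr//; lra.
apply: (@le_trans _ _ (24 * delta ^+ 2)).
  by apply: ler_pM => //; rewrite ?expR_ge0// divr_ge0// ltW.
by rewrite expr2 mulrA ler_piMl// ltW.
Qed.

Hypothesis eps0 : 0 < eps.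
Hypothesis a0 : 0 < a.
Hypothesis epsL : a * (delta / l) <= 2 * eps.
Hypothesis epsU : 2 * eps <= b * (delta / l).

(** l is at most 2 (1 + Lam) / delta, so 4 / eps is at most K / delta^2, and ln x <= x is applied to
    K and to 1 / delta. *)
Lemma log_eps_le : ln (4 / eps) <= (16 * (1 + Lam) / a + 2) / delta.
Proof.
have l4 := lambda_ge4; have l0 : 0 < lambda by lra.
have s1 := sqrt_log_ge1.
have LE : Num.sqrt L ^+ 2 = L by rewrite sqr_sqrtr//; move: L1; lra.
have Lam0 : 0 <= Lam by move: lamU; nra.
have di : 1 <= delta^-1 by rewrite invf_ge1//; move: d1 d0; lra.
have Lle : L <= 2 / delta.
  rewrite lnM ?posrE ?expR_gt0 ?invr_gt0// expRK.
  by have := @ln_le_id R delta^-1; rewrite invr_gt0 => /(_ d0); lra.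
have ll : 0 < l by apply: lt_le_trans log_le_ratio; move: L1; lra.
have lle : l <= 2 * (1 + Lam) / delta.
  rewrite log_ratioE; have := ln_le_id l0.
  have : Lam * Num.sqrt L <= Lam * L by rewrite ler_wpM2l// -[leRHS]LE expr2 ler_peMl//; lra.
  have : Lam * L <= Lam * (2 / delta) by rewrite ler_wpM2l.
  rewrite (_ : 2 * (1 + Lam) / delta = 2 / delta + Lam * (2 / delta)); last by field; rewrite gt_eqF.
  by move: lamU; lra.
set K := 16 * (1 + Lam) / a.
have K0 : 0 < K by rewrite divr_gt0// mulr_gt0//; lra.
have h : 4 / eps <= K * delta^-1 ^+ 2.
  rewrite ler_pdivrMr//.
  have : a * (delta / l) * (8 * l / (a * delta)) <= 2 * eps * (8 * l / (a * delta)).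
    by apply: ler_wpM2r epsL; rewrite divr_ge0 ?mulr_ge0// ltW.
  rewrite (_ : a * (delta / l) * _ = 8); last by field; rewrite !gt_eqF.
  have : 2 * eps * (8 * l / (a * delta)) <= 2 * eps * (8 * (2 * (1 + Lam) / delta) / (a * delta)).
    apply: ler_wpM2l; first by rewrite mulr_ge0// ltW.
    apply: ler_wpM2r; first by rewrite invr_ge0 mulr_ge0// ltW.
    exact: ler_wpM2l.
  rewrite (_ : 2 * eps * (8 * (2 * (1 + Lam) / delta) / (a * delta)) = 2 * (K * delta^-1 ^+ 2 * eps)); last first.
    by rewrite /K; field; rewrite !gt_eqF.
  lra.
have dp : 0 < delta^-1 by rewrite invr_gt0.
apply: (@le_trans _ _ (ln (K * delta^-1 ^+ 2))).
  by rewrite ler_ln// posrE ?divr_gt0// mulr_gt0// exprn_gt0.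
rewrite lnM ?posrE ?exprn_gt0// lnXn// -mulr_natl.
have := ln_le_id K0; have := ln_le_id dp.
have : K <= K * delta^-1 by rewrite ler_peMr// ltW.
by rewrite mulrDl; lra.
Qed.

Hypothesis b0 : 0 < b.

Lemma eps_log_le : 2 * eps * l <= b * delta.
Proof.
have ll : 0 < l by apply: lt_le_trans log_le_ratio; move: L1; lra.
by move: epsU; rewrite mulrA ler_pdivlMr.
Qed.

Lemma eps_le_delta : 12 * b <= L -> 24 * eps <= delta.
Proof.
move=> bL; have h := eps_log_le; have := le_trans bL log_le_ratio => bl.
rewrite -(ler_pM2l b0); apply: le_trans h.
have : 12 * b * eps <= l * eps by rewrite ler_wpM2r// ltW.
lra.
Qed.

(** This is where eps ~ delta / l matters: eps^2 l is of order delta^2 / l, and the spare factor 1 /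
    l beats every constant. *)
Lemma eps_sqr_log_le : 500 * (400 * b) ^+ 2 <= L -> 500 * (l * (8 * (100 * eps)) ^+ 2) <= delta ^+ 2.
Proof.
move=> bL; have h := eps_log_le; have bl := le_trans bL log_le_ratio.
have ll : 0 < l by apply: lt_le_trans log_le_ratio; move: L1; lra.
rewrite -(ler_pM2l ll); apply: (@le_trans _ _ (500 * (400 * b) ^+ 2 * delta ^+ 2)); last first.
  by apply: ler_wpM2r => //; exact: sqr_ge0.
rewrite [leLHS](_ : _ = 500 * (400 * (2 * eps * l)) ^+ 2); last by move: (l) => l'; ring.
rewrite -[leRHS]mulrA -exprMn -[400 * b * delta]mulrA; apply: ler_wpM2l; first exact: ler0n.
have e0 : 0 <= 2 * eps * l by rewrite !mulr_ge0// ltW.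
rewrite lerXn2r ?nnegrE ?(mulr_ge0 (ler0n R 400))//; first exact: le_trans h.
by apply: ler_wpM2l h; exact: ler0n.
Qed.

End log_parameters.

(** With kappa = M delta, kappa^2 p equals M^3 m delta^3 / lambda. The second bound follows from the
    same estimate because eps <= delta / 2. *)
Lemma lower_sample_size (R : realType) (m r k : nat) (lambda delta eps eta M : R) :
  0 < lambda -> 0 < delta -> 0 < eps -> eps <= delta / 2 -> 1 <= M ->
  eta * r%:R / 2 <= eps ^+ 2 * k%:R ->
  m%:R / lambda * delta ^+ 3 <= eta / (2 * (1024 * M ^+ 3)) * r%:R ->
  let p := m%:R * (M * delta / lambda) in
  1024 * ((M * delta) ^+ 2 * p) <= eps ^+ 2 * k%:R /\ 99 * (16 * p) <= k%:R.
Proof.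
move=> l0 d0 e0 ed M1 hk hm p.
have M0 : 0 < M by apply: lt_le_trans M1.
have M3 : 0 < M ^+ 3 by exact: exprn_gt0.
have c0 : 0 < 1024 :> R by rewrite ltr0n.
pose z := m%:R / lambda * delta ^+ 3.
have z0 : 0 <= z by rewrite mulr_ge0 ?divr_ge0 ?exprn_ge0// ltW.
have h : 1024 * (M ^+ 3 * z) <= eps ^+ 2 * k%:R.
  apply: le_trans hk; rewrite mulrA mulrC -ler_pdivlMr ?(mulr_gt0 c0 M3)//.
  apply: (le_trans hm); rewrite le_eqVlt; apply/orP; left; apply/eqP.
  by field; rewrite (gt_eqF M0).
have pE : (M * delta) ^+ 2 * p = M ^+ 3 * z by rewrite /p /z; field; rewrite gt_eqF.
split; first by rewrite pE.
have e2 : 0 < eps ^+ 2 by rewrite exprn_gt0.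
rewrite -(ler_pM2l e2); apply: le_trans h.
have p0 : 0 <= p by rewrite mulr_ge0// divr_ge0 ?mulr_ge0// ltW.
apply: (@le_trans _ _ ((delta / 2) ^+ 2 * (99 * (16 * p)))).
  apply: ler_wpM2r; first exact: mulr_ge0 (ler0n _ _) (mulr_ge0 (ler0n _ _) p0).
  by rewrite lerXn2r ?nnegrE ?(ltW e0)// divr_ge0// ltW.
rewrite (_ : _ * (99 * _) = 396 * (M * z)); last by rewrite /p /z; field; rewrite gt_eqF.
apply: ler_pM.
- exact: ler0n.
- exact: mulr_ge0 (ltW M0) z0.
- by rewrite ler_nat.
- by rewrite ler_wpM2r// -[leLHS]expr1 ler_weXn2l.
Qed.

(** The two-sided bounds also show that the extended real [ell_star] is finite. The constants are
    the squares of 2/3 <= 2 / sqrt (2 pi) and of 7. *)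
Lemma ell_star_sqr_bounds (R : realType) (r k : nat) (eps : R) :
  (0 < r)%N -> 0 < eps -> k%:R * eps ^+ 2 <= r%:R ->
  exists x : R, [/\ ell_star (@ellipsoid R r k eps) = x%:E,
    4 / 9 * r%:R <= x ^+ 2 & x ^+ 2 <= 49 * r%:R].
Proof.
move=> r0 eps0 kr; set E := @ellipsoid R r k eps.
have hU := ell_star_le r0 eps0 kr; have hL := @ell_star_ge R r k eps r0 eps0.
have rS : Num.sqrt r%:R ^+ 2 = r%:R :> R by rewrite sqr_sqrtr.
have sr : 0 <= Num.sqrt r%:R :> R by exact: sqrtr_ge0.
have fE : ell_star E \is a fin_num.
  rewrite fin_numE; apply/andP; split.
    by apply/eqP => e; move: hL; rewrite -/E e leeNy_eq.
  by apply/eqP => e; move: hU; rewrite -/E e leye_eq.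
exists (fine (ell_star E)); rewrite fineK//; move: hU hL.
rewrite -/E -(fineK fE) !lee_fin /=; set x := fine _ => hU hL.
have x1 : 2 / 3 * Num.sqrt r%:R <= x.
  apply: le_trans hL; rewrite ler_wpM2r// ler_wpM2l// lef_pV2 ?posrE ?sqrt2pi_gt0//.
  exact: sqrt2pi_le3.
have s0 : 0 <= 2 / 3 * Num.sqrt r%:R :> R by rewrite mulr_ge0// divr_ge0.
have x0 := le_trans s0 x1.
split => //.
  have : (2 / 3 * Num.sqrt r%:R) ^+ 2 <= x ^+ 2 by rewrite lerXn2r.
  by rewrite exprMn rS; lra.
have : x ^+ 2 <= (7 * Num.sqrt r%:R) ^+ 2 by rewrite lerXn2r// nnegrE mulr_ge0.
by rewrite exprMn rS; lra.
Qed.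

(* [Lam] is the upper constant of lambda ~ sqrt (log (e / delta)), and [a], [b]
   are the constants of theta ~ delta / log (e lambda / delta). *)
Theorem theorem4p6 (R : realType) :
  exists eta0 C : R, [/\ 0 < eta0, 0 < C &
  forall eta Lam a b : R,
    0 < eta -> eta <= eta0 -> C <= Lam -> 0 < a -> a <= b ->
  exists c0 c1 c2 : R, [/\ 0 < c0, 0 < c1, 0 < c2 &
  forall (delta lambda theta eps : R) (r m : nat),
    0 < delta -> delta <= c0 ->
    C * Num.sqrt (ln (expR 1 / delta)) <= lambda ->
    lambda <= Lam * Num.sqrt (ln (expR 1 / delta)) ->
    a * (delta / ln (expR 1 * lambda / delta)) <= theta ->
    theta <= b * (delta / ln (expR 1 * lambda / delta)) ->
    eps = theta / 2 -> 0 < eps -> eps < delta / 2 ->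
    (0 < r)%N -> (0 < m)%N ->
  let k := cardJ eta eps r in
  let E := @ellipsoid R r k eps in
  forall (d : measure_display) (T : measurableType d) (P : probability T R)
    (A : 'I_m -> 'I_(r + k) -> {RV P >-> R}) (tau : 'I_m -> {RV P >-> R}),
    gaussian_dither lambda A tau ->
  ((m%:R%:E <= (c1 * Num.sqrt (ln (expR 1 / delta)))%:E
                 * (ell_star E ^+ 2 * (delta ^+ 3)^-1%:E))%E ->
   with_prob_at_least P (9 / 10) [set w | exists x y : 'cV[R]_(r + k),
     [/\ E x, E y &
         2 * delta <= distortion lambda (random_map A tau w) x y]]) /\
  ((m%:R%:E >= (c2 * Num.sqrt (ln (expR 1 / delta)))%:E
                 * (ell_star E ^+ 2 * (delta ^+ 3)^-1%:E))%E ->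
   with_prob_at_least P (9 / 10) [set w |
     (ereal_sup [set (distortion lambda (random_map A tau w) p.1 p.2)%:E
                | p in E `*` E] <= delta%:E)%E])]].
Proof.
exists 1, 4; split => // eta Lam a b eta0 eta1 Lam4 a0 ab.
have b0 : 0 < b by exact: lt_le_trans ab.
have Lam0 : 0 < Lam by exact: lt_le_trans Lam4.
(* kappa = M delta: when 4 delta m > lambda, the expected band count m kappa / lambda exceeds 1000,
   as [lower_estimate] demands. *)
have [M [M1 M4]] : exists M : R, 1 <= M /\ 4 * 1000 = M by exists (4 * 1000); split => //; lra.
pose q := eta / (2 * (1024 * M ^+ 3)).
have M0 : 0 < M by exact: lt_le_trans M1.
have M3 : 0 < M ^+ 3 by exact: exprn_gt0.
have c1024 : 0 < 1024 :> R by rewrite ltr0n.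
have q0 : 0 < q by exact: divr_gt0 eta0 (mulr_gt0 (ltr0Sn _ 1) (mulr_gt0 c1024 M3)).
clear c1024.
pose H := 16 * (1 + Lam) / a + 2.
have H0 : 0 <= H by rewrite addr_ge0// divr_ge0 ?mulr_ge0// ?addr_ge0// ltW.
(* Q is the sample size in units of lambda r / delta^3. Its lower bounds serve the net, the second
   half of the sparse estimate, and s >= 1. *)
have [Q [Q1 Q2 Q3 Q0]] : exists Q : R,
    [/\ 4608 * (101 + 2 * H) <= Q, 200 * (320 * 1000) <= Q, 100 <= Q & 0 < Q].
  have h1 : 0 <= 4608 * (101 + 2 * H) by apply: (mulr_ge0 (ler0n _ _)); rewrite addr_ge0// mulr_ge0.
  have h2 : 0 <= 200 * (320 * 1000) :> R by exact: mulr_ge0 (ler0n _ _) (mulr_ge0 (ler0n _ _) (ler0n _ _)).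
  move: (4608 * _) (200 * _) h1 h2 => u v h1 h2; exists (u + (v + 100)); split.
  - by rewrite lerDl addr_ge0.
  - by rewrite addrCA lerDl addr_ge0.
  - by rewrite addrA lerDr addr_ge0.
  - by rewrite addrA ltr_wpDl// addr_ge0.
have [B [B1 B2 B3]] : exists B : R,
    [/\ eta^-1 + 1000 <= B, 12 * b <= B & 500 * (400 * b) ^+ 2 <= B].
  have h1 : 0 <= eta^-1 + 1000 by rewrite addr_ge0 ?ler0n// invr_ge0 ltW.
  have h2 : 0 <= 12 * b by rewrite mulr_ge0// ltW.
  have h3 : 0 <= 500 * (400 * b) ^+ 2 by exact: mulr_ge0 (ler0n _ _) (sqr_ge0 _).
  move: (eta^-1 + _) (12 * _) (500 * _) h1 h2 h3 => u v z h1 h2 h3.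
  exists (u + (v + z)); split.
  - by rewrite lerDl addr_ge0.
  - by rewrite addrCA lerDl addr_ge0.
  - by rewrite addrA lerDr addr_ge0.
(* c1 and c2 convert q and Q from the unit lambda r to the unit sqrt L times the squared width: 49
   and 4/9 bound the squared width over r, 4 and Lam bound lambda over sqrt L. *)
exists (expR (- B)), (4 * q / 49), (9 * Lam * Q / 4); split.
- exact: expR_gt0.
- by rewrite divr_gt0// mulr_gt0.
- by rewrite divr_gt0// !mulr_gt0.
move=> delta lambda theta eps r m d0 dB lamL lamU thL thU epsE eps0 epsd r0 m0 k E d T P A tau dither.
have [d1000 deta LB] := small_delta eta0 d0 dB B1.
have B0 : 0 <= B by apply: le_trans B2; rewrite mulr_ge0// ltW.
set L := ln (expR 1 / delta) in lamL lamU LB *.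
have L1 : 1 <= L by apply: le_trans LB; rewrite lerDl.
have LB' : B <= L by apply: le_trans LB; rewrite lerDr.
have d24 : 24 * delta <= 1.
  by apply: le_trans d1000; apply: ler_wpM2r; [exact: ltW|rewrite ler_nat].
have d1 : delta <= 1 by clear - d24 d0; lra.
have l4 := lambda_ge4 L1 lamL.
have l1 : 1 <= lambda by clear - l4; lra.
have l0 : 0 < lambda by clear - l4; lra.
have s1 := sqrt_log_ge1 L1.
have th2 : theta = 2 * eps by rewrite epsE mulrC divfK.
rewrite th2 in thL thU.
have mR : 0 < m%:R :> R by rewrite ltr0n.
have [kr nr kge] : [/\ k%:R * eps ^+ 2 <= r%:R, (r + k)%:R * eps ^+ 2 <= r%:R &
      eta * r%:R / 2 <= eps ^+ 2 * k%:R].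
  apply: cardJ_bounds => //; first by clear - epsd d1; lra.
  apply: le_trans deta; apply: (@le_trans _ _ (delta ^+ 2)); last by rewrite expr2 ler_piMl// ltW.
  have : (2 * eps) ^+ 2 <= delta ^+ 2 by rewrite lerXn2r ?nnegrE ?mulr_ge0 ?(ltW eps0) ?(ltW d0)//; clear - epsd; lra.
  by rewrite exprMn; clear; lra.
have [x [xE xL xU]] := ell_star_sqr_bounds r0 eps0 kr; rewrite -/E in xE.
have d3 : 0 < delta ^+ 3 by rewrite exprn_gt0.
have mE c : (c%:E * (ell_star E ^+ 2 * (delta ^+ 3)^-1%:E) = (c * x ^+ 2 / delta ^+ 3)%:E)%E.
  by rewrite xE -EFin_expe -!EFinM mulrA.
rewrite !mE !lee_fin ler_pdivlMr// ler_pdivrMr//.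
split => hm.
  have hq : m%:R / lambda * delta ^+ 3 <= q * r%:R.
    rewrite mulrAC ler_pdivrMr//; apply: (le_trans hm).
    apply: (@le_trans _ _ (4 * q / 49 * Num.sqrt L * (49 * r%:R))).
      by apply: ler_wpM2l xU; rewrite mulr_ge0 ?sqrtr_ge0// divr_ge0// mulr_ge0// ltW.
    rewrite (_ : _ * (49 * _) = q * r%:R * (4 * Num.sqrt L)); last by field.
    by apply: ler_wpM2l lamL; rewrite mulr_ge0// ltW.
  have [small|large] := leP (4 * delta * m%:R) lambda.
    exists setT; split => //; last by rewrite probability_setT lee_fin; clear; lra.
    move=> w _; apply: small_sample_distortion small => //; last exact: ltW.
    by clear - d24 d0; lra.
  have Md : 0 < M * delta by rewrite mulr_gt0// (lt_le_trans _ M1).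
  have [h1 h2] := lower_sample_size l0 d0 eps0 (ltW epsd) M1 kge hq.
  apply: (@lower_estimate _ _ _ _ _ _ _ lambda delta eps (M * delta)) => //.
  - by apply: le_trans l4; rewrite -M4; clear - d1000; lra.
  - rewrite mulrA ler_pdivlMr// -M4; clear - large; lra.
  - by rewrite -M4; clear - epsd d0; lra.
have hQ : Q * r%:R <= m%:R / lambda * delta ^+ 3.
  rewrite mulrAC ler_pdivlMr//; apply: le_trans hm.
  apply: (@le_trans _ _ (9 * Lam * Q / 4 * Num.sqrt L * (4 / 9 * r%:R))); last first.
    by apply: ler_wpM2l xL; rewrite mulr_ge0 ?sqrtr_ge0// divr_ge0// !mulr_ge0// ltW.
  rewrite [leRHS](_ : _ = Q * r%:R * (Lam * Num.sqrt L)); last by field.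
  by apply: ler_wpM2l lamU; rewrite mulr_ge0// ltW.
have he : 24 * eps <= delta.
  exact: (eps_le_delta d0 L1 lamL eps0 thU b0 (le_trans B2 LB')).
have hel := eps_sqr_log_le d0 L1 lamL eps0 thU (le_trans B3 LB').
have hln := log_eps_le d0 d24 L1 lamL lamU eps0 a0 thL.
have y0 : 0 <= m%:R / lambda by rewrite divr_ge0// ltW.
have c16 : 0 < 1600 :> R by rewrite ltr0n.
have cc : 1600 <= 4608 :> R by rewrite ler_nat.
have [n1 n2] := net_sample_size c16 cc r0 d0 d1 y0 H0 hln hQ Q1.
have [s [t1 t2 t3 t4]] := sparsity_level r0 d0 d1 l1 eps0 nr hQ Q3 erefl hel Q2.
have [V [mV hV PV]] : with_prob_at_least P (9 / 10) [set w | forall x y, E x -> E y ->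
    distortion lambda (random_map A tau w) x y <= delta].
  apply: (upper_estimate dither m0 r0 eps0 _ d0 d1 l1 _ t1 t2 t3 _ _ t4).
  - by rewrite ler_pdivlMr// mulrC.
  - exact: gaussian_tail_le d0 d24 L1 lamL.
  - apply: (le_trans n1); rewrite le_eqVlt; apply/orP; left; apply/eqP.
    by field; rewrite gt_eqF.
  - apply: (le_trans n2); rewrite le_eqVlt; apply/orP; left; apply/eqP.
    by field; rewrite gt_eqF.
exists V; split => // w /hV /= h; apply: ub_ereal_sup => _ [[u v] [Eu Ev] <-].
by rewrite lee_fin; exact: h.
Qed.
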